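(* Let $R_n$ be a generic $n$-rosette and let $[0,2n\pi]\ni\theta\mapsto\gamma(\theta)\in\mathbb{R}^2$ be the parameterization of $R_n$ in the polar-tangential coordinates $(p(\theta),\theta)$. Then (i) there are $2n-1$ branches of the secant caustic of $R_n$: a branch $\mathrm{SC}_k(R_n)$ with parameterization $[0,2n\pi]\ni\theta\mapsto\gamma_{k,n}(\theta):=\gamma(\theta)-\gamma(\theta+k\pi)$ for $k=1,2,\ldots,n$, and a branch $\mathrm{SC}_{n+k}(R_n)$ with parameterization $[0,2n\pi]\ni\theta\mapsto\gamma_{n+k,n}(\theta):=\gamma(\theta+k\pi)-\gamma(\theta)$ for $k=1,2,\ldots,n-1$; (ii) for each $k=1,\ldots,n-1$ we have $\mathcal{R}_{\mathbf{0}}(\mathrm{SC}_k(R_n))=\mathrm{SC}_{n+k}(R_n)$, where $\mathcal{R}_{\mathbf{0}}$ is the point reflection through the origin; (iii) the branch $\mathrm{SC}_n(R_n)$ is centrally symmetric; (iv) the rotation number of each branch of $\mathrm{SC}(R_n)$ is equal to $n$; (v) exactly $n$ branches of $\mathrm{SC}(R_n)$ are rosettes: $\mathrm{SC}_k(R_n)$ for $k$ odd if $n$ is even; $\mathrm{SC}_k(R_n)$, $\mathrm{SC}_{n+k}(R_n)$ for $k$ odd and smaller than $n$, and $\mathrm{SC}_n(R_n)$, if $n$ is odd; (vi) exactly $n-1$ branches of $\mathrm{SC}(R_n)$ are singular: $\mathrm{SC}_k(R_n)$ for $k$ even if $n$ is even; $\mathrm{SC}_k(R_n)$, $\mathrm{SC}_{n+k}(R_n)$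 for $k$ even and smaller than $n$ if $n$ is odd; and the number of cusps in each singular branch is even; (vii) the minimal number of cusps of $\mathrm{SC}(R_n)$ (over generic $n$-rosettes $R_n$) is $2(n-1)$; (viii) if $\mathcal{C}$ is a non-singular branch of $\mathrm{SC}(R_n)$, then $L_{\mathcal{C}}=2L_{R_n}$; (ix) if $\mathcal{C}$ is a singular branch of $\mathrm{SC}(R_n)$, then $L_{\mathcal{C}}\leqslant 2L_{R_n}$; (x) if $k<n$, then $$\widetilde{A}_{\mathrm{SC}_k(R_n)}+4\widetilde{A}_{\mathrm{E}_{\frac12,k}(R_n)}=4\widetilde{A}_{R_n},\qquad \widetilde{A}_{\mathrm{SC}_{n+k}(R_n)}+4\widetilde{A}_{\mathrm{E}_{\frac12,k}(R_n)}=4\widetilde{A}_{R_n},$$ and if $k=n$, then $$\widetilde{A}_{\mathrm{SC}_k(R_n)}+8\widetilde{A}_{\mathrm{E}_{\frac12,k}(R_n)}=4\widetilde{A}_{R_n}.$$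
   Context: An $n$-rosette is a smooth regular oriented closed plane curve with positive curvature and rotation number $n$; a rosette is an $n$-rosette for some $n$. Its generalized support function $p:[0,2n\pi]\to\mathbb{R}$ ($2n\pi$-periodic): $p(\theta)$ is the oriented distance from the origin to the tangent line of $R_n$ at $\gamma(\theta)$ in the direction $(\cos\theta,\sin\theta)$, and in polar-tangential coordinates $$\gamma(\theta)=\big(p(\theta)\cos\theta-p'(\theta)\sin\theta,\ p(\theta)\sin\theta+p'(\theta)\cos\theta\big),\quad \theta\in[0,2n\pi]\text{ (identified modulo }2n\pi).$$ A parallel pair of a curve $M$ is a pair of points $a\neq b$ of $M$ at which the tangent lines are parallel; $\mathrm{SC}(M)=\mathrm{cl}\{a-b: a,b\text{ a parallel pair of }M\}$. For a closed regular curve $f:S^1\to\mathbb{R}^2$, the (smooth) branches of $\mathrm{SC}(M)$ are the parameterized curves obtained by restricting $(s,t)\mapsto f(s)-f(t)$ to the connected components of $\mathrm{cl}\{(s,t)\in S^1\times S^1:s\neq t,\det(f'(s),f'(t))=0\}$; a branch is singular if this parameterization has a singular point. A regular closed curve $f$ is generic if: it has only inflexion points with $\det(f',f''')\neq0$ and no undulation points (points where the curvature vanishes without changing sign); it has only transversal self-crossings; in every parallel pair at least one point is not an inflexion point (point where the curvature changes sign); and if $f(s_1),f(s_2)$, $s_1\neq s_2$, is a parallel pair at which the curvatures, computed for local arc length parameterizations with velocities in the same direction at the two points, are equal, then the arc length derivatives of these curvatures there are different. A cusp is a singular point at which the curve is, up to diffeomorphic changes of parameter and of the plane, $t\mapsto(t^2,t^3)$.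 The rotation number of a branch (a closed curve with at most cusp singularities) is the rotation number of its continuous unit normal vector field $a-b\mapsto\mathbbm{n}(a)$, where $\mathbbm{n}$ is a continuous unit normal field of $R_n$. A curve is centrally symmetric if it is invariant under a point reflection (here, through the origin). $L_C$ is the length of a (parameterized) curve $C$; $\widetilde{A}_C=\frac12\int_C -y\,dx+x\,dy$ is the signed area of the closed oriented curve $C$. The branches of the Wigner caustic of $R_n$ are $\mathrm{E}_{\frac12,k}(R_n)$ for $k=1,\ldots,n-1$, parameterized by $[0,2n\pi]\ni\theta\mapsto\frac12(\gamma(\theta)+\gamma(\theta+k\pi))$, and $\mathrm{E}_{\frac12,n}(R_n)$, parameterized by $[0,n\pi]\ni\theta\mapsto\frac12(\gamma(\theta)+\gamma(\theta+n\pi))$. Lengths and signed areas of branches are computed with the given parameterizations. *)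

(* Defs.v *)
From HB Require Import structures.
From mathcomp Require Import all_boot all_order all_algebra.
From mathcomp Require Import all_classical all_reals all_analysis.
Set Implicit Arguments.
Unset Strict Implicit.
Unset Printing Implicit Defensive.
Import Order.TTheory GRing.Theory Num.Theory.
Import numFieldNormedType.Exports.

Local Open Scope classical_set_scope.
Local Open Scope ring_scope.

(* The plane is R * R; a closed curve is a T-periodic map
   R -> R * R, that is, a map on S^1 = R / T Z. *)

Section Smooth.
Context {R : realType}.

(* Iterated directional derivatives exist and are continuous up to order k. *)
Fixpoint class_C (V W : normedModType R) (k : nat) (A : set V) (F : V -> W)
    : Prop :=
  (forall x, A x -> {for x, continuous F}) /\
  (if k is k'.+1 then
     forall v : V, (forall x, A x -> derivable F x v) /\
                   class_C k' A (fun x => 'D_v F x)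
   else True).

Definition smooth (V W : normedModType R) (A : set V) (F : V -> W) : Prop :=
  forall k, class_C k A F.

Definition local_diffeo (V : normedModType R) (F : V -> V) (x : V) : Prop :=
  exists (A B : set V) (G : V -> V),
    [/\ open A /\ A x, open B, smooth A F /\ smooth B G, F @` A = B &
        forall y, A y -> G (F y) = y].

End Smooth.

Section PlaneCurves.
Context {R : realType}.
Implicit Types (u v : R * R) (c : R -> R * R) (nu : R -> R * R) (T L t : R).

Definition dot u v : R := u.1 * v.1 + u.2 * v.2.
Definition det2 u v : R := u.1 * v.2 - u.2 * v.1.

(* The library norm on R * R is the sup norm. *)
Definition enorm u : R := Num.sqrt (dot u u).

Definition smooth_curve c : Prop := smooth [set: R] c.

Definition closed_curve T c : Prop :=
  [/\ 0 < T, smooth_curve c & forall t, c (t + T) = c t].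

Definition singular_point c t : Prop := derive1 c t = 0.
Definition regular c : Prop := forall t, derive1 c t <> 0.
Definition singular c : Prop := exists t, singular_point c t.

Definition curvature c t : R := det2 (derive1 c t) (derive1n 2 c t) / enorm (derive1 c t) ^+ 3.

(* derivative of the curvature with respect to arc length *)
Definition curvature_deriv c t : R := derive1 (curvature c) t / enorm (derive1 c t).

Definition reverse c : R -> R * R := fun t => c (- t).

Definition changes_sign (g : R -> R) t : Prop :=
  (\forall u \near 0^'+, g (t - u) < 0 < g (t + u)) \/
  (\forall u \near 0^'+, g (t + u) < 0 < g (t - u)).

Definition inflexion c t : Prop := changes_sign (curvature c) t.
Definition undulation c t : Prop :=
  curvature c t = 0 /\ ~ changes_sign (curvature c) t.

(* The point of the circle R / T Z represented by t. *)
Definition circle_pt T t : R * R :=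
  (cos (2 * pi * t / T), sin (2 * pi * t / T)).

Definition parallel_pair c (s t : R) : Prop :=
  c s <> c t /\ det2 (derive1 c s) (derive1 c t) = 0.

(* In the last clause, when the velocities at s and t are opposite, the
   orientation near t is reversed: the point of parameter t on c is the point
   of parameter - t on reverse c. *)
Definition generic T c : Prop :=
  [/\ (forall t, inflexion c t -> det2 (derive1 c t) (derive1n 3 c t) <> 0) /\
      (forall t, ~ undulation c t),
      forall s t, circle_pt T s <> circle_pt T t -> c s = c t ->
        det2 (derive1 c s) (derive1 c t) <> 0,
      forall s t, parallel_pair c s t -> ~ inflexion c s \/ ~ inflexion c t &
      forall s t, parallel_pair c s t ->
        (0 < dot (derive1 c s) (derive1 c t) -> curvature c s = curvature c t ->
           curvature_deriv c s <> curvature_deriv c t) /\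
        (dot (derive1 c s) (derive1 c t) < 0 ->
           curvature c s = curvature (reverse c) (- t) ->
           curvature_deriv c s <> curvature_deriv (reverse c) (- t))].

Definition cusp c t : Prop :=
  singular_point c t /\
  exists (phi : R -> R) (Phi : R * R -> R * R),
    [/\ phi 0 = t, local_diffeo phi (0 : R), local_diffeo Phi (c t) &
        \forall u \near (0 : R), Phi (c (phi u)) = (u ^+ 2, u ^+ 3)].

Definition at_most_cusps c : Prop := forall t, singular_point c t -> cusp c t.

(* one parameter per point of the circle R / L Z *)
Definition cusps L c : set R := [set t | 0 <= t < L /\ cusp c t].

Definition unit_normal_field T c nu : Prop :=
  [/\ continuous nu, forall t, nu (t + T) = nu t, forall t, dot (nu t) (nu t) = 1 &
      forall t, dot (nu t) (derive1 c t) = 0].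

Definition field_rotation_number T nu (m : int) : Prop :=
  exists alpha : R -> R,
    [/\ continuous alpha, forall t, nu t = (cos (alpha t), sin (alpha t)) &
        alpha T - alpha 0 = m%:~R * (2 * pi)].

Definition rotation_number T c (m : int) : Prop :=
  exists2 nu, unit_normal_field T c nu & field_rotation_number T nu m.

Definition n_rosette (n : nat) T c : Prop :=
  [/\ closed_curve T c, regular c, forall t, 0 < curvature c t &
      rotation_number T c n%:Z].

Definition rosette T c : Prop := exists n, n_rosette n T c.

Definition length L c : R :=
  (\int[lebesgue_measure]_(t in `[0, L]) enorm (derive1 c t))%R.

Definition signed_area L c : R :=
  2^-1 * (\int[lebesgue_measure]_(t in `[0, L])
     (- (c t).2 * (derive1 c t).1 + (c t).1 * (derive1 c t).2))%R.

Definition point_reflection v : R * R := - v.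

Definition centrally_symmetric (A : set (R * R)) : Prop :=
  point_reflection @` A = A.

(* The torus S^1 x S^1 is embedded in (R * R) * (R * R) by circle_pt; being
   closed there, it contains the closure below. *)
Definition parallel_locus T c : set ((R * R) * (R * R)) :=
  closure [set z | exists s t : R,
    [/\ z = (circle_pt T s, circle_pt T t), circle_pt T s <> circle_pt T t &
        det2 (derive1 c s) (derive1 c t) = 0]].

Definition SC_components T c : set (set ((R * R) * (R * R))) :=
  [set connected_component (parallel_locus T c) z | z in parallel_locus T c].

(* b : R / L Z -> R * R is the restriction of (s, t) |-> c s - c t to the
   component B, written in a regular parameterization of B. *)
Definition parameterizes_branch T c (B : set ((R * R) * (R * R))) L
    (b : R -> R * R) : Prop :=
  exists s t : R -> R,
    let z := fun x => (circle_pt T (s x), circle_pt T (t x)) in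
    [/\ smooth [set: R] s /\ smooth [set: R] t,
        forall x, derive1 s x <> 0 \/ derive1 t x <> 0,
        forall x, z (x + L) = z x,
        set_bij `[0, L[ B z &
        forall x, b x = c (s x) - c (t x)].

End PlaneCurves.

Section Rosettes.
Context {R : realType}.
Implicit Types (n k : nat) (p : R -> R) (f gamma : R -> R * R).

Definition period n : R := 2 * n%:R * pi.

Definition polar_tangential p (theta : R) : R * R :=
  (p theta * cos theta - derive1 p theta * sin theta,
   p theta * sin theta + derive1 p theta * cos theta).

(* phi changes the parameter of f to the angle theta for which
   (cos theta, sin theta) is the velocity direction rotated by - pi / 2; the
   oriented distance from the origin to the tangent line in the direction
   (cos theta, sin theta) is the scalar product of that vector with any point
   of the line. *)
Definition support_function n (T : R) f p : Prop :=
  exists phi : R -> R,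
    [/\ smooth [set: R] phi /\ (forall theta, 0 < derive1 phi theta),
        forall theta, phi (theta + period n) = phi theta + T,
        forall theta, derive1 f (phi theta) =
          enorm (derive1 f (phi theta)) *: (- sin theta, cos theta) &
        forall theta, p theta = dot (f (phi theta)) (cos theta, sin theta)].

(* parameters of the points a and b of the parallel pair giving the point
   a - b of SC_k *)
Definition SC_fst n k (theta : R) : R :=
  if (k <= n)%N then theta else theta + (k - n)%N%:R * pi.
Definition SC_snd n k (theta : R) : R :=
  if (k <= n)%N then theta + k%:R * pi else theta.

Definition SC n gamma k (theta : R) : R * R :=
  gamma (SC_fst n k theta) - gamma (SC_snd n k theta).

Definition wigner gamma k (theta : R) : R * R :=
  2^-1 *: (gamma theta + gamma (theta + k%:R * pi)).

Definition SC_indices n : set nat := [set k | (1 <= k <= (2 * n).-1)%N].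

(* pairs of a branch and a cusp of it *)
Definition SC_cusps n gamma : set (nat * R) :=
  [set kt | SC_indices n kt.1 /\ cusps (period n) (SC n gamma kt.1) kt.2].

Definition expected_rosettes n : set nat :=
  [set k | SC_indices n k /\
     if odd n
     then [\/ odd k /\ (k < n)%N,
              exists j, [/\ k = (n + j)%N, odd j & (j < n)%N] | k = n]
     else odd k].

Definition expected_singular n : set nat :=
  [set k | SC_indices n k /\
     if odd n
     then (~~ odd k /\ (k < n)%N) \/
          (exists j, [/\ k = (n + j)%N, ~~ odd j, (0 < j)%N & (j < n)%N])
     else ~~ odd k].

End Rosettes.

(* Main.v *)
Require Import Defs.
From HB Require Import structures.
From mathcomp Require Import all_boot all_order all_algebra.
From mathcomp Require Import all_classical all_reals all_analysis.
From mathcomp Require Import ring lra zify.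
Set Implicit Arguments.
Unset Strict Implicit.
Unset Printing Implicit Defensive.
Import Order.TTheory GRing.Theory Num.Theory.
Import numFieldNormedType.Exports.
Local Open Scope classical_set_scope.
Local Open Scope ring_scope.

(* In the angle parameter, gamma' = rho e with e the unit tangent direction and
   rho > 0 a radius of curvature, so that SC_k has velocity
   (rho - (-1)^k rho(. + k pi)) e.  For odd k this never vanishes; for even k it
   has zero sum along theta, theta + k pi, ..., hence a zero, and genericity says
   that all its zeros are simple.  A periodic function with simple zeros has an
   even number of them.  At a simple zero, Hadamard's lemma writes the curve in
   the frame (e, n) as (u^2 X(u), u^3 Y(u)) with X(0), Y(0) nonzero; taking the
   square root of the first coordinate as the parameter and splitting the second
   one into even and odd parts, which Whitney's theorem makes smooth functions of
   the square, straightens it to (u^2, u^3).  Lengths and areas are integrals of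
   periodic functions, invariant under shifts.  The rosette with support function
   1 + cos(theta / n) / 2 has two cusps on each singular branch. *)

(** * Closure properties of smooth maps *)

(** Genericity enters through the curvature [1 / rho] and its arc length derivative
    [- rho' / rho ^ 3]. For even [k] the velocities at [theta] and [theta + k pi] point the same
    way, so a multiple zero of [rho - rho (. + k pi)] would be a parallel pair with equal curvatures
    and equal derivatives; the two points are distinct in the plane because a coincidence with
    parallel tangents would be a non-transversal crossing. Whitney's theorem is forced by the
    definition of a cusp, which asks for a diffeomorphism of the plane: the straightening must be
    smooth in the coordinate [v = w ^ 2], not merely in the parameter [w]. Angles with parallel
    tangents differ by [m pi] with [m] nonzero modulo [2 n], and each of these [2 n - 1] classes is
    one closed loop on the torus; hence the number of branches. In the example the radius is 1 plus
    a multiple of [cos (theta / n)], so for even [k] the speed of [SC_k] is up to sign a multiple of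
    a single shifted sine of [theta / n], with exactly two zeros in [2 n pi]. No curve does better,
    since a nonzero even number is at least 2. *)

Section SmoothTools.
Context {R : realType}.
Implicit Types (V W : normedModType R).

Lemma class_C_continuous V W k (A : set V) (F : V -> W) :
  class_C k A F -> forall x, A x -> {for x, continuous F}.
Proof. by case: k => [|k] []. Qed.

Lemma class_C_derivable V W k (A : set V) (F : V -> W) v :
  class_C k.+1 A F -> forall x, A x -> derivable F x v.
Proof. by move=> [_ /(_ v)[]]. Qed.

Lemma class_C_derive V W k (A : set V) (F : V -> W) v :
  class_C k.+1 A F -> class_C k A (fun x => 'D_v F x).
Proof. by move=> [_ /(_ v)[]]. Qed.

Lemma class_CW V W k (A : set V) (F : V -> W) : class_C k.+1 A F -> class_C k A F.
Proof.
elim: k F => [|k IH] F [cF dF]; split => // v.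
by have [d1 d2] := dF v; split => //; exact: IH.
Qed.

Lemma class_C_sub V W k (A B : set V) (F : V -> W) :
  B `<=` A -> class_C k A F -> class_C k B F.
Proof.
move=> BA; elim: k F => [|k IH] F [cF dF]; split => //.
- by move=> x /BA; exact: cF.
- by move=> x /BA; exact: cF.
- by move=> v; have [d1 d2] := dF v; split => [x /BA|]; [exact: d1|exact: IH].
Qed.

(** Derivatives at a point of [A] see a whole neighbourhood, which openness puts inside [A]. This
    lets the inductions on [k] below replace a directional derivative by its formula. *)
Lemma class_C_ext V W k (A : set V) (F G : V -> W) :
  open A -> (forall x, A x -> F x = G x) -> class_C k A F -> class_C k A G.
Proof.
move=> oA; elim: k F G => [|k IH] F G FG [cF dF].
  split => // x Ax; have := cF x Ax.
  rewrite /continuous_at /prop_for /= -(FG _ Ax) => cFx.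
  apply: cvg_trans cFx; apply: near_eq_cvg; near do apply: FG.
  exact: open_nbhs_nbhs.
have nFG x : A x -> {near x, F =1 G}.
  by move=> Ax; near do apply: FG; exact: open_nbhs_nbhs.
split.
  move=> x Ax; have := cF x Ax.
  rewrite /continuous_at /prop_for /= -(FG _ Ax) => cFx.
  by apply: cvg_trans cFx; apply: near_eq_cvg; exact: nFG.
move=> v; have [d1 d2] := dF v; split.
  by move=> x Ax; apply: near_eq_derivable (nFG _ Ax) _; exact: d1.
by apply: IH d2 => x Ax; apply: near_eq_derive; exact: nFG.
Unshelve. all: by end_near. Qed.

Lemma class_C_cst V W k (A : set V) (w : W) : class_C k A (fun=> w).
Proof.
elim: k w => [|k IH] w; split => //; try by move=> x _; exact: cst_continuous.
move=> v; split => [x _|]; first exact: derivable_cst.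
have -> : (fun x => 'D_v (fun=> w) x) = (fun=> 0 : W); last exact: IH.
by apply/funext => x; exact: derive_cst.
Qed.

Lemma class_CD V W k (A : set V) (F G : V -> W) : open A ->
  class_C k A F -> class_C k A G -> class_C k A (fun x => F x + G x).
Proof.
move=> oA; elim: k F G => [|k IH] F G [cF dF] [cG dG]; split => //.
- by move=> x Ax; apply: cvgD; [exact: cF|exact: cG].
- by move=> x Ax; apply: cvgD; [exact: cF|exact: cG].
move=> v; have [dF1 dF2] := dF v; have [dG1 dG2] := dG v; split.
  by move=> x Ax; apply: derivableD; [exact: dF1|exact: dG1].
apply: (class_C_ext oA _ (IH _ _ dF2 dG2)) => x Ax.
by rewrite -deriveD//; [exact: dF1|exact: dG1].
Qed.

Lemma class_CM V k (A : set V) (F G : V -> R) : open A ->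
  class_C k A F -> class_C k A G -> class_C k A (fun x => F x * G x).
Proof.
move=> oA; elim: k F G => [|k IH] F G CF CG.
  by split => // x Ax; apply: cvgM; [exact: (CF.1 x)|exact: (CG.1 x)].
have [cF dF] := CF; have [cG dG] := CG; split => //.
  by move=> x Ax; apply: cvgM; [exact: cF|exact: cG].
move=> v; have [dF1 dF2] := dF v; have [dG1 dG2] := dG v; split.
  by move=> x Ax; apply: derivableM; [exact: dF1|exact: dG1].
have C1 := IH _ _ (class_CW CF) dG2; have C2 := IH _ _ (class_CW CG) dF2.
apply: (class_C_ext oA _ (class_CD oA C1 C2)) => x Ax.
by rewrite [RHS]deriveM//; [exact: dF1|exact: dG1].
Qed.

(** Only the derivative of [F] along [v] is known, not its differentiability, so the chain rule is
    applied on the line [h *: v + x]. *)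
Lemma is_derive_comp_line V (F : V -> R) (g : R -> R) x v (dF dg : R) :
  is_derive x v F dF -> is_derive (F x) 1 g dg ->
  is_derive x v (fun y => g (F y)) (dg * dF).
Proof.
move=> [F1 F2] [g1 g2].
have line (H : V -> R) : 'D_v H x = 'D_1 (fun h : R => H (h *: v + x)) 0.
  rewrite /derive; set u1 := fun h => h^-1 *: _; set u2 := fun h => h^-1 *: _.
  suff -> : u1 = u2 by [].
  by apply/funext => h; rewrite /u1 /u2 /= addr0 scale0r add0r [_%:A]mulr1.
have L1 : is_derive (0 : R) 1 (fun h : R => F (h *: v + x)) dF.
  apply: DeriveDef; first by move/derivable1P: F1.
  by rewrite -F2 line.
have L2 : is_derive (F ((0 : R) *: v + x)) 1 g dg by rewrite scale0r add0r.
have [L3 L4] := @is_derive1_comp R g (fun h : R => F (h *: v + x)) 0 _ _ L2 L1.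
by apply: DeriveDef; [apply/derivable1P; exact: L3|rewrite line; exact: L4].
Qed.

Lemma class_C_comp V k (A : set V) (B : set R) (F : V -> R) (g : R -> R) :
  open A -> open B -> (forall x, A x -> B (F x)) ->
  class_C k B g -> class_C k A F -> class_C k A (fun x => g (F x)).
Proof.
move=> oA oB AB; elim: k F g AB => [|k IH] F g AB Cg CF.
  split => // x Ax; apply: continuous_comp; first exact: (CF.1 x).
  by apply: Cg.1; exact: AB.
have [cg dg] := Cg; have [cF dF] := CF; split.
  move=> x Ax; apply: continuous_comp; first exact: cF.
  by apply: cg; exact: AB.
move=> v; have [dF1 dF2] := dF v; have [dg1 dg2] := dg 1.
have Dx x : A x -> is_derive x v (fun y => g (F y)) ('D_1 g (F x) * 'D_v F x).
  move=> Ax; apply: is_derive_comp_line; apply: derivableP; first exact: dF1.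
  by apply: dg1; exact: AB.
split; first by move=> x /Dx [].
have C1 := IH _ _ AB dg2 (class_CW CF).
apply: (class_C_ext oA _ (class_CM oA C1 dF2)) => x Ax.
by have [_ ->] := Dx _ Ax.
Qed.

(** [class_C] quantifies over all directions, also on the line; this reduces them to the direction
    1. *)
Lemma derive1_scale (F : R -> R) x v : derivable F x 1 ->
  is_derive x v F (v * 'D_1 F x).
Proof.
move=> dF; rewrite mulrC.
have h : is_derive (0 : R) 1 (fun h : R => h * v + x) v.
  have -> : v = 1 * v + 0 by rewrite mul1r addr0.
  apply: is_deriveD; apply: is_derive_eq; rewrite /GRing.scale /=; ring.
have h2 : is_derive (((0 : R) * v) + x) 1 F ('D_1 F x).
  by rewrite mul0r add0r; exact: derivableP.
have [L3 L4] := @is_derive1_comp R F (fun h : R => h * v + x) 0 _ _ h2 h.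
apply: DeriveDef; first by apply/derivable1P; exact: L3.
rewrite -L4 /derive; set u1 := fun h => h^-1 *: _; set u2 := fun h => h^-1 *: _.
suff -> : u1 = u2 by [].
by apply/funext => e; rewrite /u1 /u2 /= addr0 mul0r add0r [_%:A]mulr1.
Qed.

(** The bootstrapping tool: when the derivative is expressed through functions already known to be
    of class [k], often the function itself, the order rises by one. *)
Lemma class_C_is_derive k (A : set R) (F F' : R -> R) : open A ->
  (forall x, A x -> is_derive x 1 F (F' x)) -> class_C k A F' -> class_C k.+1 A F.
Proof.
move=> oA dF CF'; split.
  move=> x /dF [/derivable1_diffP dx _]; exact: differentiable_continuous.
move=> v; split.
  by move=> x /dF [dx _]; have [] := derive1_scale v dx.
have C1 := class_CM oA (class_C_cst k A v) CF'.
apply: (class_C_ext oA _ C1) => x /dF [dx e].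
by have [_ ->] := derive1_scale v dx; rewrite e.
Qed.

Lemma class_C_derive1 k (A : set R) (F : R -> R) : open A ->
  class_C k.+1 A F -> class_C k A (derive1 F).
Proof.
move=> oA /(class_C_derive (1 : R)) C; apply: (class_C_ext oA _ C) => x _.
by rewrite derive1E.
Qed.

Lemma derivable_continuous1 (F : R -> R) x : derivable F x 1 -> {for x, continuous F}.
Proof. by move=> /derivable1_diffP; exact: differentiable_continuous. Qed.

Lemma is_derive_pair V (W1 W2 : normedModType R) (F : V -> W1) (G : V -> W2) x v dF dG :
  is_derive x v F dF -> is_derive x v G dG ->
  is_derive x v (fun y => (F y, G y)) (dF, dG).
Proof.
move=> [F1 <-] [G1 <-].
have C : (fun h : R => h^-1 *: (((fun y => (F y, G y)) \o shift x) (h *: v) - (F x, G x)))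
    @ 0^' --> (('D_v F x, 'D_v G x) : W1 * W2).
  by apply: cvg_pair.
apply: DeriveDef; first by apply/cvg_ex; exists ('D_v F x, 'D_v G x).
exact/cvg_lim.
Qed.

Lemma is_derive_linear V (W1 W2 : normedModType R) (l : {linear W1 -> W2}) (F : V -> W1) x v d :
  continuous l -> is_derive x v F d -> is_derive x v (fun y => l (F y)) (l d).
Proof.
move=> cl [F1 <-].
have C : (fun h : R => h^-1 *: (((fun y => l (F y)) \o shift x) (h *: v) - l (F x)))
    @ 0^' --> l ('D_v F x).
  under eq_fun do rewrite /= -linearB -linearZ.
  exact: (cvg_comp (fun h : R => h^-1 *: ((F \o shift x) (h *: v) - F x)) l F1 (cl _)).
apply: DeriveDef; first by apply/cvg_ex; eexists; exact: C.
exact/cvg_lim.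
Qed.

Lemma is_derive_fst V (W1 W2 : normedModType R) (F : V -> W1 * W2) x v d :
  is_derive x v F d -> is_derive x v (fun y => (F y).1) d.1.
Proof. by apply: (@is_derive_linear _ _ _ fst) => y; exact: cvg_fst. Qed.

Lemma is_derive_snd V (W1 W2 : normedModType R) (F : V -> W1 * W2) x v d :
  is_derive x v F d -> is_derive x v (fun y => (F y).2) d.2.
Proof. by apply: (@is_derive_linear _ _ _ snd) => y; exact: cvg_snd. Qed.

Lemma class_C_pair V (W1 W2 : normedModType R) k (A : set V) (F : V -> W1) (G : V -> W2) :
  open A -> class_C k A F -> class_C k A G -> class_C k A (fun x => (F x, G x)).
Proof.
move=> oA; elim: k F G => [|k IH] F G [cF dF] [cG dG]; split => //.
- by move=> x Ax; apply: cvg_pair; [exact: cF|exact: cG].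
- by move=> x Ax; apply: cvg_pair; [exact: cF|exact: cG].
move=> v; have [dF1 dF2] := dF v; have [dG1 dG2] := dG v.
have D x : A x -> is_derive x v (fun y => (F y, G y)) ('D_v F x, 'D_v G x).
  by move=> Ax; apply: is_derive_pair; apply: derivableP; [exact: dF1|exact: dG1].
split; first by move=> x /D[].
by apply: (class_C_ext oA _ (IH _ _ dF2 dG2)) => x /D[_ ->].
Qed.

Lemma class_C_linear V (W1 W2 : normedModType R) (l : {linear W1 -> W2}) k (A : set V)
    (F : V -> W1) :
  open A -> continuous l -> class_C k A F -> class_C k A (fun x => l (F x)).
Proof.
move=> oA cl; elim: k F => [|k IH] F [cF dF]; split => //.
- by move=> x Ax; apply: continuous_comp; [exact: cF|exact: cl].
- by move=> x Ax; apply: continuous_comp; [exact: cF|exact: cl].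
move=> v; have [dF1 dF2] := dF v.
have D x : A x -> is_derive x v (fun y => l (F y)) (l ('D_v F x)).
  by move=> Ax; apply: is_derive_linear => //; apply: derivableP; exact: dF1.
split; first by move=> x /D[].
by apply: (class_C_ext oA _ (IH _ dF2)) => x /D[_ ->].
Qed.

Lemma class_C_id V k (A : set V) : class_C k A (fun x => x).
Proof.
case: k => [|k]; split => //; try by move=> x _; exact: cvg_id.
move=> v; split => [x _|]; first exact: derivable_id.
have -> : (fun x => 'D_v (fun x => x) x) = (fun=> v : V); last exact: class_C_cst.
by apply/funext => x; exact: derive_id.
Qed.

Lemma class_CX V k (A : set V) (F : V -> R) n : open A ->
  class_C k A F -> class_C k A (fun x => F x ^+ n).
Proof.
move=> oA CF; elim: n => [|n IH]; first exact: class_C_cst.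
apply: (class_C_ext oA _ (class_CM oA CF IH)) => x _; by rewrite exprS.
Qed.

Lemma class_CZ V k (A : set V) (F : V -> R) c : open A ->
  class_C k A F -> class_C k A (fun x => c * F x).
Proof. by move=> oA CF; apply: class_CM => //; exact: class_C_cst. Qed.

Lemma class_CN V k (A : set V) (F : V -> R) : open A ->
  class_C k A F -> class_C k A (fun x => - F x).
Proof.
move=> oA CF; apply: (class_C_ext oA _ (class_CZ (- 1) oA CF)) => x _.
by rewrite mulN1r.
Qed.

Lemma class_CB V k (A : set V) (F G : V -> R) : open A ->
  class_C k A F -> class_C k A G -> class_C k A (fun x => F x - G x).
Proof. by move=> oA CF CG; apply: class_CD => //; exact: class_CN. Qed.

Lemma class_C_inv k : class_C k [set x : R | x != 0] (fun x : R => x^-1).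
Proof.
have oA : open [set x : R | x != 0] by exact: open_neq.
elim: k => [|k IH]; first by split => // x /= x0; exact: inv_continuous.
have H := class_CN oA (class_CX 2 oA IH).
apply: (class_C_is_derive oA _ H) => x /= x0.
have := @is_deriveV R id x 1 1 x0 (is_derive_id x 1).
by move/is_derive_eq; apply; rewrite /GRing.scale /= mulr1 exprVn.
Qed.

Lemma class_CV V k (A : set V) (F : V -> R) : open A -> (forall x, A x -> F x != 0) ->
  class_C k A F -> class_C k A (fun x => (F x)^-1).
Proof.
move=> oA F0 CF; apply: (class_C_comp oA _ F0 (class_C_inv k) CF).
exact: open_neq.
Qed.

Lemma class_C_sqrt_pos k : class_C k [set x : R | 0 < x] Num.sqrt.
Proof.
have oA : open [set x : R | 0 < x] by exact: open_gt.
elim: k => [|k IH]; first by split => // x _; exact: sqrt_continuous.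
have H : class_C k [set x : R | 0 < x] (fun x => (2 * Num.sqrt x)^-1).
  apply: class_CV => //; last exact: class_CZ.
  by move=> x x0; rewrite mulf_neq0// gt_eqF// sqrtr_gt0.
exact: (class_C_is_derive oA _ H).
Qed.

Lemma class_C_sqrt V k (A : set V) (F : V -> R) : open A -> (forall x, A x -> 0 < F x) ->
  class_C k A F -> class_C k A (fun x => Num.sqrt (F x)).
Proof.
move=> oA F0 CF; apply: (class_C_comp oA _ F0 (class_C_sqrt_pos k) CF).
exact: open_gt.
Qed.

Lemma class_C_cos_sin k (A : set R) : open A -> class_C k A cos /\ class_C k A sin.
Proof.
move=> oA; elim: k => [|k [IHc IHs]].
  by split; split => // x _; [exact: continuous_cos|exact: continuous_sin].
split; last exact: (class_C_is_derive oA _ IHc).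
exact: (class_C_is_derive oA _ (class_CN oA IHs)).
Qed.

Lemma class_C_cos V k (A : set V) (F : V -> R) : open A ->
  class_C k A F -> class_C k A (fun x => cos (F x)).
Proof.
move=> oA CF; apply: (class_C_comp oA openT _ (class_C_cos_sin k openT).1 CF) => //.
Qed.

Lemma class_C_sin V k (A : set V) (F : V -> R) : open A ->
  class_C k A F -> class_C k A (fun x => sin (F x)).
Proof.
move=> oA CF; apply: (class_C_comp oA openT _ (class_C_cos_sin k openT).2 CF) => //.
Qed.

Lemma smooth_derive1 (A : set R) (F : R -> R) : open A -> smooth A F ->
  smooth A (derive1 F).
Proof. by move=> oA sF k; apply: class_C_derive1. Qed.

Lemma smooth_is_derive (A : set R) (F : R -> R) x : smooth A F -> A x ->
  is_derive x 1 F (derive1 F x).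
Proof.
move=> /(_ 1%N) sF Ax; rewrite derive1E; apply: derivableP.
exact: (class_C_derivable sF Ax).
Qed.

Lemma isdD (f g : R -> R) (x a b : R) : is_derive x 1 f a -> is_derive x 1 g b ->
  is_derive x 1 (fun y => f y + g y) (a + b).
Proof. exact: is_deriveD. Qed.

Lemma isdB (f g : R -> R) (x a b : R) : is_derive x 1 f a -> is_derive x 1 g b ->
  is_derive x 1 (fun y => f y - g y) (a - b).
Proof. exact: is_deriveB. Qed.

Lemma isdN (f : R -> R) (x a : R) : is_derive x 1 f a -> is_derive x 1 (fun y => - f y) (- a).
Proof. exact: is_deriveN. Qed.

Lemma isdM (f g : R -> R) (x a b : R) : is_derive x 1 f a -> is_derive x 1 g b ->
  is_derive x 1 (fun y => f y * g y) (a * g x + f x * b).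
Proof.
move=> fa gb; have h := is_deriveM fa gb.
by apply: (is_derive_eq h); rewrite /GRing.scale /=; ring.
Qed.

Lemma isdZ c (f : R -> R) (x a : R) : is_derive x 1 f a -> is_derive x 1 (fun y => c * f y) (c * a).
Proof. exact: is_deriveZ. Qed.

Lemma isdV (f : R -> R) (x a : R) : f x != 0 -> is_derive x 1 f a ->
  is_derive x 1 (fun y => (f y)^-1) (- (f x) ^- 2 * a).
Proof. exact: is_deriveV. Qed.

Lemma isd_comp (f g : R -> R) (x a b : R) : is_derive (g x) 1 f a -> is_derive x 1 g b ->
  is_derive x 1 (fun y => f (g y)) (a * b).
Proof. exact: is_derive1_comp. Qed.

Lemma isd_cst (c x : R) : is_derive x 1 (fun=> c : R) (0 : R).
Proof. exact: is_derive_cst. Qed.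

Lemma isd_id (x : R) : is_derive x 1 (fun y : R => y) (1 : R).
Proof. exact: is_derive_id. Qed.

Lemma isd_exprn n (x : R) : is_derive x 1 (fun y : R => y ^+ n) (n%:R * x ^+ n.-1).
Proof.
apply: DeriveDef; first exact: exprn_derivable.
by rewrite exp_derive /GRing.scale /= mulr1.
Qed.

End SmoothTools.

Section SmoothClosure.
Context {R : realType} {V : normedModType R} (A : set V) (oA : open A).
Implicit Types f g : V -> R.

Lemma smooth_cst (W : normedModType R) (w : W) : smooth A (fun=> w).
Proof. by move=> k; exact: class_C_cst. Qed.

Lemma smooth_id : smooth A (fun x => x).
Proof. by move=> k; exact: class_C_id. Qed.

Lemma smoothD f g : smooth A f -> smooth A g -> smooth A (fun x => f x + g x).
Proof. by move=> sf sg k; exact: class_CD. Qed.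

Lemma smoothN f : smooth A f -> smooth A (fun x => - f x).
Proof. by move=> sf k; exact: class_CN. Qed.

Lemma smoothB f g : smooth A f -> smooth A g -> smooth A (fun x => f x - g x).
Proof. by move=> sf sg k; exact: class_CB. Qed.

Lemma smoothM f g : smooth A f -> smooth A g -> smooth A (fun x => f x * g x).
Proof. by move=> sf sg k; exact: class_CM. Qed.

Lemma smoothX f n : smooth A f -> smooth A (fun x => f x ^+ n).
Proof. by move=> sf k; exact: class_CX. Qed.

Lemma smoothZ c f : smooth A f -> smooth A (fun x => c * f x).
Proof. by move=> sf k; exact: class_CZ. Qed.

Lemma smoothV f : (forall x, A x -> f x != 0) -> smooth A f ->
  smooth A (fun x => (f x)^-1).
Proof. by move=> f0 sf k; exact: class_CV. Qed.

Lemma smooth_sqrt f : (forall x, A x -> 0 < f x) -> smooth A f ->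
  smooth A (fun x => Num.sqrt (f x)).
Proof. by move=> f0 sf k; exact: class_C_sqrt. Qed.

Lemma smooth_cos f : smooth A f -> smooth A (fun x => cos (f x)).
Proof. by move=> sf k; exact: class_C_cos. Qed.

Lemma smooth_sin f : smooth A f -> smooth A (fun x => sin (f x)).
Proof. by move=> sf k; exact: class_C_sin. Qed.

Lemma smooth_pair (W1 W2 : normedModType R) (F : V -> W1) (G : V -> W2) :
  smooth A F -> smooth A G -> smooth A (fun x => (F x, G x)).
Proof. by move=> sF sG k; exact: class_C_pair. Qed.

Lemma smooth_fst (W1 W2 : normedModType R) (F : V -> W1 * W2) :
  smooth A F -> smooth A (fun x => (F x).1).
Proof. by move=> sF k; apply: (@class_C_linear R _ _ _ fst) => // x; exact: cvg_fst. Qed.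

Lemma smooth_snd (W1 W2 : normedModType R) (F : V -> W1 * W2) :
  smooth A F -> smooth A (fun x => (F x).2).
Proof. by move=> sF k; apply: (@class_C_linear R _ _ _ snd) => // x; exact: cvg_snd. Qed.

Lemma smooth_comp (B : set R) f (g : R -> R) : open B -> (forall x, A x -> B (f x)) ->
  smooth B g -> smooth A f -> smooth A (fun x => g (f x)).
Proof. by move=> oB AB sg sf k; exact: (class_C_comp oA oB AB). Qed.

Lemma smooth_ext (W : normedModType R) (F G : V -> W) :
  (forall x, A x -> F x = G x) -> smooth A F -> smooth A G.
Proof. by move=> FG sF k; exact: (class_C_ext oA FG). Qed.

Lemma smooth_sub (B : set V) (W : normedModType R) (F : V -> W) :
  B `<=` A -> smooth A F -> smooth B F.
Proof. by move=> BA sF k; exact: (class_C_sub BA). Qed.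

Lemma smooth_continuous (W : normedModType R) (F : V -> W) x :
  smooth A F -> A x -> {for x, continuous F}.
Proof. by move=> /(_ 0%N)[cF _] Ax; exact: cF. Qed.

End SmoothClosure.

(** * Hadamard's lemma *)

Section Hadamard.
Context {R : realType}.
Implicit Types (d x : R) (f g h r : R -> R).

Definition symball d : set R := [set x | `|x| < d].

Lemma open_symball d : open (symball d).
Proof.
have -> : symball d = ball (0 : R) d; last exact: ball_open.
by apply/funext => x; rewrite /symball /ball /= sub0r normrN.
Qed.

(** The derivative is required only off 0, because the lemma serves to establish differentiability
    at 0. *)
Lemma MVT_symball d f g x :
  (forall y, symball d y -> {for y, continuous f}) ->
  (forall y, symball d y -> y != 0 -> is_derive y 1 f (g y)) ->
  symball d x -> x != 0 ->
  exists c, [/\ c != 0, `|c| < `|x| & f x - f 0 = g c * x].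
Proof.
rewrite /symball /= => cf df xd x0.
have cw a b : (forall y, a <= y <= b -> `|y| < d) -> {within `[a, b], continuous f}.
  move=> ab; apply: continuous_in_subspaceT => y; rewrite inE /= in_itv /= => yab.
  by apply: cf; exact: ab.
have [xp|xn|xe] := ltgtP 0 x; last by rewrite -xe eqxx in x0.
- have [y|y|c] := @MVT _ f g 0 x xp.
  + rewrite in_itv /= => /andP[y0 yx]; apply: df; last by rewrite gt_eqF.
    by rewrite gtr0_norm//; apply: lt_trans yx _; rewrite -(gtr0_norm xp).
  + apply: cw => z /andP[z0 zx]; rewrite ger0_norm//; apply: le_lt_trans zx _.
    by rewrite -(gtr0_norm xp).
  rewrite in_itv /= subr0 => /andP[c0 cx] e; exists c; split => //.
    by rewrite gt_eqF.
  by rewrite !gtr0_norm.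
- have [y|y|c] := @MVT _ f g x 0 xn.
  + rewrite in_itv /= => /andP[y0 yx]; apply: df; last by rewrite lt_eqF.
    by rewrite ltr0_norm//; apply: lt_trans xd; rewrite ltr0_norm// ltrN2.
  + apply: cw => z /andP[z0 zx]; rewrite ler0_norm//; apply: le_lt_trans xd.
    by rewrite ltr0_norm// lerN2.
  rewrite in_itv /= => /andP[c0 cx] e; exists c; split => //.
    by rewrite lt_eqF.
    by rewrite !ltr0_norm// ltrN2.
  by rewrite -opprB e; ring.
Qed.

(** By the mean value theorem the difference quotient at 0 is a value of [g] at a point squeezed to
    0. *)
Lemma is_derive_at0 d f g : 0 < d ->
  (forall y, symball d y -> {for y, continuous f}) ->
  (forall y, symball d y -> y != 0 -> is_derive y 1 f (g y)) ->
  {for 0, continuous g} -> is_derive (0 : R) 1 f (g 0).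
Proof.
move=> d0 cf df cg.
have C : (fun h : R => h^-1 *: ((f \o shift 0) (h *: 1) - f 0)) @ 0^' --> g 0.
  apply/cvgrPdist_lt => e e0.
  move/cvgrPdist_lt : cg => /(_ e e0) /nbhs_ballP[/= b b0 cg].
  rewrite near_withinE; apply/nbhs_ballP; exists (Num.min b d) => /=.
    by rewrite lt_min b0 d0.
  move=> x; rewrite /ball /= sub0r normrN lt_min => /andP[xb xd] x0.
  rewrite addr0 [_%:A]mulr1.
  have [c [c0 cx ->]] := MVT_symball cf df xd x0.
  rewrite /GRing.scale /= mulrCA mulVf// mulr1; apply: cg.
  by rewrite /ball /= sub0r normrN; exact: lt_trans xb.
by apply: DeriveDef; [apply/cvg_ex; eexists; exact: C|exact/cvg_lim].
Qed.

Lemma near_symball_neq0 d x : symball d x -> x != 0 ->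
  \forall y \near x, symball d y /\ y != 0.
Proof.
move=> xd x0; near=> y; split.
  by near: y; apply: open_nbhs_nbhs; split => //; exact: open_symball.
near: y; apply: open_nbhs_nbhs; split; last exact: x0.
exact: open_neq.
Unshelve. all: by end_near. Qed.

(** Meant for [K] vanishing at 0 with derivative [x ^+ n * k x]; the value at 0 is then the limit of
    the quotient. *)
Definition quotient_at0 n (K k : R -> R) : R -> R :=
  fun x => if x == 0 then k 0 / n.+1%:R else K x / x ^+ n.+1.

Lemma quotient_at0_continuous d n K k : 0 < d ->
  (forall x, symball d x -> is_derive x 1 K (x ^+ n * k x)) -> K 0 = 0 ->
  (forall x, symball d x -> {for x, continuous k}) ->
  forall x, symball d x -> {for x, continuous (quotient_at0 n K k)}.
Proof.
move=> d0 dK K0 ck x xd; have [->|x0] := eqVneq x 0; last first.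
  have H : {for x, continuous (fun y => K y / y ^+ n.+1)}.
    apply: cvgM; first by apply: derivable_continuous1; have [] := dK _ xd.
    by apply: cvgV; [rewrite expf_neq0|exact: exprn_continuous].
  rewrite /continuous_at /prop_for /= {2}/quotient_at0 (negPf x0).
  apply: cvg_trans H; apply: near_eq_cvg.
  have := near_symball_neq0 xd x0; apply: filterS => y [_ y0].
  by rewrite /quotient_at0 (negPf y0).
have zd : symball d 0 by rewrite /symball /= normr0.
apply/cvgrPdist_le => e e0.
have := ck _ zd; move/cvgrPdist_le => /(_ e e0) /nbhs_ballP[/= b b0 ckb].
apply/nbhs_ballP; exists (Num.min b d) => /=; first by rewrite lt_min b0 d0.
move=> y; rewrite /ball /= sub0r normrN lt_min => /andP[yb yd].
rewrite {1}/quotient_at0 eqxx; have [->|y0] := eqVneq y 0.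
  by rewrite /quotient_at0 eqxx subrr normr0 ltW.
rewrite /quotient_at0 (negPf y0).
(* Without its leading term, [K] has derivative [z ^+ n * (k z - k 0)], whose second factor is small
   near 0. *)
pose D := fun z => K z - k 0 / n.+1%:R * z ^+ n.+1.
have dD z : symball d z -> is_derive z 1 D (z ^+ n * (k z - k 0)).
  move=> zd'; have H := isdB (dK _ zd') (isdZ (k 0 / n.+1%:R) (isd_exprn n.+1 z)).
  apply: (is_derive_eq H).
  by have : n.+1%:R != 0 :> R by []; move=> nn; field.
have [||c [c0 cy]] := @MVT_symball d D (fun z => z ^+ n * (k z - k 0)) y _ _ yd y0.
- by move=> z /dD [h _]; exact: derivable_continuous1.
- by move=> z /dD.
rewrite /D K0 expr0n /= mulr0 subrr subr0 => E.
have -> : k 0 / n.+1%:R - K y / y ^+ n.+1 = - (K y - k 0 / n.+1%:R * y ^+ n.+1) / y ^+ n.+1.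
  by rewrite mulNr mulrBl mulfK ?expf_neq0//; ring.
rewrite E normrM normfV ler_pdivrMr ?normr_gt0 ?expf_neq0//.
rewrite normrN 2!normrM exprSr normrM mulrA ler_pM2r ?normr_gt0// mulrC.
apply: ler_pM => //.
  by rewrite distrC; apply: ckb; rewrite /ball /= sub0r normrN; exact: lt_trans yb.
by rewrite !normrX lerXn2r ?nnegrE// ltW.
Qed.

(** The derivative of such a quotient is a quotient of the same kind, with [n.+1] for [n] and
    [derive1 k] for [k]. Hence an induction on [m] with [n], [K] and [k] free proves Hadamard's
    lemma without differentiating under an integral. *)
Lemma quotient_at0_class_C m d n K k : 0 < d ->
  (forall x, symball d x -> is_derive x 1 K (x ^+ n * k x)) -> K 0 = 0 ->
  class_C m (symball d) k -> class_C m (symball d) (quotient_at0 n K k).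
Proof.
move=> d0; elim: m n K k => [|m IH] n K k dK K0 Ck.
  by split => //; apply: quotient_at0_continuous => //; exact: Ck.1.
have ck : forall x, symball d x -> {for x, continuous k} by exact: Ck.1.
have dk x : symball d x -> is_derive x 1 k (derive1 k x).
  by move=> xd; rewrite derive1E; apply: derivableP; exact: (class_C_derivable Ck xd).
have Ck' := class_C_derive1 (@open_symball d) Ck.
(* [K2] is the numerator of the derivative of [K / x ^+ n.+1] over [x ^+ n.+2]; in its own
   derivative the terms in [x ^+ n * k x] cancel. *)
pose K2 x := x ^+ n.+1 * k x - n.+1%:R * K x.
have dK2 x : symball d x -> is_derive x 1 K2 (x ^+ n.+1 * derive1 k x).
  move=> xd; have h := isdB (isdM (isd_exprn n.+1 x) (dk _ xd)) (isdZ n.+1%:R (dK _ xd)).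
  by apply: (is_derive_eq h) => /=; ring.
have K20 : K2 0 = 0 by rewrite /K2 K0 expr0n /= mul0r mulr0 subrr.
have C2 := IH _ _ _ dK2 K20 Ck'.
apply: (class_C_is_derive (@open_symball d) _ C2) => x xd.
have off0 y : symball d y -> y != 0 ->
    is_derive y 1 (quotient_at0 n K k) (quotient_at0 n.+1 K2 k^`()%classic y).
  move=> yd y0; rewrite /quotient_at0 (negPf y0).
  have hV := @isdV R (fun z => z ^+ n.+1) y _ (expf_neq0 n.+1 y0) (isd_exprn n.+1 y).
  have hM := isdM (dK _ yd) hV.
  apply: (@near_eq_is_derive _ _ _ (fun z => K z / z ^+ n.+1)).
    have := near_symball_neq0 yd y0; apply: filterS => z [_ z0].
    by rewrite (negPf z0).
  apply: (is_derive_eq hM); rewrite /K2 /= (exprS y n.+1) !(exprS y n).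
  have : y ^+ n != 0 by rewrite expf_neq0.
  by move: (y ^+ n) => z z0; field; rewrite y0 z0.
have [->|x0] := eqVneq x 0; last exact: off0.
apply: (is_derive_at0 d0 _ off0); first exact: quotient_at0_continuous.
by apply: (class_C_continuous C2); rewrite /symball /= normr0.
Qed.

Lemma smooth_div_id d h : 0 < d -> smooth (symball d) h -> h 0 = 0 ->
  exists2 r, smooth (symball d) r & forall x, h x = x * r x.
Proof.
move=> d0 sh h0; exists (quotient_at0 0 h (derive1 h)).
  move=> m; apply: quotient_at0_class_C => //.
    by move=> x xd; rewrite expr0 mul1r; exact: smooth_is_derive sh xd.
  by apply: class_C_derive1; [exact: open_symball|exact: sh].
move=> x; rewrite /quotient_at0; have [->|x0] := eqVneq x 0; first by rewrite mul0r.
by rewrite expr1 mulrCA divff// mulr1.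
Qed.

End Hadamard.

(** * Whitney's theorem on smooth even functions *)

Section BoundedDerivatives.
Context {R : realType}.
Implicit Types (f g h : R -> R).

Lemma derive1n_smooth j g : smooth [set: R] g -> smooth [set: R] (derive1n j g).
Proof.
move=> sg; elim: j => [|j IH]; first by [].
by rewrite derive1nS; apply: smooth_derive1 => //; exact: openT.
Qed.

Lemma is_derive1n j g (x : R) : smooth [set: R] g ->
  is_derive x 1 (derive1n j g) (derive1n j.+1 g x).
Proof.
move=> sg; rewrite derive1nS; apply: (@smooth_is_derive _ setT) => //.
exact: derive1n_smooth.
Qed.

Lemma derive1_is_derive g g' : (forall x : R, is_derive x 1 g (g' x)) -> derive1 g = g'.
Proof. by move=> dg; apply/funext => x; rewrite derive1E; have [_ ->] := dg x. Qed.

Lemma derive1nD j f g : smooth [set: R] f -> smooth [set: R] g ->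
  derive1n j (fun x => f x + g x) = (fun x => derive1n j f x + derive1n j g x).
Proof.
move=> sf sg; elim: j => [//|j IH]; rewrite derive1nS IH.
by apply: derive1_is_derive => x; apply: isdD; exact: is_derive1n.
Qed.

Lemma derive1nZ_scale j c lam f : smooth [set: R] f ->
  derive1n j (fun x => c * f (lam * x)) =
  (fun x => c * lam ^+ j * derive1n j f (lam * x)).
Proof.
move=> sf; elim: j => [|j IH]; first by apply/funext => x; rewrite expr0 mulr1.
rewrite derive1nS IH; apply: derive1_is_derive => x.
have h := @isd_comp _ (derive1n j f) (fun x => lam * x) x _ _
  (is_derive1n j (lam * x) sf) (isdZ lam (isd_id x)).
by apply: (is_derive_eq (isdZ (c * lam ^+ j) h)); rewrite exprSr; ring.
Qed.

Definition bounded_derivatives (k : nat) g :=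
  forall j, (j <= k)%N -> exists M, forall x : R, `|derive1n j g x| <= M.

Lemma bounded_derivativesW k g : bounded_derivatives k.+1 g -> bounded_derivatives k g.
Proof. by move=> bg j jk; apply: bg; rewrite (leq_trans jk). Qed.

Lemma bounded_derivatives_derive1 k g :
  bounded_derivatives k.+1 g -> bounded_derivatives k (derive1 g).
Proof. by move=> bg j jk; rewrite -derive1Sn; exact: bg. Qed.

Lemma bounded_derivativesD k f g : smooth [set: R] f -> smooth [set: R] g ->
  bounded_derivatives k f -> bounded_derivatives k g ->
  bounded_derivatives k (fun x => f x + g x).
Proof.
move=> sf sg bf bg j jk; have [M hM] := bf j jk; have [N hN] := bg j jk.
exists (M + N) => x; rewrite derive1nD//.
by apply: le_trans (ler_normD _ _) _; exact: lerD.
Qed.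

Lemma bounded_derivativesS k g g' :
  (exists M, forall x : R, `|g x| <= M) -> (forall x : R, is_derive x 1 g (g' x)) ->
  bounded_derivatives k g' -> bounded_derivatives k.+1 g.
Proof.
by move=> b0 /derive1_is_derive e b' [_|j jk] //; rewrite derive1Sn e; exact: b'.
Qed.

Lemma bounded_derivativesM k f g : smooth [set: R] f -> smooth [set: R] g ->
  bounded_derivatives k f -> bounded_derivatives k g ->
  bounded_derivatives k (fun x => f x * g x).
Proof.
elim: k f g => [|k IH] f g sf sg bf bg.
  move=> [|//] _; have [M hM] := bf 0%N isT; have [N hN] := bg 0%N isT.
  by exists (M * N) => x; rewrite normrM; apply: ler_pM.
have d0 := @smooth_derive1 _ setT _ openT.
have dd (x : R) : is_derive x 1 (fun x => f x * g x) (derive1 f x * g x + f x * derive1 g x).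
  by apply: isdM; exact: (@is_derive1n 0).
apply: bounded_derivativesS dd _.
- have [M hM] := bf 0%N isT; have [N hN] := bg 0%N isT.
  by exists (M * N) => x; rewrite normrM; apply: ler_pM.
- apply: bounded_derivativesD; [apply: smoothM|apply: smoothM|apply: IH|apply: IH];
  rewrite //; try exact: openT; try exact: d0;
  try exact: bounded_derivativesW; exact: bounded_derivatives_derive1.
Qed.

Lemma bounded_derivatives_cst k c : bounded_derivatives k (fun=> c).
Proof.
have d0 (e : R) : derive1 (fun=> e : R) = fun=> 0 by apply/funext => x; exact: derive1_cst.
move=> i _; exists `|c| => x; case: i => [//|i].
rewrite derive1Sn d0; elim: i x => [|i IH] x; first by rewrite normr0.
by rewrite derive1Sn d0.
Qed.

(** A rational cutoff for Borel's construction in place of one with compact support: what matters is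
    that it equals 1 at 0 and that [x * bump x] and its powers have bounded derivatives of all
    orders. *)
Definition bump (x : R) := (1 + x ^+ 2)^-1.
Definition xbump (x : R) := x * bump x.

Lemma bump_den_neq0 (x : R) : 1 + x ^+ 2 != 0.
Proof. by rewrite gt_eqF// ltr_pwDl// sqr_ge0. Qed.

Lemma smooth_bump : smooth [set: R] bump.
Proof.
move=> k; apply: class_CV; [exact: openT|by move=> x _; exact: bump_den_neq0|].
apply: class_CD; [exact: openT|exact: class_C_cst|apply: class_CX; [exact: openT|]].
exact: class_C_id.
Qed.

Lemma smooth_xbump : smooth [set: R] xbump.
Proof. by move=> k; apply: class_CM; [exact: openT|exact: class_C_id|exact: smooth_bump]. Qed.

Lemma bump_le1 (x : R) : `|bump x| <= 1.
Proof.
rewrite /bump normfV ger0_norm ?addr_ge0 ?sqr_ge0//.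
by rewrite invf_le1 ?lerDl ?sqr_ge0// ltr_pwDl// sqr_ge0.
Qed.

Lemma xbump_le1 (x : R) : `|xbump x| <= 1.
Proof.
rewrite /xbump /bump normrM normfV [X in _ / X]ger0_norm ?addr_ge0 ?sqr_ge0//.
rewrite ler_pdivrMr ?ltr_pwDl ?sqr_ge0// mul1r -[x ^+ 2]real_normK ?num_real//.
by have := normr_ge0 x; set y := `|x| => y0; nra.
Qed.

Lemma xbump_le_id (x : R) : `|xbump x| <= `|x|.
Proof. by rewrite normrM ler_piMr// bump_le1. Qed.

(** The derivatives of [bump] and [xbump] are polynomials in these two functions, so both bounds are
    proved by one induction. *)
Lemma bounded_bump k : bounded_derivatives k bump /\ bounded_derivatives k xbump.
Proof.
have du (x : R) : is_derive x 1 bump (- 2 * (xbump x * bump x)).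
  have h := @isdV _ (fun x => 1 + x ^+ 2) x _ (bump_den_neq0 x)
    (isdD (isd_cst 1 x) (isd_exprn 2 x)).
  apply: (is_derive_eq h); rewrite /xbump /bump.
  by have := bump_den_neq0 x => xn; field.
have dv (x : R) : is_derive x 1 xbump (bump x + - 2 * (xbump x * xbump x)).
  apply: (is_derive_eq (isdM (isd_id x) (du x))).
  by rewrite /xbump /bump; ring.
have bc := bounded_derivatives_cst.
have sc (c : R) : smooth [set: R] (fun=> c) by move=> j; exact: class_C_cst.
have o : open [set: R] by exact: openT.
have := smooth_bump; have := smooth_xbump => sv su.
have sMM f g : smooth [set: R] f -> smooth [set: R] g ->
  smooth [set: R] (fun x => - 2 * (f x * g x)).
  by move=> sf sg; apply: smoothM => //; apply: smoothM.
elim: k => [|k [IHu IHv]].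
  by split; move=> [|//] _; exists 1; [exact: bump_le1|exact: xbump_le1].
have bMM f g : smooth [set: R] f -> smooth [set: R] g ->
    bounded_derivatives k f -> bounded_derivatives k g ->
    bounded_derivatives k (fun x => - 2 * (f x * g x)).
  move=> sf sg bf bg; apply: bounded_derivativesM => //; first exact: smoothM.
  exact: bounded_derivativesM.
split.
  apply: bounded_derivativesS du _; first by exists 1; exact: bump_le1.
  exact: bMM.
apply: bounded_derivativesS dv _; first by exists 1; exact: xbump_le1.
by apply: bounded_derivativesD => //; [exact: sMM|exact: bMM].
Qed.

Lemma bounded_xbumpX n k : bounded_derivatives k (fun x => xbump x ^+ n).
Proof.
elim: n => [|n IH].
  exact: bounded_derivatives_cst.
have -> : (fun x => xbump x ^+ n.+1) = fun x => xbump x * xbump x ^+ n.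
  by apply/funext => x; rewrite exprS.
apply: bounded_derivativesM => //; first exact: smooth_xbump.
  by apply: smoothX; [exact: openT|exact: smooth_xbump].
exact: (bounded_bump k).2.
Qed.

End BoundedDerivatives.

(** * Smooth sums of series by termwise differentiation *)

Section SmoothSeries.
Context {R : realType}.
Implicit Types (f g h : R -> R).

Lemma MVT_dist f f' (a b : R) : (forall x : R, is_derive x 1 f (f' x)) ->
  exists2 c, `|c - a| <= `|b - a| & f b - f a = f' c * (b - a).
Proof.
move=> df; have cf x y : {within `[x, y], continuous f}.
  apply: continuous_subspaceT => z.
  by apply: derivable_continuous1; have [] := df z.
have [ab|ba|<-] := ltgtP a b; last by exists a; rewrite // !subrr mulr0.
- have [|c] := @MVT _ f f' a b ab; first exact: cf.
  rewrite in_itv /= => /andP[ac cb] e; exists c => //.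
  by rewrite !gtr0_norm ?subr_gt0// lerD2r ltW.
- have [|c] := @MVT _ f f' b a ba; first exact: cf.
  rewrite in_itv /= => /andP[bc ca] e; exists c => //.
    by rewrite !ltr0_norm ?subr_lt0// lerN2 lerD2r ltW.
  by rewrite -opprB e -mulrN opprB.
Qed.

(** Two uses of the mean value theorem give the constant [M] in place of the sharp [M / 2], which is
    enough for summation. *)
Lemma taylor1_le f f1 f2 (M s h : R) : (forall x : R, is_derive x 1 f (f1 x)) ->
  (forall x : R, is_derive x 1 f1 (f2 x)) -> (forall x, `|f2 x| <= M) ->
  `|f (s + h) - f s - h * f1 s| <= M * h ^+ 2.
Proof.
move=> d1 d2 bM; have [c cs] := MVT_dist s (s + h) d1.
have -> : s + h - s = h by ring.
move=> ->; have [e ec E] := MVT_dist s c d2.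
have -> : f1 c * h - h * f1 s = h * (f1 c - f1 s) by ring.
rewrite E !normrM -[h ^+ 2]real_normK ?num_real// expr2.
rewrite mulrCA ler_pM// ?mulr_ge0// ler_pM//.
by apply: le_trans cs _; rewrite (_ : s + h - s = h)//; ring.
Qed.

Lemma is_derive_quadratic f (D B s : R) :
  (forall h : R, `|f (s + h) - f s - h * D| <= B * h ^+ 2) -> is_derive s 1 f D.
Proof.
move=> H.
have B0 : 0 <= B by have := H 1; rewrite expr1n mulr1; exact: le_trans.
have C : (fun h : R => h^-1 *: ((f \o shift s) (h *: 1) - f s)) @ 0^' --> D.
  apply/cvgrPdist_le => e e0.
  (* The added 1 keeps the radius meaningful when [B] is 0. *)
  rewrite near_withinE; apply/nbhs_ballP; exists (e / (B + 1)) => /=.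
    by rewrite divr_gt0// ltr_wpDl.
  move=> h; rewrite /ball /= sub0r normrN => hb h0.
  rewrite [_%:A]mulr1 /GRing.scale /= [h + s]addrC.
  have -> : D - h^-1 * (f (s + h) - f s) = - (f (s + h) - f s - h * D) / h by field.
  rewrite normrM normrN normfV ler_pdivrMr ?normr_gt0//.
  apply: le_trans (H h) _; rewrite -[h ^+ 2]real_normK ?num_real// expr2 mulrA.
  rewrite ler_wpM2r//; move: hb; rewrite ltr_pdivlMr ?ltr_wpDl// => /ltW.
  by apply: le_trans; rewrite mulrDr mulr1 mulrC lerDl.
by apply: DeriveDef; [apply/cvg_ex; eexists; exact: C|exact/cvg_lim].
Qed.

Lemma cvg_series_dominated (u b : R ^nat) (B : R) :
  (forall k, `|u k| <= b k) -> (forall n, \sum_(0 <= k < n) b k <= B) ->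
  cvg (series u @ \oo).
Proof.
move=> ub bB; apply: normed_cvg; apply: nondecreasing_is_cvgn.
  by apply: nondecreasing_series => i _ _; exact: normr_ge0.
exists B => _ [n _ <-]; apply: le_trans (bB n); rewrite /series /=.
exact: ler_sum.
Qed.

(** Uniform convergence is replaced by remainders of second order: they add up to at most
    [B * h ^+ 2] for every partial sum, and the bound passes to the limit. *)
Lemma is_derive_series (u u' : nat -> R -> R) (b : nat -> R) (B : R) :
  (forall k (s h : R), `|u k (s + h) - u k s - h * u' k s| <= b k * h ^+ 2) ->
  (forall n, \sum_(0 <= k < n) b k <= B) ->
  (forall s, cvg (series (u ^~ s) @ \oo)) -> (forall s, cvg (series (u' ^~ s) @ \oo)) ->
  forall s : R, is_derive s 1 (fun s => lim (series (u ^~ s) @ \oo))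
                           (lim (series (u' ^~ s) @ \oo)).
Proof.
move=> H bB cu cu' s; apply: (is_derive_quadratic (B := B)) => h.
have C : (fun n => `|series (u ^~ (s + h)) n - series (u ^~ s) n -
     h * series (u' ^~ s) n|) @ \oo -->
   `|lim (series (u ^~ (s + h)) @ \oo) - lim (series (u ^~ s) @ \oo) -
     h * lim (series (u' ^~ s) @ \oo)|.
  by apply: cvg_norm; apply: cvgB; [apply: cvgB; exact: cu|apply: cvgMr; exact: cu'].
rewrite -(cvg_lim _ C)//; apply: limr_le; first by apply/cvg_ex; eexists; exact: C.
apply: nearW => n; rewrite /series /= mulr_sumr -!sumrB.
apply: le_trans (ler_norm_sum _ _ _) _.
apply: le_trans (_ : \sum_(0 <= k < n) b k * h ^+ 2 <= _); first exact: ler_sum.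
by rewrite -mulr_suml ler_wpM2r ?sqr_ge0.
Qed.

Lemma smooth_series (w : nat -> R -> R) :
  (forall k, smooth [set: R] (w k)) ->
  (forall j, exists b B, (forall k s, `|derive1n j (w k) s| <= b k) /\
     forall n, \sum_(0 <= k < n) b k <= B) ->
  exists2 W, smooth [set: R] W & forall s, series (w ^~ s) @ \oo --> W s.
Proof.
move=> sw bw; pose W j s := lim (series (fun k => derive1n j (w k) s) @ \oo).
have cW j s : cvg (series (fun k => derive1n j (w k) s) @ \oo).
  have [b [B [h1 h2]]] := bw j.
  by apply: cvg_series_dominated h2 => k; exact: h1.
have dW j (s : R) : is_derive s 1 (W j) (W j.+1 s).
  (* The remainder of the [j]-th derivatives of the terms is controlled by their derivatives of
     order [j.+2]. *)
  have [b [B [h1 h2]]] := bw j.+2.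
  apply: (@is_derive_series (fun k => derive1n j (w k)) (fun k => derive1n j.+1 (w k)) b B) => //.
  move=> k x h; apply: taylor1_le; last exact: h1.
    by move=> y; exact: is_derive1n.
  by move=> y; exact: is_derive1n.
have CW m : forall j, class_C m setT (W j).
  elim: m => [|m IH] j.
    by split => // x _; apply: derivable_continuous1; have [] := dW j x.
  by apply: (class_C_is_derive openT _ (IH j.+1)) => x _; exact: dW.
exists (W 0%N); first by move=> m; exact: CW.
by move=> s; exact: cW.
Qed.

Lemma uniform_bound (F : nat -> R -> R) i : (forall j, exists M, forall s, `|F j s| <= M) ->
  exists2 M, 0 <= M & forall j s, (j <= i)%N -> `|F j s| <= M.
Proof.
move=> bF; elim: i => [|i [M M0 hM]].
  have [M hM] := bF 0%N; exists `|M| => // j s; rewrite leqn0 => /eqP ->.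
  by apply: le_trans (hM s) _; exact: ler_norm.
have [N hN] := bF i.+1; exists (M + `|N|); first by rewrite addr_ge0.
move=> j s; rewrite leq_eqVlt => /orP[/eqP ->|ji].
  by apply: le_trans (hN s) _; rewrite ler_wpDl// ler_norm.
by apply: le_trans (hM _ s ji) _; rewrite lerDl.
Qed.

Lemma sum_geometric_half n : \sum_(0 <= k < n) (2^-1 : R) ^+ k <= 2.
Proof.
have : \sum_(0 <= k < n) (2^-1 : R) ^+ k = 2 - 2 * 2^-1 ^+ n.
  elim: n => [|n IH]; first by rewrite big_nil expr0; ring.
  by rewrite big_nat_recr//= IH exprS; field.
by move=> ->; rewrite gerBl mulr_ge0// exprn_ge0// invr_ge0.
Qed.

Lemma smooth_series_half (w : nat -> R -> R) :
  (forall k, smooth [set: R] (w k)) ->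
  (forall k j, exists M, forall s, `|derive1n j (w k) s| <= M) ->
  (forall k j s, (j < k)%N -> `|derive1n j (w k) s| <= 2^-1 ^+ k) ->
  exists2 W, smooth [set: R] W & forall s, series (w ^~ s) @ \oo --> W s.
Proof.
move=> sw bw hw; apply: smooth_series => // j.
have [M M0 hM] := uniform_bound j (bw ^~ j).
(* For fixed [j] only the terms with [k <= j] escape the geometric bound; there
   [M <= M * 2 ^+ j * 2^-1 ^+ k], so one constant serves all [k]. *)
pose K := 1 + M * 2 ^+ j; exists (fun k => K * 2^-1 ^+ k), (K * 2); split.
  have p k : 0 < (2^-1 : R) ^+ k by rewrite exprn_gt0// invr_gt0.
  have q k : 0 < (2 : R) ^+ k by rewrite exprn_gt0.
  move=> k s; have [kj|jk] := leqP k j.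
    apply: le_trans (hM k s kj) _; rewrite /K mulrDl mul1r ler_wpDl ?(ltW (p k))//.
    rewrite -mulrA ler_peMr// exprVn ler_pdivlMr// mul1r.
    by rewrite ler_weXn2l// ler1n.
  apply: le_trans (hw _ _ s jk) _; rewrite ler_peMl ?(ltW (p k))// /K lerDl.
  by rewrite mulr_ge0// ltW.
move=> n; rewrite -mulr_sumr ler_wpM2l ?sum_geometric_half//.
by rewrite /K addr_ge0// mulr_ge0// exprn_ge0.
Qed.

End SmoothSeries.

(** * Borel's construction, flat functions and smooth functions of the square *)

Section Whitney.
Context {R : realType}.
Implicit Types (d : R) (f g h r : R -> R).

Definition even_fun g := forall x : R, g (- x) = g x.

Lemma vanish_at0 g : {for 0, continuous g} -> (forall x : R, x != 0 -> g x = 0) -> g 0 = 0.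
Proof.
move=> cg g0.
have C1 : g x @[x --> 0^'] --> g 0 by exact: cvg_within_filter cg.
have C2 : g x @[x --> 0^'] --> (0 : R).
  apply: (@cvg_trans _ ((fun=> 0 : R) @ (0 : R)^')); last exact: cvg_cst.
  by apply: near_eq_cvg; rewrite near_withinE; apply: nearW => x x0; rewrite g0.
exact: (cvg_unique (@norm_hausdorff _ _) C1 C2).
Qed.

Lemma symball0 d : 0 < d -> symball d 0.
Proof. by rewrite /symball /= normr0. Qed.

Lemma near_symball d : 0 < d -> \forall x \near (0 : R), symball d x.
Proof. by move=> d0; apply: open_nbhs_nbhs; split; [exact: open_symball|exact: symball0]. Qed.

(** Hadamard's lemma applies twice: the first quotient of an even function is odd off 0, hence by
    continuity vanishes at 0 and can be divided again. *)
Lemma even_div_sq d e : 0 < d -> smooth (symball d) e -> even_fun e -> e 0 = 0 ->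
  exists r, [/\ smooth (symball d) r, even_fun r & forall x, e x = x ^+ 2 * r x].
Proof.
move=> d0 se ee e0; have [r1 s1 E1] := smooth_div_id d0 se e0.
have odd1 x : x != 0 -> r1 (- x) = - r1 x.
  move=> x0; have := ee x; rewrite !E1 mulNr -mulrN => /(mulfI x0) <-.
  by rewrite opprK.
have c1 : {for 0, continuous r1}.
  by apply: (smooth_continuous s1); exact: symball0.
have r10 : r1 0 = 0.
  have : r1 0 + r1 (- 0) = 0.
    apply: (@vanish_at0 (fun x => r1 x + r1 (- x))); last first.
      by move=> x /odd1 ->; rewrite subrr.
    apply: cvgD => //; apply: continuous_comp; first exact: oppr_continuous.
    by rewrite oppr0.
  by rewrite oppr0 => h; lra.
have [r2 s2 E2] := smooth_div_id d0 s1 r10.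
exists r2; split => // x; last by rewrite E1 E2 expr2 mulrA.
have [->|x0] := eqVneq x 0; first by rewrite oppr0.
have := odd1 _ x0; rewrite !E2 mulNr => /oppr_inj; exact: mulfI.
Qed.

(** Since [j < k], at least one factor [lam^-1] survives in [lam ^- k * lam ^+ j], and [lam] was
    chosen to outweigh the remaining constants. *)
Lemma scaled_power_bound (lam M a : R) (k j : nat) : 1 <= lam -> (j < k)%N ->
  0 <= M -> 2 ^+ k * (`|a| * M) <= lam ->
  `|a| * lam ^- k * lam ^+ j * M <= 2^-1 ^+ k.
Proof.
move=> l1 jk M0 H; have l0 : 0 < lam by exact: lt_le_trans l1.
have p2 : 0 < (2 : R) ^+ k by rewrite exprn_gt0.
have aM : 0 <= `|a| * M by rewrite mulr_ge0.
have E : lam ^- k * lam ^+ j <= lam^-1.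
  rewrite -(subnKC jk) exprD exprS !invfM mulrAC mulrC.
  rewrite -!mulrA mulVf ?mulr1; last by rewrite expf_neq0// gt_eqF.
  rewrite mulrC ler_piMr ?invr_ge0 ?(ltW l0)// invf_le1 ?exprn_gt0//.
  exact: exprn_ege1.
have -> : `|a| * lam ^- k * lam ^+ j * M = (`|a| * M) * (lam ^- k * lam ^+ j) by ring.
apply: le_trans (ler_wpM2l aM E) _.
by rewrite exprVn ler_pdivrMr// [_^-1 * _]mulrC ler_pdivlMr// mulrC.
Qed.

(** One Taylor coefficient in the variable [x ^+ 2] is peeled off: [w] realizes the term of degree
    [k] by a globally defined function, small in all derivatives below order [k], and the rest keeps
    the shape [x ^+ k.+1.*2] times a smooth even function. *)
Lemma borel_step d k r : 0 < d -> smooth (symball d) r -> even_fun r ->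
  exists w r', [/\ smooth [set: R] w,
    (forall j, exists M, forall s, `|derive1n j w s| <= M) /\
    (forall j s, (j < k)%N -> `|derive1n j w s| <= 2^-1 ^+ k),
    forall N s, (N < k)%N -> `|w s| <= 2^-1 ^+ k * `|s| ^+ N,
    smooth (symball d) r' /\ even_fun r' &
    forall x, x ^+ k.*2 * r x = w (x ^+ 2) + x ^+ k.+1.*2 * r' x].
Proof.
move=> d0 sr er; pose a := r 0.
have [M M0 hM] := uniform_bound k (fun j => @bounded_xbumpX R k j j (leqnn _)).
(* [M] bounds the derivatives of [xbump ^+ k] up to order [k]. With [M + 1 >= 1] the same [lam] also
   serves the bound on [w] itself, where no factor [M] occurs. *)
pose lam := 1 + 2 ^+ k * (`|a| * (M + 1)).
have M1 : 0 <= M + 1 by rewrite addr_ge0.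
have H1 : 0 <= 2 ^+ k * (`|a| * (M + 1)) by rewrite !mulr_ge0// exprn_ge0.
have l1 : 1 <= lam by rewrite /lam lerDl.
have l0 : 0 < lam by exact: lt_le_trans l1.
have lM : 2 ^+ k * (`|a| * (M + 1)) <= lam by rewrite /lam lerDr.
(* This is [a * s ^+ k * bump (lam * s) ^+ k], so its leading term at 0 is [a * s ^+ k]. *)
pose w s := a * lam ^- k * xbump (lam * s) ^+ k.
have sx : smooth [set: R] (fun x => xbump x ^+ k).
  by apply: smoothX; [exact: openT|exact: smooth_xbump].
have sw : smooth [set: R] w.
  apply: smoothZ; first exact: openT.
  apply: (@smooth_comp _ _ setT openT setT (fun x => lam * x) (fun x => xbump x ^+ k)) => //.
    exact: openT.
  apply: smoothZ; [exact: openT|exact: smooth_id].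
have dw j s : `|derive1n j w s| =
    `|a| * lam ^- k * lam ^+ j * `|derive1n j (fun x => xbump x ^+ k) (lam * s)|.
  rewrite /w (@derive1nZ_scale _ j _ _ (fun x => xbump x ^+ k))// !normrM.
  rewrite (@ger0_norm _ (lam ^- k)) ?invr_ge0 ?exprn_ge0 ?ltW//.
  by rewrite (@ger0_norm _ (lam ^+ j)) ?exprn_ge0 ?ltW.
have lk : 0 <= `|a| * lam ^- k by rewrite mulr_ge0// invr_ge0 exprn_ge0// ltW.
pose e x := r x - a * bump (lam * x ^+ 2) ^+ k.
have se : smooth (symball d) e.
  apply: smoothB => //; first exact: open_symball.
  apply: smoothZ; first exact: open_symball.
  apply: smoothX; first exact: open_symball.
  apply: (@smooth_comp _ _ _ (@open_symball _ d) setT (fun x => lam * x ^+ 2) bump) => //.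
  + exact: openT.
  + exact: smooth_bump.
  apply: smoothZ; first exact: open_symball.
  by apply: smoothX; [exact: open_symball|exact: smooth_id].
have ee : even_fun e by move=> x; rewrite /e er sqrrN.
have e0 : e 0 = 0.
  by rewrite /e expr0n /= mulr0 /bump expr0n /= addr0 invr1 expr1n mulr1 subrr.
have [r' [sr' er' E]] := even_div_sq d0 se ee e0.
exists w, r'; split => //.
- split.
    move=> j; have [N hN] := @bounded_xbumpX R k j j (leqnn _).
    exists (`|a| * lam ^- k * lam ^+ j * N) => s; rewrite dw.
    by rewrite ler_wpM2l// mulr_ge0// exprn_ge0// ltW.
  move=> j s jk; rewrite dw; apply: le_trans (scaled_power_bound l1 jk M1 lM).
  rewrite ler_wpM2l//; first by rewrite mulr_ge0// exprn_ge0// ltW.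
  by apply: le_trans (hM j _ (ltnW jk)) _; rewrite lerDl.
- move=> N s Nk; rewrite /w normrM normrM [`|lam ^- k|]ger0_norm ?invr_ge0 ?exprn_ge0 ?(ltW l0)//.
  have B : `|xbump (lam * s) ^+ k| <= lam ^+ N * `|s| ^+ N.
    rewrite normrX -(subnKC (ltnW Nk)) exprD -exprMn.
    apply: le_trans (_ : (lam * `|s|) ^+ N * 1 <= _); last by rewrite mulr1.
    apply: ler_pM; rewrite ?exprn_ge0// ?exprn_ile1 ?xbump_le1//.
    rewrite lerXn2r ?nnegrE ?mulr_ge0 ?(ltW l0)//.
    by apply: le_trans (xbump_le_id _) _; rewrite normrM gtr0_norm.
  apply: le_trans (ler_wpM2l lk B) _; rewrite mulrA ler_wpM2r ?exprn_ge0//.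
  apply: le_trans (scaled_power_bound l1 Nk M1 lM).
  by rewrite ler_peMr ?lerDr// mulr_ge0// exprn_ge0// (ltW l0).
move=> x; have -> : r x = a * bump (lam * x ^+ 2) ^+ k + x ^+ 2 * r' x.
  by rewrite -E /e; ring.
have lk0 : lam ^+ k != 0 by rewrite expf_neq0// gt_eqF.
rewrite /w /xbump -!mul2n !exprM [x ^+ 2 ^+ k.+1]exprS; move: (x ^+ 2) (r' x) => y z.
rewrite !exprMn; move: (bump (lam * y) ^+ k) (y ^+ k) => b' c.
by move: lk0; move: (lam ^+ k) => t t0; field.
Qed.

(** Vanishing to infinite order is phrased as decay, which is what the estimate of the tail of the
    Borel series yields. *)
Definition flat_at0 h := forall N, exists C, \forall x \near (0 : R), `|h x| <= C * `|x| ^+ N.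

Lemma bound_div_id h r C N : {for 0, continuous r} -> (forall x, h x = x * r x) ->
  (\forall x \near (0 : R), `|h x| <= C * `|x| ^+ N.+1) ->
  \forall x \near (0 : R), `|r x| <= C * `|x| ^+ N.
Proof.
move=> cr E hC.
have hC1 : \forall x \near 0^', `|r x| <= C * `|x| ^+ N.
  rewrite near_withinE; move: hC; apply: filterS => x + x0.
  by rewrite E normrM exprS mulrCA ler_pM2l ?normr_gt0.
(* At 0 there is nothing to divide by; the bound is obtained there as a limit from nearby points. *)
have Z : `|r 0| <= C * `|0 : R| ^+ N.
  have L : `|r x| @[x --> 0^'] --> `|r 0|.
    by apply: cvg_norm; exact: cvg_within_filter cr.
  have L2 : C * `|x : R| ^+ N @[x --> 0^'] --> C * `|0 : R| ^+ N.
    apply: cvg_within_filter; apply: cvgMr.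
    apply: (@continuous_comp _ _ _ (fun x : R => `|x|) (fun x : R => x ^+ N)).
      exact: norm_continuous.
    exact: exprn_continuous.
  exact: (ler_cvg_to L L2).
move: hC1; rewrite near_withinE; apply: filterS => x H.
by have [->//|/H] := eqVneq x 0.
Qed.

Lemma flat_div_pow d h N : 0 < d -> smooth (symball d) h -> flat_at0 h ->
  exists2 r, smooth (symball d) r & forall x, h x = x ^+ N * r x.
Proof.
move=> d0 sh fh; have [C hC] := fh N; move: hC.
elim: N h sh {fh} => [|N IH] h sh hC; first by exists h => // x; rewrite mul1r.
have h0 : h 0 = 0.
  by have := nbhs_singleton hC; rewrite normr0 expr0n /= mulr0 normr_le0 => /eqP.
have [r1 s1 E1] := smooth_div_id d0 sh h0.
have c1 : {for 0, continuous r1} by apply: (smooth_continuous s1); exact: symball0.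
have [r sr E] := IH _ s1 (bound_div_id c1 E1 hC).
by exists r => // x; rewrite E1 E exprS mulrA.
Qed.

Lemma flat_of_pow h : (forall N, exists2 r, {for 0, continuous r} &
  \forall x \near (0 : R), h x = x ^+ N * r x) -> flat_at0 h.
Proof.
move=> H N; have [r cr E] := H N; exists (`|r 0| + 1).
move/cvgrPdist_le : cr => /(_ 1 ltr01); move: E; apply: filterS2 => x E hx.
rewrite E normrM normrX mulrC ler_wpM2r ?exprn_ge0//.
by rewrite -lerBlDl; apply: le_trans hx; rewrite distrC; exact: lerB_dist.
Qed.

(** The substitution [s = x ^+ 2] turns [h' = 2 x q] into the statement that [q (sqrt s)] is the
    derivative of [h (sqrt s)]; flatness of [q] allows the argument to be repeated. *)
Lemma flat_derive_div d h : 0 < d -> smooth (symball d) h -> flat_at0 h ->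
  exists2 q, smooth (symball d) q /\ flat_at0 q &
    forall x : R, symball d x -> is_derive x 1 h (2 * x * q x).
Proof.
move=> d0 sh fh; have oB := @open_symball R d.
have sh' := smooth_derive1 oB sh.
have fh' : flat_at0 (derive1 h).
  (* Differentiation costs one power of [x], hence the factor [x ^+ N.+1] is extracted from [h]. *)
  apply: flat_of_pow => N; have [r sr E] := flat_div_pow N.+1 d0 sh fh.
  exists (fun x => N.+1%:R * r x + x * derive1 r x).
    have s : smooth (symball d) (fun x => N.+1%:R * r x + x * derive1 r x).
      apply: smoothD => //; first exact: smoothZ.
      by apply: smoothM => //; [exact: smooth_id|exact: smooth_derive1].
    by apply: (smooth_continuous s); exact: symball0.
  have := near_symball d0; apply: filterS => x xd.
  have [_ e] := isdM (isd_exprn N.+1 x) (smooth_is_derive sr xd).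
  have -> : h = fun x => x ^+ N.+1 * r x by apply/funext.
  by rewrite derive1E e exprS /=; ring.
have h'0 : derive1 h 0 = 0.
  have [C hC] := fh' 1%N.
  by have := nbhs_singleton hC; rewrite normr0 expr1 mulr0 normr_le0 => /eqP.
have [r sr E] := smooth_div_id d0 sh' h'0.
exists (fun x => 2^-1 * r x); last first.
  move=> x xd; apply: (is_derive_eq (smooth_is_derive sh xd)); rewrite E.
  by field.
split; first by apply: smoothZ.
move=> N; have [C hC] := fh' N.+1; exists C.
have cr : {for 0, continuous r} by apply: (smooth_continuous sr); exact: symball0.
have := bound_div_id cr E hC; apply: filterS => x; apply: le_trans.
rewrite normrM ler_piMl// ger0_norm ?invr_ge0// invf_le1// ler1n//.
Qed.

(** The descent of [h] to the variable [x ^+ 2], extended by 0 to negative [s] so as to be defined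
    on a full neighbourhood of 0; for flat [h] the two pieces fit smoothly. *)
Definition sqrt_lift h (s : R) := if 0 < s then h (Num.sqrt s) else 0.

Lemma symball_sqrt d s : 0 < d -> 0 < s -> symball (d ^+ 2) s -> symball d (Num.sqrt s).
Proof.
move=> d0 s0; rewrite /symball /= gtr0_norm// => sd.
by rewrite ger0_norm ?sqrtr_ge0// -[d]gtr0_norm// -sqrtr_sqr ltr_sqrt ?exprn_gt0.
Qed.

Lemma sqrt_lift_continuous d h s : 0 < d -> smooth (symball d) h -> flat_at0 h ->
  symball (d ^+ 2) s -> {for s, continuous (sqrt_lift h)}.
Proof.
move=> d0 sh fh sd; rewrite /continuous_at /prop_for /=.
have [s0|s0|s0] := ltgtP s 0.
- rewrite {2}/sqrt_lift ltNge (ltW s0) /=.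
  have c0 : (fun=> 0 : R) x @[x --> s] --> (0 : R) by exact: cvg_cst.
  apply: cvg_trans c0; apply: near_eq_cvg; near=> y; rewrite /sqrt_lift ltNge (_ : y <= 0)//.
  by apply: ltW; near: y; exact: lt_nbhsl.
- have c : {for s, continuous (fun y => h (Num.sqrt y))}.
    apply: continuous_comp; first exact: sqrt_continuous.
    by apply: (smooth_continuous sh); exact: symball_sqrt.
  rewrite {2}/sqrt_lift s0; apply: cvg_trans c; apply: near_eq_cvg.
  near=> y; rewrite /sqrt_lift (_ : 0 < y)//.
  by near: y; exact: lt_nbhsr.
- rewrite s0 {2}/sqrt_lift ltxx; have [C hC] := fh 1%N.
  have L : C * Num.sqrt x @[x --> (0 : R)] --> (0 : R).
    rewrite -[X in _ --> X](mulr0 C); apply: cvgMr.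
    by rewrite -[X in _ --> X](@sqrtr0 R); exact: sqrt_continuous.
  have L0 : `|sqrt_lift h x| @[x --> (0 : R)] --> (0 : R).
    apply: (@squeeze_cvgr R (nbhs (0 : R)) _ R (fun=> 0) (fun x => `|C| * Num.sqrt x)).
    + have : {near (0 : R), forall x, `|h (Num.sqrt x)| <= C * `|Num.sqrt x| ^+ 1}.
        have cs : Num.sqrt x @[x --> (0 : R)] --> (0 : R).
          by rewrite -[X in _ --> X](@sqrtr0 R); exact: sqrt_continuous.
        exact: (cs _ hC).
      apply: filterS => x hx; rewrite normr_ge0 /=.
      rewrite /sqrt_lift; case: ifP => _; last by rewrite normr0 mulr_ge0// sqrtr_ge0.
      apply: le_trans hx _; rewrite expr1 ger0_norm ?sqrtr_ge0//.
      by rewrite ler_wpM2r ?sqrtr_ge0// ler_norm.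
    + exact: cvg_cst.
    + rewrite -[X in _ --> X](mulr0 `|C|); apply: cvgMr.
      by rewrite -[X in _ --> X](@sqrtr0 R); exact: sqrt_continuous.
  exact/norm_cvg0P.
Unshelve. all: by end_near. Qed.

(** The derivative of the lift of [h] is the lift of [q] from [flat_derive_div], first off 0 and
    then at 0 by continuity, so the induction runs over flat functions. *)
Lemma sqrt_lift_class_C m d h : 0 < d -> smooth (symball d) h -> flat_at0 h ->
  class_C m (symball (d ^+ 2)) (sqrt_lift h).
Proof.
move=> d0; elim: m h => [|m IH] h sh fh.
  by split => // s; exact: sqrt_lift_continuous.
have [q [sq fq] dh] := flat_derive_div d0 sh fh.
have Cq := IH q sq fq.
have d20 : 0 < d ^+ 2 by rewrite exprn_gt0.
have off0 (s : R) : symball (d ^+ 2) s -> s != 0 -> is_derive s 1 (sqrt_lift h) (sqrt_lift q s).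
  move=> sd; rewrite /sqrt_lift; have [s0 _|s0 _|//] := ltgtP s 0.
    apply: (@near_eq_is_derive _ _ _ (fun=> 0)).
    near=> y; rewrite ltNge (_ : y <= 0)//.
    by apply: ltW; near: y; exact: lt_nbhsl.
  apply: (@near_eq_is_derive _ _ _ (fun y => h (Num.sqrt y))).
    near=> y; rewrite (_ : 0 < y)//.
    by near: y; exact: lt_nbhsr.
  have r0 : Num.sqrt s != 0 by rewrite gt_eqF// sqrtr_gt0.
  have rd : symball d (Num.sqrt s) by exact: symball_sqrt.
  apply: (is_derive_eq (isd_comp (dh _ rd) (is_derive1_sqrt s0))).
  by field.
apply: (class_C_is_derive (@open_symball _ _) _ Cq) => s sd.
have [->|s0] := eqVneq s 0; last exact: off0.
apply: (is_derive_at0 d20 _ off0).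
  by move=> y; exact: sqrt_lift_continuous.
by apply: (class_C_continuous Cq); exact: symball0.
Unshelve. all: by end_near. Qed.

(* Borel's lemma supplies a smooth W with the Taylor coefficients of f at 0 in
   the variable x^2; the remainder f x - W (x^2) is flat and descends to x^2. *)
Lemma whitney_even d f : 0 < d -> smooth (symball d) f -> even_fun f ->
  exists2 G, smooth (symball (d ^+ 2)) G & forall x, symball d x -> f x = G (x ^+ 2).
Proof.
move=> d0 sf ef.
(* Each Borel step depends on the remainder of the previous one. Packing remainders with their
   properties makes the step total on [nat * S], so [choice] turns it into a function that can be
   iterated. *)
pose S := {r : R -> R | smooth (symball d) r /\ even_fun r}.
pose Q (x : nat * S) (y : (R -> R) * S) :=
  let: (k, r) := x in let: (w, r') := y in
  [/\ smooth [set: R] w,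
    (forall j, exists M, forall s, `|derive1n j w s| <= M) /\
    (forall j s, (j < k)%N -> `|derive1n j w s| <= 2^-1 ^+ k),
    forall N s, (N < k)%N -> `|w s| <= 2^-1 ^+ k * `|s| ^+ N &
    forall x, x ^+ k.*2 * sval r x = w (x ^+ 2) + x ^+ k.+1.*2 * sval r' x].
have /choice[F HF] : forall x, exists y, Q x y.
  move=> [k [r [sr er]]].
  have [w [r' [h1 h2 h3 h4 h5]]] := borel_step k d0 sr er.
  by exists (w, exist _ r' h4).
pose rs := fix rs k : S := if k is k'.+1 then (F (k', rs k')).2 else exist _ f (conj sf ef).
pose w k := (F (k, rs k)).1.
have Hw k : Q (k, rs k) (w k, rs k.+1).
  by have := HF (k, rs k); rewrite /w /=; case: (F _).
have [W sW cW] : exists2 W, smooth [set: R] W & forall s, series (w ^~ s) @ \oo --> W s.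
  apply: smooth_series_half => [k|k j|k j s jk]; have [h1 [h2 h3] h4 h5] := Hw k => //.
  exact: h3.
have partial k x : f x = \sum_(0 <= i < k) w i (x ^+ 2) + x ^+ k.*2 * sval (rs k) x.
  elim: k => [|k IH]; first by rewrite big_nil add0r expr0 mul1r.
  by rewrite IH big_nat_recr//=; have [_ _ _ ->] := Hw k; rewrite addrA.
(* The terms omitted have index greater than [N], so each is at most [2^-1 ^+ i * |s| ^+ N], and the
   geometric series adds up to at most 2. *)
have tail N s : `|W s - \sum_(0 <= i < N.+1) w i s| <= 2 * `|s| ^+ N.
  have C : (fun n => `|series (w ^~ s) n - \sum_(0 <= i < N.+1) w i s|) @ \oo -->
      `|W s - \sum_(0 <= i < N.+1) w i s|.
    by apply: cvg_norm; apply: cvgB; [exact: cW|exact: cvg_cst].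
  rewrite -(cvg_lim _ C)//; apply: limr_le; first by apply/cvg_ex; eexists; exact: C.
  near=> n; have Nn : (N.+1 <= n)%N by near: n; exact: nbhs_infty_ge.
  rewrite /series /= (@big_cat_nat _ _ _ N.+1)//= addrAC subrr add0r.
  apply: le_trans (ler_norm_sum _ _ _) _.
  apply: le_trans (_ : \sum_(N.+1 <= i < n) (2^-1 : R) ^+ i * `|s| ^+ N <= _).
    rewrite big_nat [leRHS]big_nat; apply: ler_sum => i /andP[Ni _].
    by have [_ _ h _] := Hw i; exact: h.
  rewrite -mulr_suml ler_wpM2r ?exprn_ge0//.
  apply: le_trans (@sum_geometric_half R n).
  by rewrite [leRHS](@big_cat_nat _ _ _ N.+1)//= lerDr sumr_ge0.
pose h x := f x - W (x ^+ 2).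
have oB := @open_symball R d.
have sWx : smooth (symball d) (fun x => W (x ^+ 2)).
  apply: (@smooth_comp _ _ _ oB setT (fun x => x ^+ 2) W) => //; first exact: openT.
  by apply: smoothX => //; exact: smooth_id.
have sh : smooth (symball d) h by exact: smoothB.
have fh : flat_at0 h.
  move=> N; have [sr _] := svalP (rs N.+1).
  exists (`|sval (rs N.+1) 0| + 1 + 2).
  have cr : {for 0, continuous (sval (rs N.+1))}.
    by apply: (smooth_continuous sr); exact: symball0.
  have n1 : \forall x \near (0 : R), `|x| <= 1.
    by apply: filterS (near_symball ltr01) => x; exact: ltW.
  move/cvgrPdist_le : cr => /(_ 1 ltr01); move: n1; apply: filterS2 => x x1 hx.
  have rx : `|sval (rs N.+1) x| <= `|sval (rs N.+1) 0| + 1.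
    by rewrite -lerBlDl; apply: le_trans hx; rewrite distrC; exact: lerB_dist.
  have -> : h x = x ^+ N.+1.*2 * sval (rs N.+1) x -
      (W (x ^+ 2) - \sum_(0 <= i < N.+1) w i (x ^+ 2)).
    by rewrite /h (partial N.+1 x); ring.
  have p m : (N <= m)%N -> `|x| ^+ m <= `|x| ^+ N.
    by move=> Nm; apply: ler_wiXn2l.
  apply: le_trans (ler_normB _ _) _; rewrite mulrDl; apply: lerD.
    rewrite normrM mulrC normrX; apply: ler_pM => //; apply: p.
    by rewrite doubleS -addnn; lia.
  apply: le_trans (tail _ _) _; rewrite ler_wpM2l// normrX -exprM; apply: p.
  by lia.
exists (fun s => W s + sqrt_lift h s).
  apply: smoothD; first exact: open_symball.
    by apply: (smooth_sub _ sW).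
  by move=> m; apply: sqrt_lift_class_C.
have eh x : h (- x) = h x by rewrite /h ef sqrrN.
move=> x xd; rewrite /sqrt_lift; have [->|x0] := eqVneq x 0.
  have [C] := fh 1%N => /nbhs_singleton.
  rewrite normr0 expr1 mulr0 normr_le0 /h => /eqP.
  by rewrite expr0n /= ltxx addr0 => /eqP; rewrite subr_eq0 => /eqP.
rewrite exprn_even_gt0//= x0 sqrtr_sqr.
have -> : h `|x| = h x by case: (ger0P x) => _ //; rewrite eh.
by rewrite /h; ring.
Unshelve. all: by end_near. Qed.

End Whitney.

(** * A criterion for cusps *)

Section InverseFunction.
Context {R : realType}.
Implicit Types (d : R) (f g h r : R -> R).

Lemma symball_sub (d d' : R) : d <= d' -> symball d `<=` symball d'.
Proof. by move=> dd x; rewrite /symball /= => /lt_le_trans; exact. Qed.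

Lemma near_symball_sub d (P : R -> Prop) : 0 < d -> (\forall x \near (0 : R), P x) ->
  exists e, [/\ 0 < e, e <= d & forall x, symball e x -> P x].
Proof.
move=> d0 /nbhs_ballP[e /= e0 H]; exists (Num.min e d); split.
- by rewrite lt_min e0.
- by rewrite ge_min lexx orbT.
by move=> x; rewrite /symball /= lt_min => /andP[xe _]; apply: H; rewrite /ball /= sub0r normrN.
Qed.

(** Where the derivative is positive [psi] is strictly increasing, hence injective, and the
    intermediate value theorem makes it onto a neighbourhood of 0. Smoothness follows by
    bootstrapping from the derivative of [phi], the inverse of [derive1 psi] composed with [phi]. *)
Lemma inverse_function d (psi : R -> R) : 0 < d -> smooth (symball d) psi -> psi 0 = 0 ->
  0 < derive1 psi 0 ->
  exists (d' delta : R) (phi : R -> R), [/\ 0 < d' <= d, 0 < delta, smooth (symball delta) phi,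
    forall w, symball delta w -> symball d' (phi w) /\ psi (phi w) = w &
    forall u, symball d' u -> symball delta (psi u) -> phi (psi u) = u].
Proof.
move=> d0 sp p0 dp0; have oB := @open_symball R d.
have sp' := smooth_derive1 oB sp.
have c0 : {for 0, continuous (derive1 psi)}.
  by apply: (smooth_continuous sp'); exact: symball0.
have n0 : \forall x \near 0, 0 < derive1 psi x by exact: cvgr_gt c0 _ dp0.
have [e [e0 ed He]] := near_symball_sub d0 n0.
have cp x : symball e x -> {for x, continuous psi}.
  by move=> xe; apply: (smooth_continuous sp); exact: symball_sub xe.
have dp x : symball e x -> is_derive x 1 psi (derive1 psi x).
  by move=> xe; apply: (smooth_is_derive sp); exact: symball_sub xe.
have incr x y : symball e x -> symball e y -> x < y -> psi x < psi y.
  rewrite /symball /= !ltr_norml => /andP[x1 x2] /andP[y1 y2] xy.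
  have inb z : x <= z <= y -> symball e z.
    by move=> /andP[z1 z2]; rewrite /symball /= ltr_norml (lt_le_trans x1)// (le_lt_trans z2).
  apply: (@gtr0_derive1_incr _ psi x y); [move=> z|move=> z| |exact: lexx|exact: xy|exact: lexx].
  - by rewrite in_itv /= => /andP[/ltW a /ltW b]; have [] := dp z (inb _ (introT andP (conj a b))).
  - by rewrite in_itv /= => /andP[/ltW a /ltW b]; apply: He; exact: inb (introT andP (conj a b)).
  - apply: continuous_in_subspaceT => z; rewrite inE /= in_itv /= => zxy.
    by apply: cp; exact: inb.
have inj x y : symball e x -> symball e y -> psi x = psi y -> x = y.
  move=> xe ye E; have [xy|yx|//] := ltgtP x y.
    by have := incr x y xe ye xy; rewrite E ltxx.
  by have := incr y x ye xe yx; rewrite E ltxx.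
(* Halving puts the endpoints [d'] and [- d'] inside the interval of monotonicity, so [psi] can be
   evaluated there. *)
pose d' := e / 2.
have d'0 : 0 < d' by rewrite divr_gt0.
have d'e : d' < e by rewrite ltr_pdivrMr// ltr_pMr// ltr1n.
have be : symball e d' by rewrite /symball /= gtr0_norm.
have nbe : symball e (- d') by rewrite /symball /= normrN gtr0_norm.
have pd : 0 < psi d' by rewrite -p0; apply: incr => //; exact: symball0.
have npd : psi (- d') < 0.
  by rewrite -[X in _ < X]p0; apply: incr; rewrite ?oppr_lt0//; exact: symball0.
(* The largest symmetric interval between the values of [psi] at the two endpoints. *)
pose delta := Num.min (psi d') (- psi (- d')).
have delta0 : 0 < delta by rewrite lt_min pd oppr_gt0.
have surj w : symball delta w -> exists u, symball d' u /\ psi u = w.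
  rewrite /symball /= lt_min !ltr_norml => /andP[/andP[w1 w2] /andP[w3 w4]].
  have [|||c] := @IVT _ psi (- d') d' w.
  - by rewrite lerNl (le_trans _ (ltW d'0))// oppr_le0 ltW.
  - apply: continuous_in_subspaceT => z; rewrite inE /= in_itv /= => /andP[z1 z2].
    by apply: cp; rewrite /symball /= (le_lt_trans _ d'e)// ler_norml z1.
  - have h : psi (- d') <= psi d' by rewrite ltW// (lt_trans npd).
    by rewrite (min_idPl h) (max_idPr h); apply/andP; split; lra.
  rewrite in_itv /= => /andP[c1 c2] E; exists c; split => //.
  rewrite ltr_norml lt_neqAle c1 andbT lt_neqAle c2 andbT.
  by apply/andP; split; apply/eqP => h; [rewrite -h in E|rewrite h in E]; lra.
have [phi Hphi] : exists phi, forall w, symball delta w -> symball d' (phi w) /\ psi (phi w) = w.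
  have /choice[phi H] : forall w, exists u, symball delta w -> symball d' u /\ psi u = w.
    move=> w; have [/surj[u hu]|nw] := pselect (symball delta w); first by exists u.
    by exists 0.
  by exists phi.
have d'd : d' <= d by rewrite (le_trans (ltW d'e)).
have can u : symball d' u -> symball delta (psi u) -> phi (psi u) = u.
  move=> ud pu; have [h1 h2] := Hphi _ pu.
  by apply: inj h2; apply: symball_sub; [exact: ltW d'e| |exact: ltW d'e|].
have nz w : symball delta w -> derive1 psi (phi w) != 0.
  move=> /Hphi[h _]; rewrite gt_eqF//; apply: He; apply: symball_sub h; exact: ltW.
have dphi (w : R) : symball delta w -> is_derive w 1 phi (derive1 psi (phi w))^-1.
  move=> wd; have [h1 h2] := Hphi _ wd; rewrite -{1}h2.
  have h3 : symball e (phi w) by apply: symball_sub h1; exact: ltW.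
  have nd' : \forall u \near phi w, symball d' u.
    by apply: open_nbhs_nbhs; split => //; exact: open_symball.
  apply: is_derive_inverse.
  - have : \forall u \near phi w, symball delta (psi u).
      apply: (cp _ h3); rewrite h2.
      by apply: open_nbhs_nbhs; split => //; exact: open_symball.
    by move: nd'; apply: filterS2 => u; exact: can.
  - apply: filterS nd' => u ud; apply: cp; apply: symball_sub ud; exact: ltW.
  - exact: dp.
  - exact: nz.
have oD := @open_symball R delta.
exists d', delta, phi; split => //; first by rewrite d'0.
elim=> [|k IH].
  by split => // w /dphi[h _]; exact: derivable_continuous1.
apply: (class_C_is_derive oD dphi); apply: class_CV => //.
apply: (class_C_comp oD (@open_symball R d') _ _ IH).
  by move=> w /Hphi[].
by apply: class_C_sub (sp' k); exact: symball_sub.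
Qed.

(** Hadamard's lemma with the value of the quotient at 0; for a cusp this value shows that the
    leading coefficients do not vanish. *)
Lemma power_primitive d n K k : 0 < d ->
  (forall x : R, symball d x -> is_derive x 1 K (x ^+ n * k x)) -> K 0 = 0 ->
  smooth (symball d) k ->
  exists r, [/\ smooth (symball d) r, r 0 = k 0 / n.+1%:R & forall x, K x = x ^+ n.+1 * r x].
Proof.
move=> d0 dK K0 sk; exists (quotient_at0 n K k); split.
- by move=> m; exact: quotient_at0_class_C.
- by rewrite /quotient_at0 eqxx.
move=> x; rewrite /quotient_at0; have [->|x0] := eqVneq x 0.
  by rewrite K0 expr0n mul0r.
by rewrite mulrCA mulfV ?mulr1// expf_neq0.
Qed.

(** The odd part vanishes at 0, so Hadamard's lemma divides it by [w] and leaves an even function;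
    Whitney's theorem then applies to both parts. *)
Lemma even_odd_decomposition d Z : 0 < d -> smooth (symball d) Z ->
  exists P Q, [/\ smooth (symball (d ^+ 2)) P, smooth (symball (d ^+ 2)) Q &
    forall w, symball d w -> Z w = P (w ^+ 2) + w * Q (w ^+ 2)].
Proof.
move=> d0 sZ; have oB := @open_symball R d.
have sZN : smooth (symball d) (fun w => Z (- w)).
  apply: (@smooth_comp _ _ _ oB (symball d) (fun w => - w) Z) => //.
    by move=> x; rewrite /symball /= normrN.
  by apply: smoothN => //; exact: smooth_id.
pose ev w := 2^-1 * (Z w + Z (- w)); pose od w := 2^-1 * (Z w - Z (- w)).
have sev : smooth (symball d) ev by apply: smoothZ => //; exact: smoothD.
have sod : smooth (symball d) od by apply: smoothZ => //; exact: smoothB.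
have od0 : od 0 = 0 by rewrite /od oppr0 subrr mulr0.
have [q sq Eq] := smooth_div_id d0 sod od0.
have [P sP EP] : exists2 P, smooth (symball (d ^+ 2)) P & forall x, symball d x -> ev x = P (x ^+ 2).
  by apply: whitney_even => // x; rewrite /ev opprK addrC.
have [Q sQ EQ] : exists2 Q, smooth (symball (d ^+ 2)) Q & forall x, symball d x -> q x = Q (x ^+ 2).
  apply: whitney_even => // x; have [->|x0] := eqVneq x 0; first by rewrite oppr0.
  apply: (mulfI x0); rewrite -Eq -[x * q (- x)]opprK -mulNr -Eq /od opprK.
  by ring.
by exists P, Q; split => // w wd; rewrite -EP// -EQ// -Eq /ev /od; field.
Qed.

End InverseFunction.

(** Read from right to left, it inserts the factor that is needed before [ring] can close a
    trigonometric identity. *)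
Lemma mulr_cos2Dsin2 (R : realType) (t x : R) : x * (cos t ^+ 2 + sin t ^+ 2) = x.
Proof. by rewrite cos2Dsin2 mulr1. Qed.

Section Cusp.
Context {R : realType}.
Implicit Types (d t : R) (c : R -> R * R).

(** Coordinates in the orthonormal frame at angle [t]: [frame_x] along the tangent direction
    [(- sin t, cos t)], [frame_y] along the normal [(cos t, sin t)]. *)
Definition frame_x t (p : R * R) := - sin t * p.1 + cos t * p.2.
Definition frame_y t (p : R * R) := cos t * p.1 + sin t * p.2.
Definition unframe t (x y : R) : R * R :=
  (- sin t * x + cos t * y, cos t * x + sin t * y).

Lemma frame_xK t x y : frame_x t (unframe t x y) = x.
Proof.
rewrite /frame_x /unframe /=.
by rewrite -[RHS](mulr_cos2Dsin2 t); ring.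
Qed.

Lemma frame_yK t x y : frame_y t (unframe t x y) = y.
Proof.
rewrite /frame_y /unframe /=.
by rewrite -[RHS](mulr_cos2Dsin2 t); ring.
Qed.

Lemma unframeK t p : unframe t (frame_x t p) (frame_y t p) = p.
Proof.
case: p => p1 p2; rewrite /frame_x /frame_y /unframe /=; congr (_, _).
  by rewrite -[RHS](mulr_cos2Dsin2 t); ring.
by rewrite -[RHS](mulr_cos2Dsin2 t); ring.
Qed.

Lemma smooth_fst_id (A : set (R * R)) : open A -> smooth A (fun p => p.1).
Proof. by move=> oA; apply: smooth_fst => //; exact: smooth_id. Qed.

Lemma smooth_snd_id (A : set (R * R)) : open A -> smooth A (fun p => p.2).
Proof. by move=> oA; apply: smooth_snd => //; exact: smooth_id. Qed.

Lemma open_preimage_symball (V : normedModType R) (A : set V) (f : V -> R) r : open A ->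
  smooth A f -> open [set p | A p /\ symball r (f p)].
Proof.
move=> oA sf; rewrite openE => p [Ap fp]; rewrite /interior /=.
have n1 : \forall q \near p, A q by apply: open_nbhs_nbhs.
have n2 : \forall q \near p, symball r (f q).
  apply: (smooth_continuous sf Ap); apply: open_nbhs_nbhs; split => //.
  exact: open_symball.
by apply: filterS2 n1 n2.
Qed.

(* In the coordinates v = eps x, the curve reads (w^2, w^3 P(w^2) + w^4 Q(w^2)),
   and the shear (v, y) -> (v, (y - v^2 Q(v)) / P(v)) straightens it. *)
Lemma cusp_of_expansion c t d (X Y : R -> R) : 0 < d ->
  smooth (symball d) X -> smooth (symball d) Y -> X 0 != 0 -> Y 0 != 0 ->
  (forall u, symball d u -> c (t + u) = c t + unframe t (u ^+ 2 * X u) (u ^+ 3 * Y u)) ->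
  singular_point c t -> cusp c t.
Proof.
move=> d0 sX sY X0 Y0 Ec sing; split => //.
(* The sign makes [eps * X] positive near 0, so that it has a smooth square root. *)
pose eps := Num.sg (X 0).
have eps2 : eps * eps = 1 by rewrite -expr2 sqr_sg X0.
have eX0 : 0 < eps * X 0 by rewrite /eps -normrEsg normr_gt0.
have oB (e : R) : open (symball e) by exact: open_symball.
have seX : smooth (symball d) (fun u => eps * X u) by exact: smoothZ.
have [e [e0 ed He]] : exists e, [/\ 0 < e, e <= d & forall u, symball e u -> 0 < eps * X u].
  apply: near_symball_sub => //.
  have ce : {for 0, continuous (fun u => eps * X u)}.
    by apply: (smooth_continuous seX); exact: symball0.
  exact: cvgr_gt ce _ eX0.
have sS : smooth (symball e) (fun u => Num.sqrt (eps * X u)).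
  by apply: smooth_sqrt => //; apply: smooth_sub seX; exact: symball_sub.
(* The new parameter [w = psi u] satisfies [w ^+ 2 = eps * u ^+ 2 * X u]; its inverse [phi] makes
   the tangential coordinate exactly [eps * w ^+ 2]. *)
pose psi u := u * Num.sqrt (eps * X u).
have spsi : smooth (symball e) psi by apply: smoothM => //; exact: smooth_id.
have psi0 : psi 0 = 0 by rewrite /psi mul0r.
have dpsi0 : 0 < derive1 psi 0.
  have [_ h] := isdM (isd_id 0) (smooth_is_derive sS (symball0 e0)).
  by rewrite derive1E h mul1r mul0r addr0 sqrtr_gt0.
have [d1 [dl [phi [/andP[d10 d1e] dl0 sphi Hphi Kphi]]]] := inverse_function e0 spsi psi0 dpsi0.
have phi0 : phi 0 = 0.
  by rewrite -[in LHS]psi0 Kphi// ?psi0; exact: symball0.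
have [q sq Eq] := smooth_div_id dl0 sphi phi0.
(* [q 0] is the derivative of [phi] at 0, which is nonzero because [psi] composed with [phi] is the
   identity near 0. *)
have q0 : q 0 != 0.
  apply/eqP => h.
  have [_ h1] := isdM (isd_id 0) (smooth_is_derive sq (symball0 dl0)).
  have dphi0 : derive1 phi 0 = 0.
    rewrite derive1E (_ : phi = fun x => x * q x); last exact/funext.
    by rewrite h1 h mul1r mul0r addr0.
  have p2 : is_derive (phi 0) 1 psi (derive1 psi 0).
    by rewrite phi0; apply: (smooth_is_derive spsi); exact: symball0.
  have [_ h2] := isd_comp p2 (smooth_is_derive sphi (symball0 dl0)).
  have : 'D_1 (fun y => psi (phi y)) 0 = 'D_1 (fun y : R => y) 0.
    apply: near_eq_derive; apply: filterS (near_symball dl0) => w wd.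
    by have [_ ->] := Hphi _ wd.
  by rewrite h2 dphi0 mulr0 derive_id => /eqP; rewrite eq_sym oner_eq0.
have sYp : smooth (symball dl) (fun w => Y (phi w)).
  apply: (@smooth_comp _ _ _ (oB dl) (symball d) phi Y) => // w /Hphi[h _].
  by apply: symball_sub h; exact: le_trans ed.
(* The normal coordinate at parameter [w] is [w ^+ 3 * Z w]. *)
pose Z w := q w ^+ 3 * Y (phi w).
have sZ : smooth (symball dl) Z by apply: smoothM => //; exact: smoothX.
have Z0 : Z 0 != 0 by rewrite /Z phi0 mulf_neq0// expf_neq0.
have [P [Q [sP sQ EZ]]] := even_odd_decomposition dl0 sZ.
have dl2 : 0 < dl ^+ 2 by rewrite exprn_gt0.
have P0 : P 0 != 0.
  by have := EZ 0 (symball0 dl0); rewrite mul0r addr0 expr0n /= => <-.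
have [r [r0 rd Hr]] : exists r, [/\ 0 < r, r <= dl ^+ 2 & forall v, symball r v -> P v != 0].
  apply: near_symball_sub => //.
  have cP : {for 0, continuous P} by apply: (smooth_continuous sP); exact: symball0.
  exact: cvgr_neq0 cP _.
have sPr : smooth (symball r) P by apply: smooth_sub sP; exact: symball_sub.
have sQr : smooth (symball r) Q by apply: smooth_sub sQ; exact: symball_sub.
pose xi p := frame_x t (p - c t); pose eta p := frame_y t (p - c t).
have oT : open [set: R * R] by exact: openT.
have sxi A : open A -> smooth A xi.
  move=> oA; rewrite /xi /frame_x.
  apply: smoothD => //; apply: smoothZ => //; apply: smoothB => //;
    by [exact: smooth_fst_id|exact: smooth_snd_id|exact: smooth_cst].
have seta A : open A -> smooth A eta.
  move=> oA; rewrite /eta /frame_y.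
  apply: smoothD => //; apply: smoothZ => //; apply: smoothB => //;
    by [exact: smooth_fst_id|exact: smooth_snd_id|exact: smooth_cst].
pose A := [set p | setT p /\ symball r (eps * xi p)].
have oA : open A by apply: open_preimage_symball => //; apply: smoothZ => //; exact: sxi.
pose B := [set p : R * R | setT p /\ symball r p.1].
have oBB : open B by apply: open_preimage_symball => //; exact: smooth_fst_id.
pose Phi p := (eps * xi p, (eta p - (eps * xi p) ^+ 2 * Q (eps * xi p)) / P (eps * xi p)).
(* The shear is affine in the second coordinate, so its inverse is explicit and no inverse function
   theorem in the plane is called for. *)
pose G (z : R * R) := c t + unframe t (eps * z.1) (z.2 * P z.1 + z.1 ^+ 2 * Q z.1).
have xiG z : eps * xi (G z) = z.1.
  by rewrite /xi /G addrC addKr frame_xK mulrA eps2 mul1r.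
have etaG z : eta (G z) = z.2 * P z.1 + z.1 ^+ 2 * Q z.1.
  by rewrite /eta /G addrC addKr frame_yK.
have PhiG z : B z -> Phi (G z) = z.
  case: z => z1 z2 [_ /= /Hr Pz]; rewrite /Phi xiG etaG /= addrK mulfK//.
have GPhi p : A p -> G (Phi p) = p.
  move=> [_ /Hr Pp]; rewrite /G /Phi /= mulrA eps2 mul1r divfK// subrK.
  by rewrite unframeK addrC subrK.
exists (fun w => t + phi w), Phi; split.
- by rewrite phi0 addr0.
- pose A1 := symball dl.
  (* The two conditions describe the image of [phi] shifted by [t]: [psi] inverts [phi] only where
     both hold. *)
  pose B1 := [set s | symball d1 (s - t) /\ symball dl (psi (s - t))].
  have oS : open [set s | setT s /\ symball d1 (s - t)].
    apply: open_preimage_symball; first exact: openT.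
    by apply: smoothB; [exact: openT|exact: smooth_id|exact: smooth_cst].
  have spt : smooth [set s | setT s /\ symball d1 (s - t)] (fun s => psi (s - t)).
    apply: (@smooth_comp _ _ _ oS (symball e) (fun s => s - t) psi) => //.
      by move=> s [_ h]; exact: symball_sub h.
    by apply: smoothB; [exact: oS|exact: smooth_id|exact: smooth_cst].
  have B1E : B1 = [set s | [set s | setT s /\ symball d1 (s - t)] s /\ symball dl (psi (s - t))].
    by apply/seteqP; split => s /=; [case=> h1 h2|case=> [[_ h1]] h2].
  have oB1 : open B1 by rewrite B1E; exact: open_preimage_symball.
  exists A1, B1, (fun s => psi (s - t)); split => //.
  + by split; [exact: oB|exact: symball0].
  + split.
      by apply: smoothD; [exact: oB|exact: smooth_cst|exact: sphi].
    by apply: smooth_sub spt => s [h1 h2].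
  + apply/seteqP; split => [_ [w wd <-]|s [h1 h2]].
      by have [h1 h2] := Hphi w wd; rewrite /B1 /= addrC addKr h2.
    exists (psi (s - t)) => //; rewrite Kphi// addrC subrK//.
  + by move=> w wd; rewrite addrC addKr; have [_ ->] := Hphi w wd.
- exists A, B, G; split => //.
  + by split => //; split => //; rewrite /xi subrr /frame_x /= !mulr0 addr0 mulr0; exact: symball0.
  + have sx : smooth A (fun p => eps * xi p) by apply: smoothZ => //; exact: sxi.
    have sPA : smooth A (fun p => P (eps * xi p)).
      by apply: (@smooth_comp _ _ _ oA (symball r) (fun p => eps * xi p) P) => // p [].
    have sQA : smooth A (fun p => Q (eps * xi p)).
      by apply: (@smooth_comp _ _ _ oA (symball r) (fun p => eps * xi p) Q) => // p [].
    have sPB : smooth B (fun p => P p.1).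
      apply: (@smooth_comp _ _ _ oBB (symball r) (fun p => p.1) P) => //; first by move=> p [].
      exact: smooth_fst_id.
    have sQB : smooth B (fun p => Q p.1).
      apply: (@smooth_comp _ _ _ oBB (symball r) (fun p => p.1) Q) => //; first by move=> p [].
      exact: smooth_fst_id.
    have s1 := smooth_fst_id oBB; have s2 := smooth_snd_id oBB.
    split.
      apply: smooth_pair => //; apply: smoothM => //; last first.
        by apply: smoothV => // p [_ /Hr].
      apply: smoothB => //; first exact: seta.
      by apply: smoothM => //; exact: smoothX.
    have se1 : smooth B (fun z => eps * z.1) by exact: smoothZ.
    have se2 : smooth B (fun z => z.2 * P z.1 + z.1 ^+ 2 * Q z.1).
      by apply: smoothD => //; apply: smoothM => //; exact: smoothX.
    apply: (@smooth_ext _ _ _ oBB _ (fun z => ((c t).1 + (- sin t * (eps * z.1) +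
        cos t * (z.2 * P z.1 + z.1 ^+ 2 * Q z.1)), (c t).2 + (cos t * (eps * z.1) +
        sin t * (z.2 * P z.1 + z.1 ^+ 2 * Q z.1))))).
      by move=> z _.
    by apply: smooth_pair => //; apply: smoothD => //; (try exact: smooth_cst);
      apply: smoothD => //; exact: smoothZ.
  + apply/seteqP; split => [_ [p Ap <-]|z Bz]; first by split => //; case: Ap.
    exists (G z); last exact: PhiG.
    by split => //; rewrite xiG; case: Bz.
- have [e' [e'0 e'd He']] : exists e', [/\ 0 < e', e' <= dl & forall w, symball e' w -> symball r (w ^+ 2)].
    apply: near_symball_sub => //.
    have := @exprn_continuous R 2 0; rewrite /continuous_at /= expr0n /=; apply.
    exact: near_symball.
  apply: filterS (near_symball e'0) => w we'.
  have wd : symball dl w by exact: symball_sub we'.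
  have [h1 h2] := Hphi w wd.
  rewrite Ec; last by apply: symball_sub h1; exact: le_trans ed.
  have x2 : phi w ^+ 2 * X (phi w) = eps * w ^+ 2.
    rewrite -[in RHS]h2 /psi exprMn sqr_sqrtr; last first.
      by apply: ltW; apply: He; exact: symball_sub h1.
    by rewrite mulrCA [eps * (eps * _)]mulrA eps2 mul1r.
  have y3 : phi w ^+ 3 * Y (phi w) = w ^+ 3 * P (w ^+ 2) + w ^+ 2 ^+ 2 * Q (w ^+ 2).
    transitivity (w ^+ 3 * Z w); first by rewrite /Z Eq; ring.
    by rewrite EZ//; ring.
  have -> : unframe t (phi w ^+ 2 * X (phi w)) (phi w ^+ 3 * Y (phi w)) =
      unframe t (eps * (w ^+ 2, w ^+ 3).1)
      ((w ^+ 2, w ^+ 3).2 * P (w ^+ 2, w ^+ 3).1 + (w ^+ 2, w ^+ 3).1 ^+ 2 * Q (w ^+ 2, w ^+ 3).1).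
    by rewrite x2 y3.
  by rewrite -/(G _) PhiG//; split => //; exact: He'.
Qed.

End Cusp.

(** * Integrals of periodic functions *)

Section Integrals.
Context {R : realType}.
Notation mu := (@lebesgue_measure R).
Implicit Types (g F : R -> R).

Lemma continuous_integrable g (a b : R) : continuous g ->
  mu.-integrable `[a, b] (EFin \o g).
Proof.
move=> cg; apply: continuous_compact_integrable; first exact: segment_compact.
by apply: continuous_subspaceT.
Qed.

Lemma local_antiderivative g (a b : R) : continuous g ->
  exists F, forall x, a < x < b -> is_derive x 1 F (g x).
Proof.
move=> cg; exists (fun x => (\int[mu]_(t in `[a, x]) g t)%R) => x /andP[ax xb].
have [] := @continuous_FTC1_closed R g a x b xb (continuous_integrable _ _ cg) ax (cg x).
by move=> h1 h2; apply: DeriveDef; [exact: h1|rewrite -derive1E; exact: h2].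
Qed.

Lemma Rintegral_FTC g F (a b : R) : a < b -> continuous g ->
  (forall x, a <= x <= b -> is_derive x 1 F (g x)) ->
  (\int[mu]_(t in `[a, b]) g t)%R = F b - F a.
Proof.
move=> ab cg dF; have cF x : a <= x <= b -> {for x, continuous F}.
  by move=> /dF[h _]; exact: derivable_continuous1.
rewrite /Rintegral (@continuous_FTC2 R g F a b)//.
- exact: continuous_subspaceT.
- split.
  + by move=> x; rewrite in_itv /= => /andP[/ltW h1 /ltW h2]; have [] := dF x (introT andP (conj h1 h2)).
  + by apply: cvg_at_right_filter; apply: cF; rewrite lexx ltW.
  + by apply: cvg_at_left_filter; apply: cF; rewrite lexx ltW.
move=> x; rewrite in_itv /= => /andP[/ltW h1 /ltW h2]; rewrite derive1E.
by have [_ ->] := dF x (introT andP (conj h1 h2)).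
Qed.

Lemma is_derive_shift1 F (x a d : R) : is_derive (x + a) 1 F d ->
  is_derive x 1 (fun y => F (y + a)) d.
Proof.
move=> h; have := @isd_comp R F (fun y => y + a) x _ _ h (isdD (isd_id x) (isd_cst a x)).
by rewrite addr0 mulr1.
Qed.

Lemma continuous_shift g (a : R) : continuous g -> continuous (fun t => g (t + a)).
Proof.
move=> cg x; apply: (@continuous_comp _ _ _ (fun t => t + a) g); last exact: cg.
by apply: cvgD; [exact: cvg_id|exact: cvg_cst].
Qed.

Lemma Rintegral_shift_periodic g (P a : R) : 0 < P -> 0 <= a -> continuous g ->
  (forall t, g (t + P) = g t) ->
  (\int[mu]_(t in `[0, P]) g (t + a))%R = (\int[mu]_(t in `[0, P]) g t)%R.
Proof.
rewrite le_eqVlt => P0 /orP[/eqP<- _ _|a0 cg pg].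
  by apply: eq_Rintegral => t _; rewrite addr0.
(* The margin 1 on both sides puts the closed interval from 0 to [P + a] inside the open one where
   [F] is an antiderivative. *)
have [F dF] := local_antiderivative (- 1) (P + a + 1) cg.
have dF' x : 0 <= x <= P + a -> is_derive x 1 F (g x).
  by move=> /andP[x0 x1]; apply: dF; apply/andP; split; lra.
have e1 : (\int[mu]_(t in `[0, P]) g t)%R = F P - F 0.
  by apply: Rintegral_FTC => // x /andP[x0 x1]; apply: dF'; apply/andP; split; lra.
have e2 : (\int[mu]_(t in `[0, P]) g (t + a))%R = F (P + a) - F (0 + a).
  apply: (@Rintegral_FTC (fun t => g (t + a)) (fun t => F (t + a))) => //.
    exact: continuous_shift.
  move=> x /andP[x0 x1]; apply: is_derive_shift1; apply: dF'.
  by apply/andP; split; lra.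
rewrite e1 e2 add0r.
(* Periodicity gives [D] derivative 0, so [D a = D 0]; this is the equality of the two integrals. *)
pose D x := F (x + P) - F x.
have dD x : 0 <= x <= a -> is_derive x 1 D 0.
  move=> /andP[x0 x1]; rewrite -[X in is_derive _ _ _ X](subrr (g x)).
  apply: isdB; last by apply: dF'; apply/andP; split; lra.
  by rewrite -pg; apply: is_derive_shift1; apply: dF'; apply/andP; split; lra.
have [x||c _] := @MVT _ D (fun=> 0) 0 a a0.
- by rewrite in_itv /= => /andP[/ltW h1 /ltW h2]; apply: dD; rewrite h1.
- apply: continuous_in_subspaceT => x; rewrite inE /= in_itv /= => /dD[h _].
  exact: derivable_continuous1.
by rewrite mul0r /D add0r [a + P]addrC => h; lra.
Qed.

Lemma Rintegral_double g (L : R) : 0 < L -> continuous g -> (forall t, g (t + L) = g t) ->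
  (\int[mu]_(t in `[0, 2 * L]) g t)%R = 2 * (\int[mu]_(t in `[0, L]) g t)%R.
Proof.
move=> L0 cg pg; have [F dF] := local_antiderivative (- 1) (2 * L + 1) cg.
have dF' x : 0 <= x <= 2 * L -> is_derive x 1 F (g x).
  by move=> /andP[x0 x1]; apply: dF; apply/andP; split; lra.
have e1 : (\int[mu]_(t in `[0, 2 * L]) g t)%R = F (2 * L) - F 0.
  by apply: Rintegral_FTC => //; rewrite mulr_gt0.
have e2 : (\int[mu]_(t in `[0, L]) g t)%R = F L - F 0.
  by apply: Rintegral_FTC => // x /andP[x0 x1]; apply: dF'; apply/andP; split; lra.
have e3 : (\int[mu]_(t in `[0, L]) g (t + L))%R = F (L + L) - F (0 + L).
  apply: (@Rintegral_FTC (fun t => g (t + L)) (fun t => F (t + L))) => //.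
    exact: continuous_shift.
  move=> x /andP[x0 x1]; apply: is_derive_shift1; apply: dF'.
  by apply/andP; split; lra.
have e4 : (\int[mu]_(t in `[0, L]) g (t + L))%R = (\int[mu]_(t in `[0, L]) g t)%R.
  by apply: eq_Rintegral => t _; rewrite pg.
have e5 : L + L = 2 * L by ring.
by rewrite e3 e2 add0r e5 in e4; rewrite e1 e2; lra.
Qed.

Lemma Rintegral_linear (f g : R -> R) (a b c d : R) : continuous f -> continuous g ->
  (\int[mu]_(t in `[c, d]) (a * f t + b * g t))%R =
  a * (\int[mu]_(t in `[c, d]) f t)%R + b * (\int[mu]_(t in `[c, d]) g t)%R.
Proof.
move=> cf cg.
have i1 : mu.-integrable `[c, d] (EFin \o (fun t => a * f t)).
  by apply: continuous_integrable => t; apply: cvgMr; exact: cf.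
have i2 : mu.-integrable `[c, d] (EFin \o (fun t => b * g t)).
  by apply: continuous_integrable => t; apply: cvgMr; exact: cg.
rewrite RintegralD//.
by rewrite !RintegralZl//; exact: continuous_integrable.
Qed.

End Integrals.

(** * Zeros of periodic functions *)

Section SimpleZeros.
Context {R : realType}.
Context (g g' : R -> R).
Context (dg : forall x : R, is_derive x 1 g (g' x)).
Context (simple : forall x, g x = 0 -> g' x != 0).
Implicit Types (x y a b u v : R).

(* whether g is positive immediately to the left of x *)
Definition pos_left x := (0 < g x) || ((g x == 0) && (g' x < 0)).

(** Half-open intervals and signs taken on the left make the property additive: a zero at a common
    endpoint is counted only in the interval to its right. The list also records that the zeros are
    finitely many. *)
Definition zero_parity a b := exists s : seq R,
  [/\ uniq s, forall x, (x \in s) = (a <= x < b) && (g x == 0) &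
      odd (size s) = pos_left a (+) pos_left b].

Lemma zero_parity_cat a b c : a <= b -> b <= c ->
  zero_parity a b -> zero_parity b c -> zero_parity a c.
Proof.
move=> ab bc [s [us Hs os]] [t [ut Ht ot]]; exists (s ++ t); split.
- rewrite cat_uniq us ut andbT /=; apply/hasPn => x; rewrite Ht Hs.
  by move=> /andP[/andP[bx _] _]; rewrite ltNge bx andbF.
- move=> x; rewrite mem_cat Hs Ht -andb_orl; congr (_ && _).
  have [xb|bx] := ltP x b; first by rewrite andbT orbF (lt_le_trans xb bc) andbT.
  by rewrite andbF /= (le_trans ab bx).
by rewrite size_cat oddD os ot; case: (pos_left a) (pos_left b) (pos_left c) => [] [] [].
Qed.

Lemma continuous_of_derive : continuous g.
Proof. by move=> x; apply: derivable_continuous1; have [] := dg x. Qed.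

Lemma sign_near_zero x : g x = 0 ->
  exists2 d, 0 < d & forall y, `|y - x| < d -> y != x -> 0 < g y * (g' x * (y - x)).
Proof.
move=> gx0; have [h1 h2] := dg x.
have C : (fun h : R => h^-1 *: ((g \o shift x) (h *: 1) - g x)) @ 0^' --> g' x.
  by rewrite -h2; exact: h1.
have g'0 := simple gx0.
have n0 : 0 < `|g' x| by rewrite normr_gt0.
move/cvgrPdist_lt : C => /(_ _ n0); rewrite near_withinE => /nbhs_ballP[d /= d0 H].
exists d => // y yd yx; have hy : y - x != 0 by rewrite subr_eq0.
have := H (y - x); rewrite /ball /= sub0r normrN => /(_ yd hy).
rewrite [_%:A]mulr1 subrK gx0 subr0 /GRing.scale /=.
set q := (y - x)^-1 * g y => Hq.
have -> : g y = q * (y - x) by rewrite /q mulrC mulrA divff// mul1r.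
have -> : q * (y - x) * (g' x * (y - x)) = (q * g' x) * (y - x) ^+ 2 by ring.
rewrite mulr_gt0//; last by rewrite exprn_even_gt0.
move: Hq; have [gp|gn] : 0 < g' x \/ g' x < 0 by move: g'0; rewrite neq_lt => /orP[]; [right|left].
  rewrite [ltRHS]gtr0_norm// ltr_norml => /andP[_ h].
  by rewrite mulr_gt0//; lra.
rewrite [ltRHS]ltr0_norm// ltr_norml => /andP[h _].
by rewrite nmulr_rgt0//; lra.
Qed.

Lemma sign_near_nonzero x : g x != 0 ->
  exists2 d, 0 < d & forall y, `|y - x| < d -> 0 < g y * g x.
Proof.
move=> gx; have n0 : 0 < g x * g x by rewrite -expr2 exprn_even_gt0.
have C : g y * g x @[y --> x] --> g x * g x.
  by apply: cvgMl; exact: continuous_of_derive.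
have /nbhs_ballP[d /= d0 H] : \forall y \near x, 0 < g y * g x by exact: cvgr_gt C _ n0.
by exists d => // y yd; apply: H; rewrite /ball /= distrC.
Qed.

(** Just left of [x] there is no zero and the sign is the one recorded by [pos_left x]. Starting at
    [x] there is at most the zero [x] itself, and being simple it flips the sign. *)
Lemma zero_parity_local x : exists2 d, 0 < d &
  (forall u, x - d < u <= x -> zero_parity u x) /\
  (forall v, x <= v < x + d -> zero_parity x v).
Proof.
have triv y : zero_parity y y.
  exists [::]; split => //; last by rewrite addbb.
  by move=> z; rewrite in_nil; case: leP => //= yz; rewrite ltNge yz.
have nozero a b : (forall y, a <= y < b -> g y != 0) -> pos_left a = pos_left b -> zero_parity a b.
  move=> H e; exists [::]; split => //; last by rewrite e addbb.
  by move=> z; rewrite in_nil; apply/esym/negP => /andP[/H/negPf ->].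
have pl y : g y != 0 -> pos_left y = (0 < g y) by rewrite /pos_left => /negPf ->; rewrite orbF.
have pos_iff y z : 0 < y * z -> (0 < y) = (0 < z :> R).
  move=> yz; have [z0|z0|z0] := ltgtP z 0.
  - by apply/negbTE; rewrite -leNgt; nra.
  - by nra.
  - by rewrite z0 mulr0 ltxx in yz.
have [gx0|gx] := eqVneq (g x) 0.
  have [d d0 H] := sign_near_zero gx0; exists d => //.
  have nz y : `|y - x| < d -> y != x -> g y != 0.
    by move=> h1 h2; have := H y h1 h2; apply: contraTneq => ->; rewrite mul0r ltxx.
  have plx : pos_left x = (g' x < 0) by rewrite /pos_left gx0 ltxx eqxx.
  split.
    move=> u /andP[h1]; rewrite le_eqVlt => /orP[/eqP ->//|ux].
    have ud y : u <= y < x -> `|y - x| < d /\ y != x.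
      by move=> /andP[uy yx]; rewrite lt_eqF// ltr0_norm ?subr_lt0//; split => //; lra.
    have uu : u <= u < x by rewrite lexx.
    apply: nozero => [y /ud[]|]; first exact: nz.
    have [u1 u2] := ud u uu; rewrite plx pl ?nz// (pos_iff _ _ (H u u1 u2)).
    by rewrite nmulr_lgt0// subr_lt0.
  move=> v /andP[]; rewrite le_eqVlt => /orP[/eqP ->//|xv] h1.
  have vd y : x < y <= v -> `|y - x| < d /\ y != x.
    by move=> /andP[xy yv]; rewrite gt_eqF// gtr0_norm ?subr_gt0//; split => //; lra.
  have vv : x < v <= v by rewrite lexx andbT.
  have [v1 v2] := vd v vv.
  exists [:: x]; split => //.
    move=> y; rewrite inE; have [->|yx] := eqVneq y x; first by rewrite lexx xv gx0 eqxx.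
    apply/esym/negP => /andP[/andP[xy yv]]; apply/negP; apply: nz => //.
    by have [] := vd y _ => //; rewrite lt_neqAle eq_sym yx xy ltW.
  rewrite plx pl ?nz// (pos_iff _ _ (H v v1 v2)) pmulr_lgt0 ?subr_gt0//=.
  by have := simple gx0; rewrite neq_lt; case: ltgtP.
have [d d0 H] := sign_near_nonzero gx; exists d => //.
have nz y : `|y - x| < d -> g y != 0.
  by move=> /H; apply: contraTneq => ->; rewrite mul0r ltxx.
have xx : `|x - x| < d by rewrite subrr normr0.
have same y : `|y - x| < d -> pos_left y = pos_left x.
  by move=> h; rewrite !pl ?nz//; exact: pos_iff (H _ h).
split.
  move=> u /andP[h1 h2]; have h3 : `|u - x| < d by rewrite ltr_norml; apply/andP; split; lra.
  apply: nozero; last exact: same.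
  by move=> y /andP[h4 h5]; apply: nz; rewrite ltr_norml; apply/andP; split; lra.
move=> v /andP[h1 h2]; have h3 : `|v - x| < d by rewrite ltr_norml; apply/andP; split; lra.
apply: nozero; last by rewrite same.
by move=> y /andP[h4 h5]; apply: nz; rewrite ltr_norml; apply/andP; split; lra.
Qed.

(** Induction along the interval: at the supremum of the endpoints reached, the local statement
    bridges the gap on its left and, before [b], goes beyond it. Finiteness of the zeros comes out
    together with the parity. *)
Lemma zero_parity_all a b : a <= b -> zero_parity a b.
Proof.
move=> ab; pose S := [set c | a <= c <= b /\ zero_parity a c].
have Sa : S a.
  split; first by rewrite lexx.
  have [d d0 [_ H]] := zero_parity_local a; apply: H; rewrite lexx ltrDl//.
have hS : has_sup S by split; [exists a|exists b => c [/andP[_]]].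
have ubS := sup_upper_bound hS; pose m := sup S.
have am : a <= m by exact: ubS.
have mb : m <= b by apply: ge_sup => [|c [/andP[_]]//]; exists a.
have [d d0 [H1 H2]] := zero_parity_local m.
have [c [/andP[ac cb] Qc] mc] := sup_adherent d0 hS.
have cm : c <= m by apply: ubS; split => //; rewrite ac.
have Qm : zero_parity a m.
  by apply: zero_parity_cat Qc (H1 c _) => //; rewrite mc.
have [mb'|bm] := ltP m b; last by have <- : m = b by apply/eqP; rewrite eq_le mb.
pose v := Num.min b (m + d / 2).
have mv : m < v by rewrite lt_min mb' ltrDl divr_gt0.
have vd : v < m + d by rewrite gt_min; apply/orP; right; rewrite ltrD2l; lra.
have : S v.
  split; first by rewrite (le_trans am (ltW mv)) ge_min lexx.
  by apply: zero_parity_cat Qm (H2 v _) => //; rewrite ltW// vd.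
by move=> /ubS; rewrite leNgt mv.
Qed.

Lemma periodic_zeros_even P : 0 < P -> (forall x, g (x + P) = g x) ->
  exists s : seq R, [/\ uniq s, forall x, (x \in s) = (0 <= x < P) && (g x == 0) &
    ~~ odd (size s)].
Proof.
move=> P0 pg; have [s [us Hs os]] := zero_parity_all (ltW P0).
exists s; split => //; rewrite os.
(* The derivative of a periodic function is periodic, so the left sign takes the same value at both
   ends. *)
suff -> : pos_left P = pos_left 0 by rewrite addbb.
have e : g P = g 0 by rewrite -(add0r P) pg.
have e' : g' P = g' 0.
  have [_ <-] := dg 0; have [_ <-] := dg P.
  have := @isd_comp R g (fun x => x + P) 0 (g' P) _.
  rewrite add0r => /(_ _ (dg P) (isdD (isd_id 0) (isd_cst P 0)))[_].
  rewrite addr0 mulr1 => e1; have [_ ->] := dg P; rewrite -e1.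
  by rewrite (_ : (fun y => g (y + P)) = g)//; apply/funext => x; rewrite pg.
by rewrite /pos_left e e'.
Qed.

End SimpleZeros.

Lemma card_seq_set (T : eqType) (s : seq T) (A : set T) : uniq s ->
  (forall x, A x <-> x \in s) -> (A #= `I_(size s))%card.
Proof.
move=> us H; have -> : `I_(size s) = (index ^~ s) @` A.
  apply/seteqP; split => [i /= is_|_ [x /H xs <-]]; last by rewrite /= index_mem.
  case: s us H is_ => // y t us H is_.
  exists (nth y (y :: t) i); last exact: index_uniq.
  by apply/H/mem_nth.
rewrite card_eq_sym; apply: inj_card_eq => x y.
rewrite !inE => /H xs /H ys; exact: index_inj.
Qed.

(** * Curves parameterized by the direction of the tangent line *)

Section TangentCurves.
Context {R : realType}.
Implicit Types (c : R -> R * R) (tau : R -> R) (t : R).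

Lemma isd_addl (t u : R) : is_derive u 1 (fun x => t + x) (1 : R).
Proof. by have := isdD (isd_cst t u) (isd_id u); rewrite add0r. Qed.

Definition velocity_dir t : R * R := (- sin t, cos t).

Lemma smooth_derive1W (W : normedModType R) (F : R -> W) :
  smooth setT F -> smooth setT (derive1 F).
Proof.
move=> sF k; have [_ /(_ 1)[_ H]] := sF k.+1.
by rewrite (_ : derive1 F = fun x => 'D_1 F x)//; apply/funext => x; rewrite derive1E.
Qed.

Lemma smooth_is_deriveW (W : normedModType R) (F : R -> W) t :
  smooth setT F -> is_derive t 1 F (derive1 F t).
Proof.
by move=> sF; rewrite derive1E; apply: derivableP; have [_ /(_ 1)[H _]] := sF 1%N; exact: H.
Qed.

Lemma derive1_of (W : normedModType R) (F : R -> W) t d : is_derive t 1 F d -> derive1 F t = d.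
Proof. by move=> [_ <-]; rewrite derive1E. Qed.

Lemma smooth_fstT c : smooth setT c -> smooth setT (fun t => (c t).1).
Proof. by move=> sc; apply: smooth_fst => //; exact: openT. Qed.

Lemma smooth_sndT c : smooth setT c -> smooth setT (fun t => (c t).2).
Proof. by move=> sc; apply: smooth_snd => //; exact: openT. Qed.

(** The scalar [tau] may vanish or change sign, so the notion covers both the rosette, with [tau]
    its radius of curvature, and the branches across their cusps. *)
Definition tangent_curve c tau :=
  [/\ smooth setT c, smooth setT tau & forall t : R, is_derive t 1 c (tau t *: velocity_dir t)].

Lemma tangent_curve_derive1 c tau t : tangent_curve c tau ->
  derive1 c t = tau t *: velocity_dir t.
Proof. by move=> [_ _ /(_ t)]; exact: derive1_of. Qed.

Lemma velocity_dir_neq0 t : velocity_dir t <> 0.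
Proof.
move=> [/eqP]; rewrite oppr_eq0 => /eqP s0 c0; have := cos2Dsin2 t.
by rewrite s0 c0 expr0n /= addr0 => /eqP; rewrite eq_sym oner_eq0.
Qed.

Lemma tangent_curve_singular c tau t : tangent_curve c tau ->
  singular_point c t <-> tau t = 0.
Proof.
move=> tc; rewrite /singular_point (tangent_curve_derive1 t tc); split.
  by move=> /eqP; rewrite scaler_eq0 => /orP[/eqP//|/eqP /velocity_dir_neq0].
by move=> ->; rewrite scale0r.
Qed.

Lemma dot_velocity_dir a b t : dot (a *: velocity_dir t) (b *: velocity_dir t) = a * b.
Proof.
by rewrite /dot /= /GRing.scale /= -[RHS](mulr_cos2Dsin2 t); ring.
Qed.

Lemma enorm_velocity_dir a t : enorm (a *: velocity_dir t) = `|a|.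
Proof. by rewrite /enorm dot_velocity_dir -expr2 sqrtr_sqr. Qed.

Lemma tangent_curve_derive2 c tau t : tangent_curve c tau ->
  derive1n 2 c t = (- (derive1 tau t * sin t + tau t * cos t),
                    derive1 tau t * cos t - tau t * sin t).
Proof.
move=> tc; have [_ st _] := tc; rewrite derive1nS.
have -> : derive1n 1 c = fun t => (tau t * - sin t, tau t * cos t).
  by apply/funext => x; rewrite derive1n1 (tangent_curve_derive1 _ tc).
have h := @smooth_is_derive _ setT tau t st I.
apply: derive1_of; rewrite (_ : (_, _) = (derive1 tau t * - sin t + tau t * - cos t,
   derive1 tau t * cos t + tau t * - sin t)); last by congr (_, _); ring.
apply: is_derive_pair.
  by apply: isdM => //; exact: isdN (is_derive_sin t).
by apply: isdM => //; exact: is_derive_cos.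
Qed.

(** The determinant of the first two derivatives is [tau ^+ 2] whatever the sign of [tau], so a
    branch run in the direction opposite to [velocity_dir] also has positive curvature. *)
Lemma tangent_curve_curvature c tau t : tangent_curve c tau -> tau t != 0 ->
  curvature c t = `|tau t|^-1.
Proof.
move=> tc t0; rewrite /curvature (tangent_curve_derive2 t tc) (tangent_curve_derive1 t tc).
rewrite enorm_velocity_dir /det2 /= /GRing.scale /=.
have -> : tau t * - sin t * (derive1 tau t * cos t - tau t * sin t) -
    tau t * cos t * - (derive1 tau t * sin t + tau t * cos t) =
    tau t ^+ 2 * (cos t ^+ 2 + sin t ^+ 2) by ring.
rewrite cos2Dsin2 mulr1 -(real_normK (num_real (tau t))).
have : `|tau t| != 0 by rewrite normr_eq0.
by move: (`|tau t|) => x x0; field.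
Qed.

(** In the frame at [t] the coordinates have derivatives [tau (t + u) * cos u] and
    [- tau (t + u) * sin u], which vanish at [u = 0] to orders 1 and 2; the coordinates therefore
    start with [tau' / 2 * u ^ 2] and [- tau' / 3 * u ^ 3]. *)
Lemma tangent_curve_cusp c tau t : tangent_curve c tau ->
  tau t = 0 -> derive1 tau t != 0 -> cusp c t.
Proof.
move=> tc t0 dt0; have [sc st dc] := tc.
have [s ss Es] : exists2 s, smooth (symball 1) s & forall u, tau (t + u) = u * s u.
  apply: (@smooth_div_id R 1 (fun u => tau (t + u))) => //; last by rewrite addr0.
  apply: (@smooth_comp _ _ _ (@open_symball R 1) setT (fun u => t + u) tau) => //.
    exact: openT.
  by apply: smoothD; [exact: open_symball|exact: smooth_cst|exact: smooth_id].
have [sn ssn Esn] : exists2 s, smooth (symball 1) s & forall u : R, sin u = u * s u.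
  apply: smooth_div_id => //; last exact: sin0.
  by apply: smooth_sin; [exact: open_symball|exact: smooth_id].
have z1 : symball 1 (0 : R) by rewrite /symball /= normr0.
have s0 : s 0 = derive1 tau t.
  have h := isdM (isd_id 0) (smooth_is_derive ss z1).
  rewrite mul1r mul0r addr0 in h.
  have h2 : is_derive (0 : R) 1 (fun u => tau (t + u)) (derive1 tau t).
    rewrite -[X in is_derive _ _ _ X]mulr1; apply: isd_comp.
      by rewrite addr0; exact: (@smooth_is_derive _ setT).
    exact: isd_addl.
  rewrite -(derive1_of h) -(derive1_of h2); congr (derive1 _ 0).
  by apply/funext => u; rewrite Es.
have sn0 : sn 0 = 1.
  have h := isdM (isd_id 0) (smooth_is_derive ssn z1).
  rewrite mul1r mul0r addr0 in h.
  rewrite -(derive1_of h) -(@cos0 R) -(derive1_of (is_derive_sin 0)); congr (derive1 _ 0).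
  by apply/funext => u; rewrite Esn.
have dcu1 (u : R) : is_derive u 1 (fun u => (c (t + u)).1) (- (tau (t + u) * sin (t + u))).
  have := is_derive_fst (dc (t + u)); rewrite /= /GRing.scale /= mulrN => h.
  rewrite -[X in is_derive _ _ _ X]mulr1; apply: (@isd_comp R (fun t => (c t).1)) => //.
  exact: isd_addl.
have dcu2 (u : R) : is_derive u 1 (fun u => (c (t + u)).2) (tau (t + u) * cos (t + u)).
  have := is_derive_snd (dc (t + u)); rewrite /= /GRing.scale /= => h.
  rewrite -[X in is_derive _ _ _ X]mulr1; apply: (@isd_comp R (fun t => (c t).2)) => //.
  exact: isd_addl.
pose x u := frame_x t (c (t + u) - c t); pose y u := frame_y t (c (t + u) - c t).
have dx (u : R) : is_derive u 1 x (u ^+ 1 * (s u * cos u)).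
  have h := isdD (isdZ (- sin t) (isdB (dcu1 u) (isd_cst (c t).1 u)))
    (isdZ (cos t) (isdB (dcu2 u) (isd_cst (c t).2 u))).
  apply: (is_derive_eq h); rewrite expr1 mulrA -Es.
  have -> : cos u = cos (t + u - t) by congr cos; ring.
  by rewrite cosB; ring.
have dy (u : R) : is_derive u 1 y (u ^+ 2 * (- (s u * sn u))).
  have h := isdD (isdZ (cos t) (isdB (dcu1 u) (isd_cst (c t).1 u)))
    (isdZ (sin t) (isdB (dcu2 u) (isd_cst (c t).2 u))).
  apply: (is_derive_eq h).
  have -> : u ^+ 2 * - (s u * sn u) = - (u * s u * (u * sn u)) by ring.
  rewrite -Es -Esn.
  have -> : sin u = sin (t + u - t) by congr sin; ring.
  by rewrite sinB; ring.
have oB := @open_symball R 1.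
have [X [sX X0 EX]] : exists r, [/\ smooth (symball 1) r, r 0 = (s 0 * cos 0) / 2%:R &
    forall u, x u = u ^+ 2 * r u].
  apply: (@power_primitive R 1 1 x (fun u => s u * cos u)) => //.
    by rewrite /x addr0 subrr /frame_x /= !mulr0 addr0.
  by apply: smoothM => //; apply: smooth_cos => //; exact: smooth_id.
have [Y [sY Y0 EY]] : exists r, [/\ smooth (symball 1) r, r 0 = - (s 0 * sn 0) / 3%:R &
    forall u, y u = u ^+ 3 * r u].
  apply: (@power_primitive R 1 2 y (fun u => - (s u * sn u))) => //.
    by rewrite /y addr0 subrr /frame_y /= !mulr0 addr0.
  by apply: smoothN => //; exact: smoothM.
apply: (@cusp_of_expansion R c t 1 X Y) => //.
- by rewrite X0 s0 cos0 mulr1 mulf_neq0// invr_eq0.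
- by rewrite Y0 s0 sn0 mulr1 mulf_neq0// ?oppr_eq0// invr_eq0.
- by move=> u _; rewrite -EX -EY unframeK [RHS]addrC subrK.
by apply/(tangent_curve_singular t tc).
Qed.

End TangentCurves.

(** * Multiples of pi and points of the circle *)

Section Trigonometry.
Context {R : realType}.
Implicit Types (x y : R) (m : int).

Lemma antiperiodic_mulz (F : R -> R) x m : (forall x, F (x + pi) = - F x) ->
  F (x + m%:~R * pi) = (-1) ^+ `|m|%N * F x.
Proof.
move=> aF; have H (k : nat) y : F (y + k%:R * pi) = (-1) ^+ k * F y.
  elim: k => [|k IH]; first by rewrite mul0r addr0 expr0 mul1r.
  by rewrite mulrSr mulrDl mul1r addrA aF IH exprS mulN1r mulNr.
case: m => k; first exact: H.
have {2}-> : x = x + (Negz k)%:~R * pi + k.+1%:R * pi.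
  by rewrite NegzE mulrNz mulNr subrK.
by rewrite H mulrA -exprD addnn -mul2n exprM sqrrN expr1n expr1n mul1r.
Qed.

Lemma sin_addzpi x m : sin (x + m%:~R * pi) = (-1) ^+ `|m|%N * sin x.
Proof. by apply: antiperiodic_mulz; exact: sinDpi. Qed.

Lemma cos_addzpi x m : cos (x + m%:~R * pi) = (-1) ^+ `|m|%N * cos x.
Proof. by apply: antiperiodic_mulz; exact: cosDpi. Qed.

Lemma sin_addkpi x (k : nat) : sin (x + k%:R * pi) = (-1) ^+ k * sin x.
Proof. exact: (sin_addzpi x k%:Z). Qed.

Lemma cos_addkpi x (k : nat) : cos (x + k%:R * pi) = (-1) ^+ k * cos x.
Proof. exact: (cos_addzpi x k%:Z). Qed.

Lemma periodic_mulz (W : Type) (F : R -> W) (P x : R) m : (forall x, F (x + P) = F x) ->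
  F (x + m%:~R * P) = F x.
Proof.
move=> pF; have H (k : nat) y : F (y + k%:R * P) = F y.
  elim: k => [|k IH]; first by rewrite mul0r addr0.
  by rewrite mulrSr mulrDl mul1r addrA pF.
by case: m => k; [exact: H|rewrite -(H k.+1) NegzE mulrNz mulNr subrK].
Qed.

Lemma period_reduce (P x : R) : 0 < P -> exists m, 0 <= x + m%:~R * P < P.
Proof.
move=> P0; exists (- Num.floor (x / P)); have := floor_itv (x / P).
rewrite ler_pdivlMr// ltr_pdivrMr// intrD mulrDl mul1r mulrNz mulNr => /andP[h1 h2].
by apply/andP; split; lra.
Qed.

Lemma sin_eq0_pi x : sin x = 0 -> exists m, x = m%:~R * pi.
Proof.
move=> sx; have [m /andP[a b]] := period_reduce x (pi_gt0 R); exists (- m).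
have s0 := sin_addzpi x m; rewrite sx mulr0 in s0.
rewrite mulrNz mulNr; apply/eqP; rewrite -addr_eq0.
move: a; rewrite le_eqVlt eq_sym => /orP[//|x0].
by have := sin_gt0_pi (introT andP (conj x0 b)); rewrite s0 ltxx.
Qed.

Lemma sin_addkpi0 (k : nat) : sin (k%:R * pi) = 0 :> R.
Proof. by rewrite -[X in sin X]add0r sin_addkpi sin0 mulr0. Qed.

(** The difference has sine 0, so it is [m * pi], and cosine 1, so [m] is even. *)
Lemma cos_sin_inj x y : cos x = cos y -> sin x = sin y -> exists m, x = y + m%:~R * (2 * pi).
Proof.
move=> cxy sxy; have /sin_eq0_pi[m E] : sin (x - y) = 0 by rewrite sinB cxy sxy; ring.
have c1 : cos (x - y) = 1 by rewrite cosB cxy sxy -!expr2 cos2Dsin2.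
have := cos_addzpi 0 m; rewrite add0r -E c1 cos0 mulr1 => /esym.
rewrite -signr_odd; case: (boolP (odd `|m|%N)) => om /=.
  by rewrite expr1 => /eqP; rewrite eq_sym -subr_eq0 opprK (_ : 1 + 1 = 2%:R)// pnatr_eq0.
move=> _; have [k mk] : exists k, m = k * 2.
  exists (m %/ 2)%Z; apply/esym/divzK.
  by rewrite dvdzE /= dvdn2.
by exists k; rewrite -[LHS](subrK y) E mk addrC intrM; ring.
Qed.

Lemma cos_addz2pi x m : cos (x + m%:~R * (2 * pi)) = cos x.
Proof.
have -> : m%:~R * (2 * pi) = (m * 2)%:~R * pi :> R by rewrite intrM; ring.
by rewrite cos_addzpi abszM mulnC exprM sqrrN expr1n expr1n mul1r.
Qed.

Lemma sin_addz2pi x m : sin (x + m%:~R * (2 * pi)) = sin x.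
Proof.
have -> : m%:~R * (2 * pi) = (m * 2)%:~R * pi :> R by rewrite intrM; ring.
by rewrite sin_addzpi abszM mulnC exprM sqrrN expr1n expr1n mul1r.
Qed.

Lemma velocity_dir_addkpi x (k : nat) : velocity_dir (x + k%:R * pi) = (-1) ^+ k *: velocity_dir x.
Proof. by rewrite /velocity_dir sin_addkpi cos_addkpi /GRing.scale /= -mulrN. Qed.

Lemma period_pi (n : nat) : (period n : R) = (2 * n)%:R * pi.
Proof. by rewrite /period natrM. Qed.

Lemma velocity_dir_period x (n : nat) : velocity_dir (x + period n) = velocity_dir x.
Proof. by rewrite period_pi velocity_dir_addkpi exprM sqrrN expr1n expr1n scale1r. Qed.

Lemma circle_pt_eq (T s t : R) : 0 < T ->
  circle_pt T s = circle_pt T t <-> exists m, s = t + m%:~R * T.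
Proof.
move=> T0; have T1 : T != 0 by rewrite gt_eqF.
have p1 : 2 * pi != 0 :> R by rewrite mulf_neq0// gt_eqF// pi_gt0.
split=> [[c s']|[m ->]].
  have [m E] := cos_sin_inj c s'; exists m; apply: (mulfI p1).
  rewrite -[LHS](divfK T1) E; field.
  by rewrite T1.
rewrite /circle_pt; have -> : 2 * pi * (t + m%:~R * T) / T = 2 * pi * t / T + m%:~R * (2 * pi).
  by field.
by rewrite cos_addz2pi sin_addz2pi.
Qed.

End Trigonometry.

(** * Determinants, scalar products and smoothness of the curvature *)

Section CurvatureFacts.
Context {R : realType}.
Implicit Types (c f : R -> R * R) (t theta : R).

Lemma det2Z (a b : R) (u v : R * R) : det2 (a *: u) (b *: v) = a * b * det2 u v.
Proof. by rewrite /det2 /= /GRing.scale /=; ring. Qed.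

Lemma dotZ (a b : R) (u v : R * R) : dot (a *: u) (b *: v) = a * b * dot u v.
Proof. by rewrite /dot /= /GRing.scale /=; ring. Qed.

Lemma det2_velocity_dir (a b : R) : det2 (velocity_dir a) (velocity_dir b) = sin (b - a).
Proof. by rewrite /det2 /= sinB; ring. Qed.

Lemma dot_velocity_dir2 (a b : R) : dot (velocity_dir a) (velocity_dir b) = cos (b - a).
Proof. by rewrite /dot /= cosB; ring. Qed.

Lemma enorm_gt0 (u : R * R) : u <> 0 -> 0 < enorm u.
Proof.
move=> u0; rewrite sqrtr_gt0 /dot -!expr2 lt_neqAle eq_sym addr_ge0 ?sqr_ge0// andbT.
rewrite paddr_eq0 ?sqr_ge0// !sqrf_eq0; apply/negP => /andP[/eqP a /eqP b]; apply: u0.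
by case: u a b => x y /= -> ->.
Qed.

Lemma enorm_dot_gt0 (u : R * R) : 0 < enorm u -> 0 < dot u u.
Proof. by rewrite sqrtr_gt0. Qed.

Lemma smooth_dot (A : set R) (u v : R -> R * R) : open A -> smooth A u -> smooth A v ->
  smooth A (fun t => dot (u t) (v t)).
Proof.
move=> oA su sv; apply: smoothD => //; apply: smoothM => //;
  by [exact: smooth_fst|exact: smooth_snd].
Qed.

Lemma smooth_det2 (A : set R) (u v : R -> R * R) : open A -> smooth A u -> smooth A v ->
  smooth A (fun t => det2 (u t) (v t)).
Proof.
move=> oA su sv; apply: smoothB => //; apply: smoothM => //;
  by [exact: smooth_fst|exact: smooth_snd].
Qed.

Lemma smooth_curvature c : smooth setT c -> regular c -> smooth setT (curvature c).
Proof.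
move=> sc rc; have oT : open [set: R] by exact: openT.
have sc1 := smooth_derive1W sc.
have sc2 : smooth setT (derive1n 2 c) by rewrite derive1nS; exact: smooth_derive1W.
have e0 t : 0 < enorm (derive1 c t) by apply: enorm_gt0; exact: rc.
apply: (smoothM oT); first exact: (smooth_det2 oT sc1 sc2).
apply: (smoothV oT); first by move=> t _; rewrite expf_neq0// gt_eqF.
apply: smoothX; first exact: oT.
apply: (smooth_sqrt oT); last exact: (smooth_dot oT sc1 sc1).
by move=> t _; apply: enorm_dot_gt0.
Qed.

Lemma is_derive_comp_curve (W : normedModType R) (F : R -> W) (g : R -> R) x a b :
  is_derive (g x) 1 F a -> is_derive x 1 g b -> is_derive x 1 (fun y => F (g y)) (b *: a).
Proof.
move=> [h1 h2] [h3 h4].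
have d1 : differentiable F (g x) by apply/derivable1_diffP.
have d2 : differentiable g x by apply/derivable1_diffP.
have d3 : differentiable (F \o g) x by exact: differentiable_comp.
apply: DeriveDef; first by apply: (@diff_derivable _ _ _ (F \o g)).
rewrite -[LHS]/('D_1 (F \o g) x) -derive1E derive1E'//.
rewrite diff_comp//= -[X in 'd F _ X]mulr1 -h2 -h4 -!derive1E (derive1E' d1) (derive1E' d2).
by rewrite [LHS]linearZ.
Qed.

End CurvatureFacts.

(** * Rosettes parameterized by the angle of the tangent *)

Section SupportFunction.
Context {R : realType} (n : nat) (T : R) (f : R -> R * R) (p phi : R -> R).
Context (cf : closed_curve T f) (rf : regular f).
Context (sphi : smooth [set: R] phi) (phi_incr : forall theta, 0 < derive1 phi theta)
  (phi_period : forall theta, phi (theta + period n) = phi theta + T)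
  (f_dir : forall theta, derive1 f (phi theta) =
     enorm (derive1 f (phi theta)) *: (- sin theta, cos theta))
  (pE : forall theta, p theta = dot (f (phi theta)) (cos theta, sin theta)).

Let gam := polar_tangential p.
(** The derivative of arc length with respect to the tangent angle, that is, the radius of
    curvature. *)
Definition radius theta : R := enorm (derive1 f (phi theta)) * derive1 phi theta.

Let sf : smooth setT f. Proof. by case: cf. Qed.
Let oT : open [set: R]. Proof. exact: openT. Qed.

Lemma speed_gt0 theta : 0 < enorm (derive1 f (phi theta)).
Proof. exact/enorm_gt0/rf. Qed.

Lemma radius_gt0 theta : 0 < radius theta.
Proof. by rewrite mulr_gt0// speed_gt0. Qed.

Lemma smooth_f_phi (F : R -> R * R) : smooth setT F -> smooth setT (fun x => F (phi x)).
Proof.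
move=> sF.
apply: (@smooth_ext _ _ _ oT _ (fun x => ((F (phi x)).1, (F (phi x)).2))).
  by move=> x _; case: (F (phi x)).
apply: smooth_pair => //.
  by apply: (@smooth_comp _ _ _ oT setT phi (fun x => (F x).1)) => //; exact: smooth_fstT.
by apply: (@smooth_comp _ _ _ oT setT phi (fun x => (F x).2)) => //; exact: smooth_sndT.
Qed.

Lemma is_derive_f_phi (theta : R) :
  is_derive theta 1 (fun x => f (phi x)) (radius theta *: velocity_dir theta).
Proof.
have h := is_derive_comp_curve (smooth_is_deriveW (phi theta) sf)
  (@smooth_is_derive _ setT phi theta sphi I).
apply: (is_derive_eq h); by rewrite {1}f_dir scalerA /radius mulrC.
Qed.

(** The velocity is orthogonal to [(cos theta, sin theta)], so [p'] is the coordinate of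
    [f (phi theta)] along [(- sin theta, cos theta)]; [p] and [p'] are thus its coordinates in an
    orthonormal frame. *)
Lemma polar_tangentialE theta : gam theta = f (phi theta).
Proof.
have h := is_derive_f_phi theta.
have h1 := is_derive_fst h; have h2 := is_derive_snd h.
have dp : is_derive theta 1 p (- (f (phi theta)).1 * sin theta + (f (phi theta)).2 * cos theta).
  have -> : p = fun x => (f (phi x)).1 * cos x + (f (phi x)).2 * sin x.
    by apply/funext => x; rewrite pE.
  have := isdD (isdM h1 (is_derive_cos theta)) (isdM h2 (is_derive_sin theta)).
  by move=> h3; apply: (is_derive_eq h3); rewrite /= /GRing.scale /=; ring.
rewrite /gam /polar_tangential (derive1_of dp) pE /dot /=.
case: (f (phi theta)) => a b /=; congr (_, _).
  by rewrite -[RHS](mulr_cos2Dsin2 theta); ring.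
by rewrite -[RHS](mulr_cos2Dsin2 theta); ring.
Qed.

Lemma polar_tangential_f_phi : gam = fun x => f (phi x).
Proof. by apply/funext => x; exact: polar_tangentialE. Qed.

Lemma smooth_speed : smooth setT (fun x => enorm (derive1 f (phi x))).
Proof.
have s := smooth_f_phi (smooth_derive1W sf).
apply: (smooth_sqrt oT); last exact: (smooth_dot oT s s).
by move=> t _; apply: enorm_dot_gt0; exact: speed_gt0.
Qed.

Lemma smooth_radius : smooth setT radius.
Proof. by apply: smoothM => //; [exact: smooth_speed|exact: smooth_derive1]. Qed.

Lemma tangent_curve_gamma : tangent_curve gam radius.
Proof.
rewrite polar_tangential_f_phi; split.
- exact: smooth_f_phi.
- exact: smooth_radius.
- exact: is_derive_f_phi.
Qed.

Lemma gamma_period theta : gam (theta + period n) = gam theta.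
Proof. by rewrite !polar_tangentialE phi_period; case: cf => _ _ ->. Qed.

Lemma radius_period theta : radius (theta + period n) = radius theta.
Proof.
have tg := tangent_curve_gamma; have [_ _ dg] := tg.
have h1 : is_derive theta 1 gam (radius (theta + period n) *: velocity_dir theta).
  have := @is_derive_comp_curve R _ gam (fun y => y + period n) theta _ _ (dg (theta + period n))
    (isdD (isd_id theta) (isd_cst (period n) theta)).
  rewrite addr0 scale1r velocity_dir_period.
  by rewrite (_ : (fun y => gam (y + period n)) = gam)//; apply/funext => x; rewrite gamma_period.
have := derive1_of h1; rewrite (derive1_of (dg theta)) => /eqP.
rewrite -subr_eq0 -scalerBl scaler_eq0 => /orP[|/eqP /velocity_dir_neq0//].
by rewrite subr_eq0 eq_sym => /eqP.
Qed.

Lemma curvature_f_phi theta : curvature f (phi theta) = (radius theta)^-1.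
Proof.
have dphi := @smooth_is_derive _ setT phi theta sphi I.
have h1 := is_derive_comp_curve (smooth_is_deriveW (phi theta) (smooth_derive1W sf)) dphi.
(* [w] is the derivative of the speed; it multiplies the tangent direction and cancels in the
   determinant with the velocity. *)
have [w h2] : exists w : R, is_derive theta 1 (fun x => derive1 f (phi x))
    (w *: velocity_dir theta - enorm (derive1 f (phi theta)) *: (cos theta, sin theta)).
  exists (derive1 (fun x => enorm (derive1 f (phi x))) theta).
  have hs := @smooth_is_derive _ setT (fun x => enorm (derive1 f (phi x))) theta smooth_speed I.
  have e : (fun x => derive1 f (phi x)) = fun x => (enorm (derive1 f (phi x)) * - sin x,
      enorm (derive1 f (phi x)) * cos x).
    by apply/funext => x; rewrite {1}f_dir.
  rewrite {1}e.
  have := is_derive_pair (isdM hs (isdN (is_derive_sin theta))) (isdM hs (is_derive_cos theta)).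
  by move=> h; apply: (is_derive_eq h); congr (_, _); rewrite /= /GRing.scale /=; ring.
have E := etrans (esym (derive1_of h2)) (derive1_of h1).
have v0 := speed_gt0 theta; have ph0 := phi_incr theta.
have E2 : derive1n 2 f (phi theta) = (derive1 phi theta)^-1 *:
   (w *: velocity_dir theta - enorm (derive1 f (phi theta)) *: (cos theta, sin theta)).
  by rewrite E scalerA mulVf ?scale1r ?gt_eqF.
rewrite /curvature E2 {1}f_dir /radius.
move: v0 ph0; move: (enorm _) (derive1 phi theta) => v q v0 q0.
rewrite /det2 /= /GRing.scale /=.
have -> : v * - sin theta * (q^-1 * (w * cos theta - v * sin theta)) -
  v * cos theta * (q^-1 * (w * - sin theta - v * cos theta)) =
  q^-1 * v ^+ 2 * (cos theta ^+ 2 + sin theta ^+ 2) by ring.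
rewrite cos2Dsin2 mulr1.
have v1 : v != 0 by rewrite gt_eqF.
have q1 : q != 0 by rewrite gt_eqF.
by field; rewrite v1 q1.
Qed.

(** Differentiating [curvature f (phi theta) = (radius theta)^-1] in the angle and dividing by the
    arc length derivative, again the radius, gives the cube. *)
Lemma curvature_deriv_f_phi theta :
  curvature_deriv f (phi theta) = - derive1 radius theta / radius theta ^+ 3.
Proof.
have r0 := radius_gt0 theta; have r1 : radius theta != 0 by rewrite gt_eqF.
have dphi := @smooth_is_derive _ setT phi theta sphi I.
have hk := @smooth_is_derive _ setT (curvature f) (phi theta) (smooth_curvature sf rf) I.
have hr := @smooth_is_derive _ setT radius theta smooth_radius I.
have h1 := isd_comp hk dphi; have h2 := isdV r1 hr.
have E : derive1 (curvature f) (phi theta) * derive1 phi theta = - radius theta ^- 2 * derive1 radius theta.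
  rewrite -(derive1_of h1) -(derive1_of h2); congr (derive1 _ theta).
  by apply/funext => x; rewrite curvature_f_phi.
have v0 := speed_gt0 theta; have ph0 := phi_incr theta.
have q1 : derive1 phi theta != 0 by rewrite gt_eqF.
have v1 : enorm (derive1 f (phi theta)) != 0 by rewrite gt_eqF.
rewrite /curvature_deriv; have -> : derive1 (curvature f) (phi theta) =
    - radius theta ^- 2 * derive1 radius theta / derive1 phi theta by rewrite -E mulfK.
have rE : radius theta = enorm (derive1 f (phi theta)) * derive1 phi theta by [].
rewrite rE; move: v1 q1; move: (enorm _) (derive1 phi theta) (derive1 radius theta) => v q w v1 q1.
by field; rewrite v1 q1.
Qed.

Lemma phi_lt x y : x < y -> phi x < phi y.
Proof.
move=> xy; apply: (@gtr0_derive1_incr _ phi x y); [move=> z _|move=> z _| |exact: lexx|exact: xy|exact: lexx].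
- by have [] := @smooth_is_derive _ setT phi z sphi I.
- exact: phi_incr.
- apply: continuous_subspaceT => z; exact: (smooth_continuous sphi).
Qed.

Lemma phi_inj : injective phi.
Proof.
move=> x y E; have [xy|yx|//] := ltgtP x y.
  by have := phi_lt xy; rewrite E ltxx.
by have := phi_lt yx; rewrite E ltxx.
Qed.

Lemma phi_periodz theta (m : int) : phi (theta + m%:~R * period n) = phi theta + m%:~R * T.
Proof.
have H k x : phi (x + k%:R * period n) = phi x + k%:R * T.
  elim: k => [|k IH]; first by rewrite !mul0r !addr0.
  rewrite mulrSr mulrDl mul1r addrA phi_period IH; ring.
case: m => m; first exact: H.
rewrite NegzE mulrNz !mulNr; apply: (addIr (m.+1%:~R * T)); rewrite subrK.
by rewrite -[_%:~R * T]/(m.+1%:R * T) -H -[_%:~R * _]/(m.+1%:R * period n) subrK.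
Qed.

Lemma phi_surj t : exists theta, phi theta = t.
Proof.
have T0 : 0 < T by case: cf.
have [m hm] : exists m : int, phi 0 + m%:~R * T <= t < phi 0 + (m + 1)%:~R * T.
  exists (Num.floor ((t - phi 0) / T)).
  have := floor_itv ((t - phi 0) / T); rewrite ler_pdivlMr// ltr_pdivrMr//.
  by move=> /andP[h1 h2]; apply/andP; split; lra.
pose a := 0 + m%:~R * period n : R; pose b := 0 + (m + 1)%:~R * period n : R.
have pa : phi a = phi 0 + m%:~R * T by rewrite /a phi_periodz.
have pb : phi b = phi 0 + (m + 1)%:~R * T by rewrite /b phi_periodz.
have ab : a <= b.
  rewrite /a /b !add0r ler_wpM2r ?ler_int ?lerDl//.
  by rewrite /period !mulr_ge0// pi_ge0.
have [||c _ <-] := @IVT _ phi a b t ab; last by exists c.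
  by apply: continuous_subspaceT => z; exact: (smooth_continuous sphi).
have h : phi a <= phi b by rewrite pa pb; case/andP: hm => h1 h2; rewrite (le_trans h1)// ltW.
by rewrite (min_idPl h) (max_idPr h) pa pb; case/andP: hm => -> /ltW ->.
Qed.

Lemma circle_pt_phi x y : circle_pt T (phi x) = circle_pt T (phi y) <->
  exists m : int, x = y + m%:~R * period n.
Proof.
have T0 : 0 < T by case: cf.
split=> [/(circle_pt_eq _ _ T0)[m]|[m ->]].
  by rewrite -phi_periodz => /phi_inj ->; exists m.
by apply/(circle_pt_eq _ _ T0); exists m; rewrite phi_periodz.
Qed.

Lemma velocity_phi theta : derive1 f (phi theta) =
  enorm (derive1 f (phi theta)) *: velocity_dir theta.
Proof. exact: f_dir. Qed.

(** For even [j] both velocities have the same direction, so the last clause of genericity applies;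
    the formulas for the curvature and its derivative translate it into radii. *)
Lemma generic_radius (j : nat) theta : generic T f -> ~~ odd j -> (0 < j < 2 * n)%N ->
  radius theta = radius (theta + j%:R * pi) ->
  derive1 radius theta <> derive1 radius (theta + j%:R * pi).
Proof.
move=> [_ g2 _ g4] oj /andP[j0 jn] E D.
pose t := theta + j%:R * pi.
have te : t - theta = j%:R * pi by rewrite /t addrC addKr.
have p0 := pi_gt0 R; have v1 := speed_gt0 theta; have v2 := speed_gt0 t.
(* A shift by [j%:R * pi] with [0 < j < 2 * n] is not a multiple of the period. *)
have nz : circle_pt T (phi theta) <> circle_pt T (phi t).
  move=> /circle_pt_phi[m]; rewrite /t -addrA -[LHS]addr0 => /addrI.
  rewrite period_pi mulrA -mulrDl => /esym/eqP; rewrite mulf_eq0 (gt_eqF p0) orbF.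
  rewrite -[j%:R]/(j%:~R) -[(2 * n)%:R]/((2 * n)%N%:~R) -intrM -intrD intr_eq0 => /eqP H.
  move: H j0 jn; clear; case: m => m; lia.
have par : det2 (derive1 f (phi theta)) (derive1 f (phi t)) = 0.
  rewrite velocity_phi [X in det2 _ X]velocity_phi det2Z det2_velocity_dir te.
  by rewrite sin_addkpi0 mulr0.
(* Were the two points equal in the plane, the curve would cross itself there with parallel
   tangents. *)
have pp : parallel_pair f (phi theta) (phi t).
  by split; [move=> fE; exact: (g2 _ _ nz fE par)|exact: par].
have [/(_ _ _) h _] := g4 _ _ pp.
have := h _ _; rewrite !curvature_f_phi !curvature_deriv_f_phi; apply.
- rewrite velocity_phi [X in dot _ X]velocity_phi dotZ dot_velocity_dir2 te.
  rewrite -[X in cos X]add0r cos_addkpi cos0 mulr1 -signr_odd (negPf oj) mulr1.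
  exact: mulr_gt0 v1 v2.
- by rewrite -E.
by rewrite -E -D.
Qed.

End SupportFunction.

(** * Branches of the secant caustic *)

Section Branches.
Context {R : realType} (n : nat) (hn : (0 < n)%N) (gam : R -> R * R) (rho : R -> R).
Context (tg : tangent_curve gam rho) (rho_gt0 : forall theta, 0 < rho theta)
  (gam_period : forall theta, gam (theta + period n) = gam theta)
  (rho_period : forall theta, rho (theta + period n) = rho theta).
Context (rho_generic : forall (j : nat) theta, ~~ odd j -> (0 < j < 2 * n)%N ->
  rho theta = rho (theta + j%:R * pi) ->
  derive1 rho theta <> derive1 rho (theta + j%:R * pi)).

Let oT : open [set: R]. Proof. exact: openT. Qed.
Let srho : smooth setT rho. Proof. by case: tg. Qed.
Let sgam : smooth setT gam. Proof. by case: tg. Qed.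

Lemma period_gt0 : 0 < period n :> R.
Proof. by rewrite /period !mulr_gt0 ?pi_gt0// ltr0n. Qed.

(* The branch SC_k pairs theta with theta + branch_shift k * pi, with the sign
   branch_sign k; its tangential speed is branch_speed k. *)
Definition branch_shift (k : nat) := if (k <= n)%N then k else (k - n)%N.
Definition branch_sign (k : nat) : R := if (k <= n)%N then 1 else -1.
Definition radius_diff (j : nat) theta : R := rho theta - (-1) ^+ j * rho (theta + j%:R * pi).
Definition branch_speed k theta : R := branch_sign k * radius_diff (branch_shift k) theta.

Lemma branch_sign_neq0 k : branch_sign k != 0.
Proof. by rewrite /branch_sign; case: ifP; rewrite ?oppr_eq0 oner_eq0. Qed.

Lemma branch_sign_norm k : `|branch_sign k| = 1.
Proof. by rewrite /branch_sign; case: ifP; rewrite ?normrN normr1. Qed.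

Lemma branch_shift_bound k : SC_indices n k -> (0 < branch_shift k <= n)%N.
Proof. by rewrite /branch_shift => /andP[h1 h2]; case: (leqP k n) => h; lia. Qed.

Lemma SC_E k theta : SC n gam k theta =
  branch_sign k *: (gam theta - gam (theta + (branch_shift k)%:R * pi)).
Proof.
rewrite /SC /SC_fst /SC_snd /branch_sign /branch_shift; case: (leqP k n) => _.
  by rewrite scale1r.
by rewrite scaleN1r opprB.
Qed.

Lemma smooth_shift (F : R -> R) (a : R) : smooth setT F -> smooth setT (fun x => F (x + a)).
Proof.
move=> sF; apply: (@smooth_comp _ _ _ oT setT (fun x => x + a) F) => //.
by apply: smoothD; [exact: oT|exact: smooth_id|exact: smooth_cst].
Qed.

Lemma smooth_radius_diff j : smooth setT (radius_diff j).
Proof. by apply: smoothB => //; apply: smoothZ => //; exact: smooth_shift. Qed.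

Lemma is_derive_radius_diff j (theta : R) : is_derive theta 1 (radius_diff j)
  (derive1 rho theta - (-1) ^+ j * derive1 rho (theta + j%:R * pi)).
Proof.
have h x := @smooth_is_derive _ setT rho x srho I.
exact: isdB (h theta) (isdZ ((-1) ^+ j) (is_derive_shift1 (h _))).
Qed.

Lemma tangent_curve_SC k : tangent_curve (SC n gam k) (branch_speed k).
Proof.
split.
- pose a := (branch_shift k)%:R * pi : R.
  apply: (@smooth_ext _ _ _ oT _ (fun t => (branch_sign k * ((gam t).1 - (gam (t + a)).1),
     branch_sign k * ((gam t).2 - (gam (t + a)).2)))).
    by move=> t _; rewrite SC_E.
  have s1 := smooth_fstT sgam; have s2 := smooth_sndT sgam.
  have s3 := @smooth_shift _ a s1; have s4 := @smooth_shift _ a s2.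
  by apply: (smooth_pair oT); apply: (smoothZ oT); apply: (smoothB oT).
- by apply: (smoothZ oT); exact: smooth_radius_diff.
move=> t; have [_ _ dg] := tg; pose a := (branch_shift k)%:R * pi : R.
have -> : SC n gam k = fun t => branch_sign k *: (gam t - gam (t + a)).
  by apply/funext => x; rewrite SC_E.
have h := @is_derive_comp_curve R _ gam (fun y => y + a) t _ _ (dg (t + a)) (isdD (isd_id t) (isd_cst a t)).
have h2 := is_deriveZ (branch_sign k) (is_deriveB (dg t) h).
apply: (is_derive_eq h2); rewrite addr0 scale1r velocity_dir_addkpi scalerA -scalerBl scalerA.
by rewrite /branch_speed /radius_diff; congr (_ *: _); rewrite -/a; ring.
Qed.

Lemma radius_diff_period j theta : radius_diff j (theta + period n) = radius_diff j theta.
Proof. by rewrite /radius_diff rho_period addrAC rho_period. Qed.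

Lemma branch_speed_period k theta : branch_speed k (theta + period n) = branch_speed k theta.
Proof. by rewrite /branch_speed radius_diff_period. Qed.

Lemma SC_period k theta : SC n gam k (theta + period n) = SC n gam k theta.
Proof. by rewrite !SC_E gam_period addrAC gam_period. Qed.

Lemma radius_diff_odd j theta : odd j -> radius_diff j theta = rho theta + rho (theta + j%:R * pi).
Proof. by move=> oj; rewrite /radius_diff -signr_odd oj expr1 mulN1r opprK. Qed.

Lemma radius_diff_even j theta : ~~ odd j -> radius_diff j theta = rho theta - rho (theta + j%:R * pi).
Proof. by move=> oj; rewrite /radius_diff -signr_odd (negPf oj) expr0 mul1r. Qed.

Lemma branch_speed_eq0 k theta : branch_speed k theta = 0 <-> radius_diff (branch_shift k) theta = 0.
Proof.
rewrite /branch_speed; split => [/eqP|->]; last by rewrite mulr0.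
by rewrite mulf_eq0 (negPf (branch_sign_neq0 k)) => /eqP.
Qed.

Lemma branch_speed_odd k theta : odd (branch_shift k) -> branch_speed k theta != 0.
Proof.
move=> ok; apply/eqP => /branch_speed_eq0; rewrite radius_diff_odd// => /eqP.
by rewrite gt_eqF// addr_gt0.
Qed.

Lemma continuous_zero (g : R -> R) x y : continuous g -> g x <= 0 -> 0 <= g y ->
  exists c, g c = 0.
Proof.
move=> cg gx gy; have h := le_trans gx gy; have [xy|/ltW yx] := leP x y.
  have [||c _ gc] := @IVT _ g x y 0 xy; last by exists c.
    exact: continuous_subspaceT.
  by rewrite (min_idPl h) (max_idPr h) gx.
have [||c _ gc] := @IVT _ g y x 0 yx; last by exists c.
  exact: continuous_subspaceT.
by rewrite (min_idPr h) (max_idPl h) gx.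
Qed.

(* Along theta, theta + j pi, ..., theta + (2n - 1) j pi the differences sum to 0. *)
Lemma radius_diff_zero j : ~~ odd j -> exists theta, radius_diff j theta = 0.
Proof.
move=> oj; pose a := j%:R * pi : R; pose g := radius_diff j.
have gE x : g x = rho x - rho (x + a) by rewrite /g radius_diff_even.
have cg : continuous g by move=> x; exact: (smooth_continuous (smooth_radius_diff j)).
have S : \sum_(i < 2 * n) g (i%:R * a) = 0.
  have T : forall m, \sum_(i < m) g (i%:R * a) = rho 0 - rho (m%:R * a).
    elim=> [|m IH]; first by rewrite big_ord0 mul0r subrr.
    by rewrite big_ord_recr/= IH gE -[in RHS]natr1 mulrDl mul1r; ring.
  (* The sum telescopes, and [2 * n] steps of [j%:R * pi] make [j] full periods. *)
  rewrite T; have -> : (2 * n)%:R * a = 0 + j%:R * period n by rewrite period_pi /a; ring.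
  by rewrite (periodic_mulz _ j rho_period) subrr.
have n2 : (0 < 2 * n)%N by lia.
have [x gx] : exists x, g x <= 0.
  apply: contrapT => H; have P x : 0 < g x.
    by rewrite ltNge; apply/negP => h; apply: H; exists x.
  have : 0 < \sum_(i < 2 * n) g (i%:R * a).
    rewrite (bigD1 (Ordinal n2))//= ltr_wpDr//; apply: sumr_ge0 => i _; exact: ltW.
  by rewrite S ltxx.
have [y gy] : exists y, 0 <= g y.
  apply: contrapT => H; have P z : g z < 0.
    by rewrite ltNge; apply/negP => h; apply: H; exists z.
  have : \sum_(i < 2 * n) g (i%:R * a) < 0.
    rewrite (bigD1 (Ordinal n2))//= ltr_wnDr//; apply: sumr_le0 => i _; exact: ltW.
  by rewrite S ltxx.
exact: continuous_zero cg gx gy.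
Qed.

Lemma branch_singularP k : SC_indices n k -> singular (SC n gam k) <-> ~~ odd (branch_shift k).
Proof.
move=> hk; split.
  move=> [t /(tangent_curve_singular t (tangent_curve_SC k)) h].
  by apply/negP => /(branch_speed_odd t); rewrite h eqxx.
move=> ok; have [t ht] := radius_diff_zero ok; exists t.
by apply/(tangent_curve_singular t (tangent_curve_SC k))/branch_speed_eq0.
Qed.

Lemma derive1_branch_speed k theta : derive1 (branch_speed k) theta =
  branch_sign k * (derive1 rho theta - (-1) ^+ (branch_shift k) *
    derive1 rho (theta + (branch_shift k)%:R * pi)).
Proof. by apply: derive1_of; apply: isdZ; exact: is_derive_radius_diff. Qed.

Lemma branch_speed_simple k theta : SC_indices n k -> branch_speed k theta = 0 ->
  derive1 (branch_speed k) theta != 0.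
Proof.
move=> hk h0; have ek : ~~ odd (branch_shift k).
  by apply/negP => /(branch_speed_odd theta); rewrite h0 eqxx.
rewrite derive1_branch_speed mulf_neq0 ?branch_sign_neq0// -signr_odd (negPf ek) mul1r.
rewrite subr_eq0; apply/eqP; apply: rho_generic => //.
  by have := branch_shift_bound hk; lia.
by move/branch_speed_eq0: h0; rewrite radius_diff_even// => /eqP; rewrite subr_eq0 => /eqP.
Qed.

Lemma SC_singular_cusp k theta : SC_indices n k -> singular_point (SC n gam k) theta ->
  cusp (SC n gam k) theta.
Proof.
move=> hk /(tangent_curve_singular theta (tangent_curve_SC k)) h0.
exact: tangent_curve_cusp (tangent_curve_SC k) h0 (branch_speed_simple hk h0).
Qed.

Lemma cusps_SC k theta : SC_indices n k ->
  cusps (period n) (SC n gam k) theta <-> (0 <= theta < period n) && (branch_speed k theta == 0).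
Proof.
move=> hk; split => [[h1 [h2 _]]|/andP[h1 /eqP h2]].
  by rewrite h1; apply/eqP/(tangent_curve_singular theta (tangent_curve_SC k)).
split => //; apply: SC_singular_cusp => //.
by apply/(tangent_curve_singular theta (tangent_curve_SC k)).
Qed.

Lemma cusps_seq k : SC_indices n k -> exists s : seq R,
  [/\ uniq s, forall x, cusps (period n) (SC n gam k) x <-> x \in s & ~~ odd (size s)].
Proof.
move=> hk; have [_ st _] := tangent_curve_SC k.
have dg x := @smooth_is_derive _ setT (branch_speed k) x st I.
have [s [us Hs os]] := periodic_zeros_even dg (fun x => @branch_speed_simple k x hk)
  period_gt0 (branch_speed_period k).
by exists s; split => // x; rewrite cusps_SC// Hs.
Qed.

(** A singular point moved into the fundamental period shows that the list is nonempty; its size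
    being even, it is at least 2. *)
Lemma cusps_seq_ge2 k (s : seq R) : SC_indices n k -> singular (SC n gam k) ->
  (forall x, cusps (period n) (SC n gam k) x <-> x \in s) -> ~~ odd (size s) ->
  (2 <= size s)%N.
Proof.
move=> hk [t /(tangent_curve_singular t (tangent_curve_SC k)) t0] Hs.
have [m hm] := period_reduce t period_gt0.
have : t + m%:~R * period n \in s.
  by apply/Hs; rewrite cusps_SC// hm (periodic_mulz _ _ (branch_speed_period k)) t0 eqxx.
by case: s {Hs} => [|a [|b s]].
Qed.

End Branches.

(** * Parity and counting of the branch indices *)

Section IndexSets.
Context (n : nat) (hn : (0 < n)%N).

(** For even [n] the indices [k] and [k - n] have the same parity, so a single condition on
    [branch_shift] covers both cases. *)
Lemma expected_rosettesP k : expected_rosettes n k <-> SC_indices n k /\ odd (branch_shift n k).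
Proof.
rewrite /expected_rosettes /branch_shift /SC_indices /=.
split => -[/andP[h1 h2] h3]; split; rewrite ?h1 ?h2//.
  move: h3; case: ifP => on.
    case=> [[ok kn]|[j [-> oj jn]]|->].
    - by rewrite ltnW.
    - by case: (leqP (n + j) n) => h; rewrite ?addKn//; lia.
    - by rewrite leqnn.
  by case: (leqP k n) => h //; rewrite oddB ?on ?addbF// ltnW.
case: ifP => on; move: h3; case: (leqP k n) => h.
- by rewrite leq_eqVlt in h; case/orP: h => [/eqP -> _|h ok]; [exact: Or33|exact: Or31].
- by move=> o; apply: Or32; exists (k - n)%N; split => //; lia.
- by [].
- by rewrite oddB ?on ?addbF// ltnW.
Qed.

Lemma expected_singularP k : expected_singular n k <-> SC_indices n k /\ ~~ odd (branch_shift n k).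
Proof.
rewrite /expected_singular /branch_shift /SC_indices /=.
split => -[/andP[h1 h2] h3]; split; rewrite ?h1 ?h2//.
  move: h3; case: ifP => on.
    case=> [[ok kn]|[j [-> oj j0 jn]]].
    - by rewrite ltnW.
    - by case: (leqP (n + j) n) => h; rewrite ?addKn//; lia.
  by case: (leqP k n) => h //; rewrite oddB ?on ?addbF// ltnW.
case: ifP => on; move: h3; case: (leqP k n) => h.
- move=> ok; left; split => //; rewrite ltn_neqAle h andbT.
  by apply: contraNneq ok => ->.
- by move=> o; right; exists (k - n)%N; split => //; lia.
- by [].
- by rewrite oddB ?on ?addbF// ltnW.
Qed.

Lemma card_nat_image (T : Type) (A : set T) (m : nat) (F : nat -> T) :
  (forall i j, (i < m)%N -> (j < m)%N -> F i = F j -> i = j) ->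
  (forall i, (i < m)%N -> A (F i)) -> (forall x, A x -> exists2 i, (i < m)%N & F i = x) ->
  (A #= `I_m)%card.
Proof.
move=> Finj FA AF; have -> : A = F @` `I_m.
  by apply/seteqP; split => [x /AF[i im <-]|_ [i im <-]]; [exists i|exact: FA].
by apply: inj_card_eq => i j; rewrite !inE /= => im jm; exact: Finj.
Qed.

(** For odd [n] the indices [n + j] with [j] odd are even, so the enumeration switches from odd to
    even numbers when it passes [n]. *)
Lemma card_expected_rosettes : (expected_rosettes n #= `I_n)%card.
Proof.
have [on|en] := boolP (odd n).
  apply: (@card_nat_image _ _ _ (fun i => if (i.*2.+1 <= n)%N then i.*2.+1 else i.*2)).
  - by move=> i j hi hj; case: ifP => h1; case: ifP => h2; lia.
  - move=> i hi; apply/expected_rosettesP; rewrite /SC_indices /branch_shift /=.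
    by case: (leqP i.*2.+1 n) => h1; case: ifP => h2; split; lia.
  - move=> k /expected_rosettesP; rewrite /SC_indices /branch_shift /=.
    case: (leqP k n) => h [/andP[h1 h2] ok].
      by exists k./2; first lia; case: ifP; lia.
    by exists k./2; first lia; case: ifP; lia.
apply: (@card_nat_image _ _ _ (fun i => i.*2.+1)).
- by move=> i j hi hj; lia.
- move=> i hi; apply/expected_rosettesP; rewrite /SC_indices /branch_shift /=.
  by case: (leqP i.*2.+1 n) => h1; split; lia.
- move=> k /expected_rosettesP; rewrite /SC_indices /branch_shift /=.
  by case: (leqP k n) => h [/andP[h1 h2] ok]; exists k./2; lia.
Qed.

(** The even numbers from 2 on; for odd [n] they are replaced beyond [n] by odd ones, which have the
    form [n] plus an even number. *)
Definition singular_index (i : nat) :=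
  if odd n && (n < i.*2.+2)%N then i.*2.+3 else i.*2.+2.

Lemma singular_indexP i : (i < n - 1)%N -> expected_singular n (singular_index i).
Proof.
move=> hi; apply/expected_singularP; rewrite /SC_indices /branch_shift /singular_index /=.
by case: ifP => h; case: ifP => h2; split; lia.
Qed.

Lemma singular_index_inj i j : (i < n - 1)%N -> (j < n - 1)%N ->
  singular_index i = singular_index j -> i = j.
Proof. by rewrite /singular_index => hi hj; case: ifP => h1; case: ifP => h2; lia. Qed.

Lemma singular_index_surj k : expected_singular n k ->
  exists2 i, (i < n - 1)%N & singular_index i = k.
Proof.
move=> /expected_singularP; rewrite /SC_indices /branch_shift /singular_index /=.
case: (leqP k n) => h [/andP[h1 h2] ok].
  by exists k./2.-1; first lia; case: ifP; lia.
have [on|en] := boolP (odd n).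
  by exists (k - 3)./2; first lia; case: ifP; lia.
by rewrite /=; exists k./2.-1; lia.
Qed.

Lemma card_expected_singular : (expected_singular n #= `I_(n - 1))%card.
Proof.
apply: (@card_nat_image _ _ _ singular_index).
- exact: singular_index_inj.
- exact: singular_indexP.
- exact: singular_index_surj.
Qed.

Lemma card_SC_indices : (SC_indices n #= `I_(2 * n - 1))%card.
Proof.
apply: (@card_nat_image _ _ _ S).
- by move=> i j _ _ [].
- by move=> i hi; rewrite /SC_indices /=; lia.
- by move=> k; rewrite /SC_indices /= => hk; exists k.-1; lia.
Qed.

End IndexSets.

(** * Symmetry, rotation numbers and lengths of the branches *)

Section BranchGeometry.
Context {R : realType} (n : nat) (hn : (0 < n)%N) (gam : R -> R * R) (rho : R -> R).
Context (tg : tangent_curve gam rho) (rho_gt0 : forall theta, 0 < rho theta)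
  (gam_period : forall theta, gam (theta + period n) = gam theta)
  (rho_period : forall theta, rho (theta + period n) = rho theta).

Notation bshift := (branch_shift n).

Lemma SC_reflection k : (1 <= k <= n - 1)%N ->
  point_reflection \o SC n gam k = SC n gam (n + k)%N.
Proof.
move=> hk; apply/funext => theta; rewrite /point_reflection /SC /SC_fst /SC_snd /=.
have -> : (k <= n)%N by lia.
have -> : (n + k <= n)%N = false by lia.
by rewrite addKn opprB.
Qed.

(** A shift by [n%:R * pi] is half a period: it exchanges the two points of the pair and so changes
    the sign of their difference. *)
Lemma SC_centrally_symmetric : centrally_symmetric (range (SC n gam n)).
Proof.
have E theta : - SC n gam n theta = SC n gam n (theta + n%:R * pi).
  rewrite /SC /SC_fst /SC_snd leqnn opprB; congr (_ - _).
  by rewrite -addrA -mulrDl -natrD addnn -mul2n -period_pi gam_period.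
apply/seteqP; split => [_ [_ [t _ <-] <-]|_ [t _ <-]].
  by exists (t + n%:R * pi); rewrite // -E.
exists (- SC n gam n t); first by exists (t + n%:R * pi); rewrite // -E.
by rewrite /point_reflection opprK.
Qed.

Definition frame_normal (t : R) : R * R := (cos t, sin t).

Lemma dot_frame_normal (a t : R) : dot (frame_normal t) (a *: velocity_dir t) = 0.
Proof. by rewrite /dot /= /GRing.scale /=; ring. Qed.

Lemma continuous_frame_normal : continuous frame_normal.
Proof.
move=> t; have s : smooth setT frame_normal; last exact: (smooth_continuous s).
by apply: smooth_pair; [exact: openT|apply: smooth_cos|apply: smooth_sin];
  (try exact: openT); exact: smooth_id.
Qed.

Lemma frame_normal_period t : frame_normal (t + period n) = frame_normal t.
Proof.
rewrite /frame_normal period_pi sin_addkpi cos_addkpi exprM sqrrN expr1n expr1n.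
by rewrite !mul1r.
Qed.

Lemma tangent_curve_unit_normal (c : R -> R * R) tau : tangent_curve c tau ->
  unit_normal_field (period n) c frame_normal.
Proof.
move=> tc; split.
- exact: continuous_frame_normal.
- exact: frame_normal_period.
- by move=> t; rewrite /dot /= -!expr2 cos2Dsin2.
- by move=> t; rewrite (tangent_curve_derive1 t tc) dot_frame_normal.
Qed.

Lemma frame_normal_rotation (b : R) :
  field_rotation_number (period n) (fun t => frame_normal (t + b)) n%:Z.
Proof.
exists (fun t => t + b); split => //.
  by move=> t; apply: cvgD; [exact: cvg_id|exact: cvg_cst].
by rewrite /period [RHS]mulrCA -mulrA; rewrite -[n%:~R]/(n%:R : R); ring.
Qed.

Lemma frame_normal_addkpi t (k : nat) : frame_normal (t + k%:R * pi) = (-1) ^+ k *: frame_normal t.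
Proof. by rewrite /frame_normal sin_addkpi cos_addkpi. Qed.

(** A unit normal is plus or minus [frame_normal], and by continuity the sign is constant. It is
    encoded as a half turn of the angle, so that the field stays a shift of [frame_normal]. *)
Lemma unit_normal_field_gamma nu : unit_normal_field (period n) gam nu ->
  exists e : bool, forall t, nu t = frame_normal (t + e%:R * pi).
Proof.
move=> [cnu pnu nu1 nu0]; pose a t := dot (nu t) (frame_normal t).
have nuE t : nu t = a t *: frame_normal t.
  have := nu0 t; rewrite (tangent_curve_derive1 t tg) /dot /= /GRing.scale /= => h.
  have h2 : (nu t).2 * cos t - (nu t).1 * sin t = 0.
    by apply: (mulfI (lt0r_neq0 (rho_gt0 t))); rewrite mulr0 -[RHS]h; ring.
  rewrite /a /dot /= /frame_normal; case: (nu t) h2 => x y /= h2.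
  have c2 := cos2Dsin2 t; rewrite /GRing.scale /=; congr (_, _).
    transitivity (x * (cos t ^+ 2 + sin t ^+ 2) + sin t * (y * cos t - x * sin t)).
      by rewrite h2 c2; ring.
    by rewrite /= /GRing.scale /=; ring.
  transitivity (y * (cos t ^+ 2 + sin t ^+ 2) - cos t * (y * cos t - x * sin t)).
    by rewrite h2 c2; ring.
  by rewrite /= /GRing.scale /=; ring.
have a2 t : a t ^+ 2 = 1.
  rewrite -(nu1 t) nuE dotZ /dot /= -!expr2 cos2Dsin2; ring.
have ca : continuous a.
  move=> t; apply: cvgD; apply: cvgM.
  - apply: (@continuous_comp _ _ _ nu fst); first exact: cnu.
    exact: cvg_fst.
  - exact: continuous_cos.
  - apply: (@continuous_comp _ _ _ nu snd); first exact: cnu.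
    exact: cvg_snd.
  - exact: continuous_sin.
have a1 t : a t = 1 \/ a t = -1.
  by have /eqP := a2 t; rewrite sqrf_eq1 => /orP[/eqP|/eqP]; [left|right].
(* A change of sign would produce a zero of [a], whereas [a ^+ 2] is constantly 1. *)
have ac t : a t = a 0.
  apply/eqP; apply/negPn/negP => h.
  have [c ac] : exists c, a c = 0.
    case: (a1 t) (a1 0) h => at1 [] a01; rewrite at1 a01 ?eqxx// => _.
      by apply: (continuous_zero (x := 0) (y := t)); rewrite // ?at1 ?a01 ?lerN10 ?ler01.
    by apply: (continuous_zero (x := t) (y := 0)); rewrite // ?at1 ?a01 ?lerN10 ?ler01.
  by have := a2 c; rewrite ac expr0n /= => /eqP; rewrite eq_sym oner_eq0.
case: (a1 0) => h.
  by exists false => t; rewrite nuE ac h scale1r mul0r addr0.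
by exists true => t; rewrite nuE ac h frame_normal_addkpi expr1.
Qed.

(** The tangents of a branch are parallel to those of [gam] at the same angle, so the normals of
    [gam] at [SC_fst] serve the branch. They form a shift of [frame_normal], whose angle grows by
    [2 * n%:R * pi] over the period. *)
Lemma unit_normal_field_SC k nu : unit_normal_field (period n) gam nu ->
  unit_normal_field (period n) (SC n gam k) (nu \o SC_fst n k) /\
  field_rotation_number (period n) (nu \o SC_fst n k) n%:Z.
Proof.
move=> hnu; have [cnu pnu nu1 nu0] := hnu; have [e nuE] := unit_normal_field_gamma hnu.
have [m fstE] : exists m : nat, forall t, SC_fst n k t = t + m%:R * pi :> R.
  rewrite /SC_fst; case: (leqP k n) => _; last by exists (k - n)%N.
  by exists 0%N => t; rewrite mul0r addr0.
have E : nu \o SC_fst n k = fun t => frame_normal (t + (m + e)%:R * pi).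
  by apply/funext => t; rewrite /= fstE nuE natrD mulrDl addrA.
rewrite E; split; last exact: frame_normal_rotation.
split.
- move=> t; apply: (@continuous_comp _ _ _ (fun t => t + (m + e)%:R * pi) frame_normal).
    by apply: cvgD; [exact: cvg_id|exact: cvg_cst].
  exact: continuous_frame_normal.
- by move=> t; rewrite addrAC frame_normal_period.
- by move=> t; rewrite /dot /= -!expr2 cos2Dsin2.
- move=> t; rewrite (tangent_curve_derive1 t (tangent_curve_SC n tg k)) frame_normal_addkpi.
  by rewrite dotZ -[velocity_dir t]scale1r dot_frame_normal mulr0.
Qed.

Lemma SC_rosetteP k : SC_indices n k ->
  rosette (period n) (SC n gam k) <-> odd (bshift k).
Proof.
move=> hk; have tc := tangent_curve_SC n tg k; split.
  move=> [m [_ reg _ _]]; apply: contrapT => /negP ek.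
  have /(branch_singularP hn tg rho_gt0 rho_period hk) [t ht] := ek.
  exact: reg ht.
move=> ok; exists n; split.
- split; first exact: period_gt0.
    by case: tc.
  exact: SC_period.
- move=> t /(tangent_curve_singular t tc) h.
  by have := branch_speed_odd rho_gt0 t ok; rewrite h eqxx.
- move=> t; have h := branch_speed_odd rho_gt0 t ok.
  by rewrite (tangent_curve_curvature tc h) invr_gt0 normr_gt0.
- exists frame_normal; first exact: tangent_curve_unit_normal tc.
  have := frame_normal_rotation 0.
  by rewrite (_ : (fun t => frame_normal (t + 0)) = frame_normal)//; apply/funext => t; rewrite addr0.
Qed.

Lemma continuous_rho : continuous rho.
Proof. by move=> x; have [_ srho _] := tg; exact: (smooth_continuous srho). Qed.

Lemma length_gamma : length (period n) gam =
  (\int[lebesgue_measure]_(t in `[0%R, period n]) rho t)%R.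
Proof.
apply: eq_Rintegral => t _.
by rewrite (tangent_curve_derive1 t tg) enorm_velocity_dir gtr0_norm.
Qed.

Lemma length_SC k : length (period n) (SC n gam k) =
  (\int[lebesgue_measure]_(t in `[0%R, period n]) `|radius_diff rho (bshift k) t|)%R.
Proof.
apply: eq_Rintegral => t _.
rewrite (tangent_curve_derive1 t (tangent_curve_SC n tg k)) enorm_velocity_dir normrM.
by rewrite branch_sign_norm mul1r.
Qed.

Lemma Rintegral_radius_sum (a : R) : 0 <= a ->
  (\int[lebesgue_measure]_(t in `[0%R, period n]) (rho t + rho (t + a)))%R =
  2 * length (period n) gam.
Proof.
move=> a0; have cr := continuous_rho.
rewrite RintegralD//=; last 2 first.
- exact: continuous_integrable.
- by apply: continuous_integrable; exact: continuous_shift.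
rewrite Rintegral_shift_periodic//; first by rewrite length_gamma; ring.
exact: period_gt0.
Qed.

Lemma length_SC_nonsingular k : SC_indices n k -> ~ singular (SC n gam k) ->
  length (period n) (SC n gam k) = 2 * length (period n) gam.
Proof.
move=> hk ns; have ok : odd (bshift k).
  by apply: contrapT => /negP h; apply: ns; apply/(branch_singularP hn tg rho_gt0 rho_period hk).
rewrite length_SC -(@Rintegral_radius_sum ((bshift k)%:R * pi)); last by rewrite mulr_ge0// pi_ge0.
by apply: eq_Rintegral => t _; rewrite radius_diff_odd// gtr0_norm// addr_gt0.
Qed.

(** The triangle inequality bounds the speed of the branch by the sum of the two radii, whose
    integral is twice the length of the rosette. *)
Lemma length_SC_le k : length (period n) (SC n gam k) <= 2 * length (period n) gam.
Proof.
have cr := continuous_rho; have [_ srho _] := tg.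
rewrite length_SC -(@Rintegral_radius_sum ((bshift k)%:R * pi)); last by rewrite mulr_ge0// pi_ge0.
apply: le_Rintegral => //=.
- apply: continuous_integrable => t; apply: cvg_norm.
  exact: (smooth_continuous (smooth_radius_diff tg (bshift k))).
- by apply: continuous_integrable => t; apply: cvgD; [exact: cr|exact: continuous_shift].
move=> t _; apply: le_trans (ler_normB _ _) _.
by rewrite normrM normrX normrN1 expr1n mul1r !gtr0_norm.
Qed.

End BranchGeometry.

(** * Signed areas of the branches and of the Wigner caustic *)

Section Areas.
Context {R : realType} (n : nat) (hn : (0 < n)%N) (gam : R -> R * R) (rho : R -> R).
Context (tg : tangent_curve gam rho)
  (gam_period : forall theta, gam (theta + period n) = gam theta)
  (rho_period : forall theta, rho (theta + period n) = rho theta).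

Definition area_density (u v : R -> R * R) (t : R) : R := - (u t).2 * (v t).1 + (u t).1 * (v t).2.

Let vel t := rho t *: velocity_dir t.
Let oT : open [set: R]. Proof. exact: openT. Qed.

Lemma signed_area_density (L : R) (c v : R -> R * R) : (forall t : R, is_derive t 1 c (v t)) ->
  signed_area L c = 2^-1 * (\int[lebesgue_measure]_(t in `[0%R, L]) area_density c v t)%R.
Proof.
by move=> dc; congr (_ * _); apply: eq_Rintegral => t _; rewrite (derive1_of (dc t)).
Qed.

Lemma continuous_area_density (u v : R -> R * R) : smooth setT u -> smooth setT v ->
  continuous (area_density u v).
Proof.
move=> su sv t; have s : smooth setT (area_density u v); last exact: (smooth_continuous s).
by apply: (smoothD oT); apply: (smoothM oT); (try apply: (smoothN oT));
  [exact: smooth_sndT|exact: smooth_fstT|exact: smooth_fstT|exact: smooth_sndT].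
Qed.

Let sgam : smooth setT gam. Proof. by case: tg. Qed.
Let svel : smooth setT vel.
Proof.
have e : vel = derive1 gam by apply/funext => t; rewrite (tangent_curve_derive1 t tg).
by rewrite e; exact: smooth_derive1W.
Qed.
Let dgam (t : R) : is_derive t 1 gam (vel t). Proof. by case: tg. Qed.

Let dgam_shift (a t : R) : is_derive t 1 (fun t => gam (t + a)) (vel (t + a)).
Proof.
have := @is_derive_comp_curve R _ gam (fun y => y + a) t _ _ (dgam (t + a)) (isdD (isd_id t) (isd_cst a t)).
by rewrite addr0 scale1r.
Qed.

Lemma smooth_curve_shift (F : R -> R * R) (a : R) : smooth setT F -> smooth setT (fun x => F (x + a)).
Proof. by apply: smooth_f_phi; apply: (smoothD oT); [exact: smooth_id|exact: smooth_cst]. Qed.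

Lemma smooth_curveD (F G : R -> R * R) : smooth setT F -> smooth setT G ->
  smooth setT (fun x => F x + G x).
Proof. by move=> sF sG k; apply: class_CD. Qed.

Lemma smooth_curveZ (b : R) (F : R -> R * R) : smooth setT F -> smooth setT (fun x => b *: F x).
Proof.
move=> sF; apply: (@smooth_ext _ _ _ oT _ (fun x => (b * (F x).1, b * (F x).2))) => //.
by apply: (smooth_pair oT); apply: (smoothZ oT); [exact: smooth_fstT|exact: smooth_sndT].
Qed.

Lemma vel_period t : vel (t + period n) = vel t.
Proof. by rewrite /vel rho_period velocity_dir_period. Qed.

(** The area density is bilinear in the curve and its velocity, so the parallelogram identity holds
    pointwise; the shifted density has the same integral over a period. *)
Lemma area_parallelogram (a : R) : 0 <= a ->
  signed_area (period n) (fun t => gam t - gam (t + a)) +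
  4 * signed_area (period n) (fun t => 2^-1 *: (gam t + gam (t + a))) =
  4 * signed_area (period n) gam.
Proof.
move=> a0; have P0 := @period_gt0 R n hn.
have d1 (t : R) : is_derive t 1 (fun t => gam t - gam (t + a)) (vel t - vel (t + a)).
  exact: is_deriveB (dgam t) (dgam_shift a t).
have d2 (t : R) : is_derive t 1 (fun t => 2^-1 *: (gam t + gam (t + a))) (2^-1 *: (vel t + vel (t + a))).
  exact: is_deriveZ (is_deriveD (dgam t) (dgam_shift a t)).
rewrite (signed_area_density _ d1) (signed_area_density _ d2) (signed_area_density _ dgam).
set u1 := area_density _ _; set u2 := area_density _ _; set u := area_density gam vel.
have sgs := smooth_curve_shift a sgam; have svs := smooth_curve_shift a svel.
have cu : continuous u by exact: continuous_area_density.
have c1 : continuous u1.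
  apply: continuous_area_density.
    by apply: smooth_curveD => //; have := smooth_curveZ (-1) sgs; under eq_fun do rewrite scaleN1r.
  by apply: smooth_curveD => //; have := smooth_curveZ (-1) svs; under eq_fun do rewrite scaleN1r.
have c2 : continuous u2.
  by apply: continuous_area_density; apply: smooth_curveZ; exact: smooth_curveD.
have pu t : u (t + period n) = u t by rewrite /u /area_density gam_period vel_period.
have cus : continuous (fun t => u (t + a)) by exact: continuous_shift.
have E : (\int[lebesgue_measure]_(t in `[0%R, period n]) (1 * u1 t + 4 * u2 t))%R =
    (\int[lebesgue_measure]_(t in `[0%R, period n]) (2 * u t + 2 * u (t + a)))%R.
  apply: eq_Rintegral => t _; rewrite /u1 /u2 /u /area_density /= /GRing.scale /=.
  by field.
rewrite (Rintegral_linear _ _ _ _ c1 c2) (Rintegral_linear _ _ _ _ cu cus) in E.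
rewrite (Rintegral_shift_periodic P0 a0 cu pu) in E.
by lra.
Qed.

Lemma signed_area_SC_wigner k : (1 <= k < n)%N ->
  signed_area (period n) (SC n gam k) + 4 * signed_area (period n) (wigner gam k)
    = 4 * signed_area (period n) gam /\
  signed_area (period n) (SC n gam (n + k)%N) + 4 * signed_area (period n) (wigner gam k)
    = 4 * signed_area (period n) gam.
Proof.
move=> hk; have a0 : 0 <= k%:R * pi :> R by rewrite mulr_ge0// pi_ge0.
have SCk : SC n gam k = fun t => gam t - gam (t + k%:R * pi).
  by apply/funext => t; rewrite /SC /SC_fst /SC_snd; have -> : (k <= n)%N by lia.
have E := area_parallelogram a0; rewrite SCk; split; first exact: E.
have d1 (t : R) : is_derive t 1 (fun t => gam t - gam (t + k%:R * pi)) (vel t - vel (t + k%:R * pi)).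
  exact: is_deriveB (dgam t) (dgam_shift _ t).
have SCnk : SC n gam (n + k)%N = fun t => gam (t + k%:R * pi) - gam t.
  have nk : (n + k <= n)%N = false by lia.
  by apply/funext => t; rewrite /SC /SC_fst /SC_snd nk addKn.
have d2 (t : R) : is_derive t 1 (fun t => gam (t + k%:R * pi) - gam t) (vel (t + k%:R * pi) - vel t).
  exact: is_deriveB (dgam_shift _ t) (dgam t).
(* The density is quadratic, so reflection through the origin preserves it. *)
have E2 : signed_area (period n) (fun t => gam (t + k%:R * pi) - gam t) =
    signed_area (period n) (fun t => gam t - gam (t + k%:R * pi)).
  rewrite (signed_area_density _ d1) (signed_area_density _ d2); congr (_ * _).
  by apply: eq_Rintegral => t _; rewrite /area_density /=; ring.
by rewrite SCnk E2; exact: E.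
Qed.

(** The midpoint curve for [k = n] already closes up after half a period; a full period runs through
    it twice, which doubles the factor 4. *)
Lemma signed_area_SC_wigner_n :
  signed_area (period n) (SC n gam n) + 8 * signed_area (n%:R * pi) (wigner gam n)
    = 4 * signed_area (period n) gam.
Proof.
pose a : R := n%:R * pi; have a0 : 0 < a by rewrite mulr_gt0 ?pi_gt0// ltr0n.
have P2 : period n = 2 * a by rewrite /period mulrA.
have SCn : SC n gam n = fun t => gam t - gam (t + a).
  by apply/funext => t; rewrite /SC /SC_fst /SC_snd leqnn.
have d2 (t : R) : is_derive t 1 (wigner gam n) (2^-1 *: (vel t + vel (t + a))).
  exact: is_deriveZ (is_deriveD (dgam t) (dgam_shift a t)).
have sgs := smooth_curve_shift a sgam; have svs := smooth_curve_shift a svel.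
have sw : smooth setT (wigner gam n) by apply: smooth_curveZ; exact: smooth_curveD.
have sv : smooth setT (fun t => 2^-1 *: (vel t + vel (t + a))).
  by apply: smooth_curveZ; exact: smooth_curveD.
have cu := continuous_area_density sw sv.
have pw t : area_density (wigner gam n) (fun t => 2^-1 *: (vel t + vel (t + a))) (t + a) =
    area_density (wigner gam n) (fun t => 2^-1 *: (vel t + vel (t + a))) t.
  have aa : t + a + a = t + period n by rewrite P2; ring.
  have w : wigner gam n (t + a) = wigner gam n t.
    by rewrite /wigner -/a aa gam_period addrC.
  by rewrite /area_density w aa vel_period [vel (t + a) + _]addrC.
have E := area_parallelogram (ltW a0).
have E2 : signed_area (period n) (wigner gam n) = 2 * signed_area a (wigner gam n).
  rewrite !(signed_area_density _ d2) P2 (Rintegral_double a0 cu pw); ring.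
rewrite SCn -E -/a -[X in _ = _ + 4 * signed_area _ X]/(wigner gam n) E2.
by congr (_ + _); ring.
Qed.

End Areas.

(** * Components of the parallel locus *)

Section FiniteComponents.
Context {T : topologicalType} {I : choiceType} (s : seq I) (C : I -> set T).
Context (closedC : forall i, i \in s -> closed (C i))
  (connectedC : forall i, i \in s -> connected (C i))
  (disjointC : forall i j x, i \in s -> j \in s -> C i x -> C j x -> i = j).

Lemma closed_finite_union : closed [set x | exists2 i, i \in s & C i x].
Proof.
suff -> : [set x | exists2 i, i \in s & C i x] = \big[setU/set0]_(i <- s) C i.
  by apply: closed_bigsetU => i; exact: closedC.
apply/seteqP; split => x.
  by move=> [i si Cx]; rewrite -bigcup_seq; exists i.
by rewrite -bigcup_seq => -[i si Cx]; exists i.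
Qed.

(** Within the union, the complement of [C i] is a finite union of closed sets. So [C i] is
    relatively open as well as closed, and a connected subset meeting it lies in it. *)
Lemma component_finite_union i x : i \in s -> C i x ->
  connected_component [set x | exists2 i, i \in s & C i x] x = C i.
Proof.
move=> si Cx; set E := [set x | _]; apply/seteqP; split; last first.
  by apply: connected_component_max => // [y Cy|]; [exists i|exact: connectedC].
set D := connected_component E x.
have DE : D `<=` E by exact: connected_component_sub.
have cD : connected D by exact: component_connected.
pose O := [set y | exists2 j, j \in [seq j <- s | j != i] & C j y].
have clO : closed O.
  have -> : O = \big[setU/set0]_(j <- [seq j <- s | j != i]) C j.
    apply/seteqP; split => y.
      by move=> [j sj Cy]; rewrite -bigcup_seq; exists j.
    by rewrite -bigcup_seq => -[j sj Cy]; exists j.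
  by apply: closed_bigsetU => j; rewrite mem_filter => /andP[_]; exact: closedC.
suff <- : D `&` C i = D by move=> y [].
apply: cD.
- exists x; split => //; apply: connected_component_refl; by exists i.
- exists (~` O); first exact: closed_openC.
  apply/seteqP; split => y [Dy h]; split => //.
    move=> [j]; rewrite mem_filter => /andP[ji sj] Cy.
    by move/eqP: ji; apply; exact: disjointC Cy h.
  have [j sj Cy] := DE _ Dy; have [<-//|ji] := eqVneq j i.
  by exfalso; apply: h; exists j => //; rewrite mem_filter ji.
- by exists (C i) => //; exact: closedC.
Qed.

End FiniteComponents.

(** * The loops of angle pairs with parallel tangents *)

Section Locus.
Context {R : realType} (n : nat) (hn : (0 < n)%N) (T : R) (f : R -> R * R) (p phi : R -> R).
Context (cf : closed_curve T f) (rf : regular f).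
Context (sphi : smooth [set: R] phi) (phi_incr : forall theta, 0 < derive1 phi theta)
  (phi_period : forall theta, phi (theta + period n) = phi theta + T)
  (f_dir : forall theta, derive1 f (phi theta) =
     enorm (derive1 f (phi theta)) *: (- sin theta, cos theta))
  (pE : forall theta, p theta = dot (f (phi theta)) (cos theta, sin theta)).

Let P0 : 0 < period n :> R. Proof. exact: period_gt0. Qed.
Let T0 : 0 < T. Proof. by case: cf. Qed.
Let circ := circle_pt_phi cf sphi phi_incr phi_period.

Definition branch_pt k (theta : R) : (R * R) * (R * R) :=
  (circle_pt T (phi (SC_fst n k theta)), circle_pt T (phi (SC_snd n k theta))).

(** The closed interval, with both ends giving the same point, yields compactness and connectedness
    at once; injectivity is treated on the half-open interval. *)
Definition branch_locus k := branch_pt k @` `[0, period n].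

(** The angle from the first point of the pair to the second in units of pi, normalized to lie above
    [- n] and at most [n]: one representative for each class modulo [2 * n]. *)
Definition branch_gap k : int := if (k <= n)%N then k%:Z else - (k - n)%N%:Z.

Lemma SC_sndE k theta : SC_snd n k theta = SC_fst n k theta + (branch_gap k)%:~R * pi :> R.
Proof.
rewrite /SC_snd /SC_fst /branch_gap; case: (leqP k n) => _ //.
by rewrite mulrNz mulNr addrK.
Qed.

Lemma SC_fstE k theta : SC_fst n k theta = theta + (if (k <= n)%N then 0%N else (k - n)%N)%:R * pi :> R.
Proof. by rewrite /SC_fst; case: (leqP k n) => _ //; rewrite mul0r addr0. Qed.

Lemma branch_pt_period k theta (m : int) : branch_pt k (theta + m%:~R * period n) = branch_pt k theta.
Proof.
rewrite /branch_pt !SC_sndE !SC_fstE; congr (_, _); apply/circ; exists m; ring.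
Qed.

Lemma period_int : period n = (2 * n)%N%:Z%:~R * pi :> R.
Proof. by rewrite period_pi. Qed.

Lemma pi_int_inj (a b : int) : a%:~R * pi = b%:~R * pi :> R -> a = b.
Proof. by move/(mulIf (lt0r_neq0 (pi_gt0 R)))/eqP; rewrite eqr_int => /eqP. Qed.

Lemma branch_pt_eq j k x y : branch_pt j x = branch_pt k y ->
  (exists m : int, branch_gap j = branch_gap k + m * (2 * n)%N%:Z) /\
  exists m : int, SC_fst n j x = SC_fst n k y + m%:~R * period n.
Proof.
move=> E; have /circ[m1 E1] := congr1 fst E; have /circ[m2 E2] := congr1 snd E.
split; last by exists m1.
exists (m2 - m1); apply: pi_int_inj; move: E2; rewrite !SC_sndE E1 period_int.
rewrite intrD intrM intrB => h.
apply: (addrI (SC_fst n k y + m1%:~R * ((2 * n)%N%:~R * pi))); rewrite h; ring.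
Qed.

Lemma int_mul_small (a m N : int) : a = m * N -> - N < a < N -> m = 0.
Proof. by move=> -> /andP[h1 h2]; have [h|h|//] := ltgtP m 0; nia. Qed.

Lemma branch_gap_bound k : SC_indices n k -> - n%:Z < branch_gap k <= n%:Z /\ branch_gap k != 0.
Proof. by rewrite /branch_gap => /andP[k1 k2]; case: (leqP k n) => hk; lia. Qed.

Lemma branch_gap_inj j k : SC_indices n j -> SC_indices n k ->
  branch_gap j = branch_gap k -> j = k.
Proof.
rewrite /branch_gap => /andP[j1 j2] /andP[k1 k2].
by case: (leqP j n) => hj; case: (leqP k n) => hk; lia.
Qed.

(** At a common point the two gaps agree modulo [2 * n]; by their normalization they are equal, and
    the gap determines the index. *)
Lemma branch_locus_disjoint j k z : SC_indices n j -> SC_indices n k ->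
  branch_locus j z -> branch_locus k z -> j = k.
Proof.
move=> hj hk [x _ <-] [y _ /esym /branch_pt_eq [[m E] _]].
have [bj _] := branch_gap_bound hj; have [bk _] := branch_gap_bound hk.
have m0 : m = 0.
  by apply: (@int_mul_small (branch_gap j - branch_gap k) m (2 * n)%N); lia.
by apply: branch_gap_inj => //; rewrite E m0 mul0r addr0.
Qed.

Lemma branch_locus_range k x : branch_locus k (branch_pt k x).
Proof.
have [m /andP[m1 m2]] := period_reduce x P0.
exists (x + m%:~R * period n); last by rewrite branch_pt_period.
by rewrite /= in_itv /= m1 ltW.
Qed.

Lemma continuous_pair (W1 W2 : normedModType R) (F : R -> W1) (G : R -> W2) :
  continuous F -> continuous G -> continuous (fun x => (F x, G x)).
Proof. by move=> cF cG x; apply: cvg_pair; [exact: cF|exact: cG]. Qed.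

Lemma continuous_circle_pt (g : R -> R) : continuous g -> continuous (fun x => circle_pt T (g x)).
Proof.
move=> cg; have cl : continuous (fun x => 2 * pi * g x / T).
  by move=> x; apply: cvgMl; apply: cvgMr; exact: cg.
apply: continuous_pair => x.
  exact: (@continuous_comp _ _ _ (fun x => 2 * pi * g x / T) cos x (cl x) (@continuous_cos R _)).
exact: (@continuous_comp _ _ _ (fun x => 2 * pi * g x / T) sin x (cl x) (@continuous_sin R _)).
Qed.

Lemma continuous_phi : continuous phi.
Proof. by move=> x; exact: (smooth_continuous sphi). Qed.

Lemma continuous_branch_pt k : continuous (branch_pt k).
Proof.
apply: continuous_pair; apply: continuous_circle_pt => y;
  apply: (@continuous_comp _ _ _ _ phi); try exact: continuous_phi.
  rewrite (_ : SC_fst n k = fun x => x + (if (k <= n)%N then 0%N else (k - n)%N)%:R * pi).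
    by apply: cvgD; [exact: cvg_id|exact: cvg_cst].
  by apply/funext => t; exact: SC_fstE.
rewrite (_ : SC_snd n k = fun x => x + (if (k <= n)%N then k else 0%N)%:R * pi).
  by apply: cvgD; [exact: cvg_id|exact: cvg_cst].
by apply/funext => t; rewrite /SC_snd; case: (leqP k n) => _ //; rewrite mul0r addr0.
Qed.

Lemma branch_locus_closed k : closed (branch_locus k).
Proof.
apply: compact_closed; first exact: norm_hausdorff.
apply: continuous_compact; first by apply: continuous_subspaceT; exact: continuous_branch_pt.
exact: segment_compact.
Qed.

Lemma branch_locus_connected k : connected (branch_locus k).
Proof.
apply: connected_continuous_connected; first exact: segment_connected.
by apply: continuous_subspaceT; exact: continuous_branch_pt.
Qed.

Definition index_seq := iota 1 (2 * n).-1.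

Lemma mem_index_seq k : (k \in index_seq) <-> SC_indices n k.
Proof. by rewrite mem_iota /SC_indices /=; split; lia. Qed.

Lemma parallel_pairsE : [set z | exists s t : R,
    [/\ z = (circle_pt T s, circle_pt T t), circle_pt T s <> circle_pt T t &
        det2 (derive1 f s) (derive1 f t) = 0]] =
  [set z | exists2 k, k \in index_seq & branch_locus k z].
Proof.
have v0 x : 0 < enorm (derive1 f (phi x)) by exact/enorm_gt0/rf.
have det x y : det2 (derive1 f (phi x)) (derive1 f (phi y)) =
    enorm (derive1 f (phi x)) * enorm (derive1 f (phi y)) * sin (y - x).
  have dir u : derive1 f (phi u) = enorm (derive1 f (phi u)) *: velocity_dir u by exact: f_dir.
  by rewrite {1}dir [X in det2 _ X]dir det2Z det2_velocity_dir.
apply/seteqP; split => z.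
  move=> [s [t [-> nst d0]]].
  have [x xs] := phi_surj cf sphi phi_period s.
  have [y yt] := phi_surj cf sphi phi_period t.
  rewrite -xs -yt in nst d0 *.
  have s0 : sin (y - x) = 0.
    apply: (mulfI (lt0r_neq0 (mulr_gt0 (v0 x) (v0 y)))); rewrite -det d0 mulr0//.
  have [m E] := sin_eq0_pi s0.
  have yE : y = x + m%:~R * pi by rewrite -E addrC subrK.
  have n2 : (0 < (2 * n)%N%:Z) by lia.
  (* Only the class of [m] modulo [2 * n] affects the second point on the circle, and [r = 0] would
     make the two points coincide. *)
  pose r := (m %% (2 * n)%N%:Z)%Z; pose q := (m %/ (2 * n)%N%:Z)%Z.
  have mE : m = q * (2 * n)%N%:Z + r by exact: divz_eq.
  have r0 : 0 <= r by apply: modz_ge0; lia.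
  have rn : r < (2 * n)%N%:Z by exact: ltz_pmod.
  have rnz : r != 0.
    apply/eqP => rz; apply: nst; apply/circ; exists (- q).
    by rewrite yE mE rz addr0 intrM period_int mulrNz; ring.
  have yq : circle_pt T (phi y) = circle_pt T (phi (x + r%:~R * pi)).
    by apply/circ; exists q; rewrite yE mE intrD intrM period_int; ring.
  have [rle|rgt] := leP r n%:Z.
    exists `|r|%N; first by apply/mem_index_seq; rewrite /SC_indices /=; lia.
    have -> : (circle_pt T (phi x), circle_pt T (phi y)) = branch_pt `|r|%N x; last exact: branch_locus_range.
    rewrite /branch_pt /SC_fst /SC_snd (_ : (`|r| <= n)%N = true); last by lia.
    rewrite yq; congr (_, circle_pt T (phi (x + _ * _))).
    by rewrite -[in LHS](gez0_abs r0).
  (* A residue above [n] is read backwards: the first point lies [i%:R * pi] after the second,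
     modulo the period, as on the branch of index [n + i]. *)
  pose i := `|(2 * n)%N%:Z - r|%N; exists (n + i)%N.
    by apply/mem_index_seq; rewrite /SC_indices /= /i; lia.
  have -> : (circle_pt T (phi x), circle_pt T (phi y)) = branch_pt (n + i)%N (x - i%:R * pi);
    last exact: branch_locus_range.
  rewrite /branch_pt /SC_fst /SC_snd (_ : (n + i <= n)%N = false); last by rewrite /i; lia.
  rewrite addKn subrK yq; congr (_, _); apply/circ; exists 1.
  have -> : i%:R = (2 * n)%N%:Z%:~R - r%:~R :> R.
    rewrite -intrB -[i%:R]/(i%:Z%:~R); congr (_%:~R); rewrite /i gez0_abs//; lia.
  by rewrite period_int; ring.
move=> [k /mem_index_seq hk [x _ <-]].
exists (phi (SC_fst n k x)), (phi (SC_snd n k x)); split => //.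
  move=> /circ[m]; rewrite SC_sndE -addrA -[LHS]addr0 => /addrI /esym.
  rewrite period_int mulrA -intrM -mulrDl -intrD -[0 in RHS](mul0r pi) -[0 in RHS]/(0%:~R) => /pi_int_inj.
  have [bk /eqP k0] := branch_gap_bound hk => E; apply: k0.
  have m0 : m = 0 by apply: (@int_mul_small (- branch_gap k) m (2 * n)%N); lia.
  by move: E; rewrite m0 mul0r addr0 => /esym.
have gapE : SC_snd n k x - SC_fst n k x = (branch_gap k)%:~R * pi.
  by rewrite SC_sndE addrC addKr.
by rewrite det gapE -[X in sin X]add0r sin_addzpi sin0 !mulr0.
Qed.

(** The set under the closure is already a finite union of compact loops, so the closure adds
    nothing. *)
Lemma parallel_locusE : parallel_locus T f = [set z | exists2 k, k \in index_seq & branch_locus k z].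
Proof.
rewrite /parallel_locus parallel_pairsE; apply/esym/closure_id.
by apply: (@closed_finite_union _ _ index_seq branch_locus) => k _; exact: branch_locus_closed.
Qed.

Lemma branch_component k z : SC_indices n k -> branch_locus k z ->
  connected_component (parallel_locus T f) z = branch_locus k.
Proof.
move=> /mem_index_seq hk kz; rewrite parallel_locusE; apply: (@component_finite_union _ _ index_seq branch_locus) => //.
- by move=> i _; exact: branch_locus_closed.
- by move=> i _; exact: branch_locus_connected.
- by move=> i j x /mem_index_seq hi /mem_index_seq hj; exact: branch_locus_disjoint.
Qed.

Lemma branch_locus_bij : set_bij (SC_indices n) (SC_components T f) branch_locus.
Proof.
split.
- move=> k hk; exists (branch_pt k 0); last exact/branch_component/branch_locus_range.
  by rewrite parallel_locusE; exists k; [exact/mem_index_seq|exact: branch_locus_range].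
- move=> j k; rewrite !inE => hj hk E.
  apply: (@branch_locus_disjoint j k (branch_pt j 0)) => //; first exact: branch_locus_range.
  by rewrite -E; exact: branch_locus_range.
move=> _ [z + <-]; rewrite {1}parallel_locusE => -[k /mem_index_seq hk kz].
by exists k => //; rewrite (branch_component hk kz).
Qed.

Lemma branch_parameterization k : SC_indices n k ->
  parameterizes_branch T f (branch_locus k) (period n) (SC n (polar_tangential p) k).
Proof.
move=> hk; have oT : open [set: R] by exact: openT.
have gE := polar_tangentialE cf sphi f_dir pE.
have sfst : smooth setT (fun x => phi (SC_fst n k x)).
  rewrite (_ : (fun x => phi (SC_fst n k x)) =
    fun x => phi (x + (if (k <= n)%N then 0%N else (k - n)%N)%:R * pi)); first exact: smooth_shift.
  by apply/funext => x; rewrite SC_fstE.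
have ssnd : smooth setT (fun x => phi (SC_snd n k x)).
  rewrite (_ : (fun x => phi (SC_snd n k x)) =
    fun x => phi (x + (if (k <= n)%N then k else 0%N)%:R * pi)); first exact: smooth_shift.
  by apply/funext => t; rewrite /SC_snd; case: (leqP k n) => _ //; rewrite mul0r addr0.
exists (fun x => phi (SC_fst n k x)), (fun x => phi (SC_snd n k x)); split.
- by [].
- move=> x; left; rewrite (_ : (fun x => phi (SC_fst n k x)) =
    fun x => phi (x + (if (k <= n)%N then 0%N else (k - n)%N)%:R * pi)); last first.
    by apply/funext => t; rewrite SC_fstE.
  have h := is_derive_shift1 (@smooth_is_derive _ setT phi
    (x + (if (k <= n)%N then 0%N else (k - n)%N)%:R * pi) sphi I).
  by rewrite (derive1_of h) => h0; have := phi_incr (x + (if (k <= n)%N then 0%N else (k - n)%N)%:R * pi);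
    rewrite h0 ltxx.
- by move=> x; have := branch_pt_period k x 1; rewrite mul1r.
- split.
  + by move=> x _; exact: branch_locus_range.
  + move=> x y; rewrite !inE /= !in_itv /= => /andP[x0 x1] /andP[y0 y1] /branch_pt_eq[_ [m]].
    rewrite !SC_fstE addrAC => /addIr E.
    have [m0|m0|m0] := ltgtP m 0; last by rewrite E m0 mul0r addr0.
      have : m%:~R <= -1 :> R by rewrite -[-1]/((-1)%:~R) ler_int; lia.
      by move=> h; nra.
    have : 1 <= m%:~R :> R by rewrite -[1]/(1%:~R) ler_int; lia.
    by move=> h; nra.
  + move=> z [x /=]; rewrite in_itv /= => /andP[x0]; rewrite le_eqVlt => /orP[/eqP -> <-|x1 <-].
      (* The right end of the closed interval, missing from the half-open one, gives the same point
         as 0. *)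
      exists 0; first by rewrite /= in_itv /= lexx.
      by have := branch_pt_period k 0 1; rewrite mul1r add0r => h; exact: esym h.
    by exists x => //; rewrite /= in_itv /= x0.
by move=> x; rewrite /SC !gE.
Qed.

End Locus.

(** * The minimal number of cusps *)

Section PositiveCurvature.
Context {R : realType}.
Implicit Types (c : R -> R * R) (t : R).

Lemma not_inflexion c t : (forall t, 0 < curvature c t) -> ~ inflexion c t.
Proof.
move=> cp; case=> H; have [u /andP[h1 h2]] := filter_ex H.
  by have := cp (t - u); rewrite ltNge (ltW h1).
by have := cp (t + u); rewrite ltNge (ltW h1).
Qed.

(** On a curve of positive curvature this rules out equal curvatures at a parallel pair with
    opposite velocities, so the corresponding clause of genericity holds vacuously for the
    example. *)
Lemma curvature_reverse c t : smooth setT c -> curvature (reverse c) (- t) = - curvature c t.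
Proof.
move=> sc; have dN (u : R) : is_derive u 1 (fun x : R => - x) (- 1 : R) by exact: isdN (isd_id u).
have sc1 := smooth_derive1W sc.
have E1 u : derive1 (reverse c) u = - derive1 c (- u).
  have := is_derive_comp_curve (smooth_is_deriveW (- u) sc) (dN u).
  by rewrite scaleN1r => /derive1_of.
have E2 u : derive1n 2 (reverse c) u = derive1n 2 c (- u).
  rewrite derive1nS (_ : derive1n 1 (reverse c) = fun u => - derive1 c (- u)); last first.
    by apply/funext => v; rewrite derive1n1 E1.
  have h := is_derive_comp_curve (smooth_is_deriveW (- u) sc1) (dN u).
  by have := is_deriveN h; rewrite scaleN1r opprK => /derive1_of.
rewrite /curvature E1 E2 opprK; have -> : enorm (- derive1 c t) = enorm (derive1 c t).
  by congr Num.sqrt; rewrite /dot /=; ring.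
have dE : det2 (- derive1 c t) (derive1n 2 c t) = - det2 (derive1 c t) (derive1n 2 c t).
  by move: (derive1 c t) (derive1n 2 c t) => u v; rewrite /det2 /=; ring.
by rewrite dE mulNr.
Qed.

End PositiveCurvature.

(** * A generic rosette attaining the minimal number of cusps *)

Section Example.
Context {R : realType} (n : nat) (hn : (0 < n)%N).

Definition ex_support (t : R) : R := 1 + 2^-1 * cos (t / n%:R).
(** The radius of curvature is [p + p''], and two derivatives of [cos (t / n%:R)] bring out the
    factor [- n%:R ^- 2]. For [n = 1] the amplitude is 0 and the curve is a circle. *)
Definition ex_amplitude : R := 2^-1 * (1 - n%:R ^- 2).
Definition ex_radius (t : R) : R := 1 + ex_amplitude * cos (t / n%:R).
Definition ex_curve : R -> R * R := polar_tangential ex_support.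

Let oT : open [set: R]. Proof. exact: openT. Qed.
Let n0 : n%:R != 0 :> R. Proof. by rewrite pnatr_eq0 -lt0n. Qed.

Lemma is_derive_cos_div (t : R) : is_derive t 1 (fun x => cos (x / n%:R)) (- (n%:R^-1 * sin (t / n%:R))).
Proof.
have h := @isd_comp R cos (fun x => x / n%:R) t _ _ (is_derive_cos (t / n%:R))
  (isdM (isd_id t) (isd_cst n%:R^-1 t)).
by apply: (is_derive_eq h); ring.
Qed.

Lemma is_derive_sin_div (t : R) : is_derive t 1 (fun x => sin (x / n%:R)) (n%:R^-1 * cos (t / n%:R)).
Proof.
have h := @isd_comp R sin (fun x => x / n%:R) t _ _ (is_derive_sin (t / n%:R))
  (isdM (isd_id t) (isd_cst n%:R^-1 t)).
by apply: (is_derive_eq h); ring.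
Qed.

Lemma ex_supportE' : derive1 ex_support = fun t => - (2^-1 * n%:R^-1 * sin (t / n%:R)).
Proof.
apply/funext => t; have h := isdD (isd_cst 1 t) (isdZ 2^-1 (is_derive_cos_div t)).
by rewrite (derive1_of h); ring.
Qed.

Lemma ex_support_gt0 t : 0 < ex_support t.
Proof. by rewrite /ex_support; have := cos_geN1 (t / n%:R); lra. Qed.

Lemma ex_amplitude_bound : 0 <= ex_amplitude < 2^-1.
Proof.
have h1 : 1 <= (n%:R : R) ^+ 2 by rewrite exprn_ege1// ler1n.
have h2 : (n%:R : R) ^- 2 <= 1 by rewrite invf_le1// (lt_le_trans _ h1).
have h3 : 0 < (n%:R : R) ^- 2 by rewrite invr_gt0 (lt_le_trans _ h1).
by rewrite /ex_amplitude; apply/andP; split; lra.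
Qed.

Lemma ex_amplitude_gt0 : (1 < n)%N -> 0 < ex_amplitude.
Proof.
move=> n1; have h1 : 1 < (n%:R : R) ^+ 2 by rewrite exprn_egt1// ltr1n.
have h2 : (n%:R : R) ^- 2 < 1 by rewrite invf_lt1// (lt_trans _ h1).
by rewrite /ex_amplitude; lra.
Qed.

Lemma ex_radius_gt0 t : 0 < ex_radius t.
Proof.
rewrite /ex_radius; have := cos_geN1 (t / n%:R); have /andP[] := ex_amplitude_bound.
by move: ex_amplitude (cos _) => a c; nra.
Qed.

Lemma smooth_div_n : smooth setT (fun x : R => x / n%:R).
Proof. by apply: (smoothM oT); [exact: smooth_id|exact: smooth_cst]. Qed.

Lemma ex_tangent_curve : tangent_curve ex_curve ex_radius.
Proof.
have sc : smooth setT (fun x : R => cos (x / n%:R)) by apply: (smooth_cos oT); exact: smooth_div_n.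
have ss : smooth setT (fun x : R => sin (x / n%:R)) by apply: (smooth_sin oT); exact: smooth_div_n.
have cE : ex_curve = fun t =>
  (ex_support t * cos t + 2^-1 * n%:R^-1 * sin (t / n%:R) * sin t,
   ex_support t * sin t - 2^-1 * n%:R^-1 * sin (t / n%:R) * cos t).
  by apply/funext => t; rewrite /ex_curve /polar_tangential ex_supportE'; congr (_, _); ring.
have sp : smooth setT ex_support.
  by apply: (smoothD oT); [exact: smooth_cst|exact: (smoothZ oT)].
have sq : smooth setT (fun t : R => 2^-1 * n%:R^-1 * sin (t / n%:R)) by exact: (smoothZ oT).
have c1 : smooth setT (@cos R) by apply: (smooth_cos oT); exact: smooth_id.
have s1 : smooth setT (@sin R) by apply: (smooth_sin oT); exact: smooth_id.
split.
- rewrite cE; apply: (smooth_pair oT).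
    by apply: (smoothD oT); exact: (smoothM oT).
  by apply: (smoothB oT); exact: (smoothM oT).
- by apply: (smoothD oT); [exact: smooth_cst|exact: (smoothZ oT)].
move=> t; rewrite cE.
have dp := isdD (isd_cst 1 t) (isdZ 2^-1 (is_derive_cos_div t)).
have dq := isdZ (2^-1 * n%:R^-1) (is_derive_sin_div t).
have h1 := isdD (isdM dp (is_derive_cos t)) (isdM dq (is_derive_sin t)).
have h2 := isdB (isdM dp (is_derive_sin t)) (isdM dq (is_derive_cos t)).
apply: (is_derive_eq (is_derive_pair h1 h2)).
have e : (n%:R : R) ^- 2 = n%:R^-1 * n%:R^-1 by rewrite expr2 invfM.
rewrite /ex_radius /ex_amplitude e; move: (n%:R^-1) (cos (t / n%:R)) (sin (t / n%:R)) => m a b.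
transitivity ((1 + 2^-1 * (1 - m * m) * a) * - sin t, (1 + 2^-1 * (1 - m * m) * a) * cos t) => //.
by congr (_, _); field.
Qed.

Lemma div_n_period (t : R) (m : int) : (t + m%:~R * period n) / n%:R = t / n%:R + m%:~R * (2 * pi).
Proof. by rewrite /period; field. Qed.

Lemma ex_curve_period t (m : int) : ex_curve (t + m%:~R * period n) = ex_curve t.
Proof.
rewrite /ex_curve /polar_tangential ex_supportE' /ex_support div_n_period.
have -> : m%:~R * period n = (m * n%:Z)%:~R * (2 * pi) :> R.
  by rewrite intrM /period -[n%:~R]/(n%:R : R); ring.
by rewrite !cos_addz2pi !sin_addz2pi.
Qed.

Lemma ex_curve_period1 t : ex_curve (t + period n) = ex_curve t.
Proof. by have := ex_curve_period t 1; rewrite mul1r. Qed.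

Lemma ex_curvatureE t : curvature ex_curve t = (ex_radius t)^-1.
Proof.
have r0 := ex_radius_gt0 t; have rn : ex_radius t != 0 by rewrite gt_eqF.
by rewrite (tangent_curve_curvature ex_tangent_curve rn) gtr0_norm.
Qed.

Lemma ex_curvature_gt0 t : 0 < curvature ex_curve t.
Proof. by rewrite ex_curvatureE invr_gt0 ex_radius_gt0. Qed.

Lemma ex_closed : closed_curve (period n) ex_curve.
Proof.
split; [exact: period_gt0|by case: ex_tangent_curve|exact: ex_curve_period1].
Qed.

Lemma ex_regular : regular ex_curve.
Proof.
by move=> t /(tangent_curve_singular t ex_tangent_curve) h; have := ex_radius_gt0 t; rewrite h ltxx.
Qed.

Lemma ex_n_rosette : n_rosette n (period n) ex_curve.
Proof.
split; [exact: ex_closed|exact: ex_regular|exact: ex_curvature_gt0|].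
exists frame_normal; first exact: tangent_curve_unit_normal ex_tangent_curve.
have := @frame_normal_rotation R n 0.
by rewrite (_ : (fun t => frame_normal (t + 0)) = frame_normal)//; apply/funext => t; rewrite addr0.
Qed.

Let sid : smooth [set: R] (fun x : R => x). Proof. exact: smooth_id. Qed.
Let did (theta : R) : derive1 (fun x : R => x) theta = 1. Proof. exact: derive1_of (isd_id _). Qed.

Lemma ex_derive1 t : derive1 ex_curve t = enorm (derive1 ex_curve t) *: (- sin t, cos t).
Proof.
rewrite (tangent_curve_derive1 t ex_tangent_curve) enorm_velocity_dir.
by rewrite gtr0_norm// ex_radius_gt0.
Qed.

Lemma ex_dot_frame_normal t : dot (ex_curve t) (frame_normal t) = ex_support t.
Proof.
rewrite /ex_curve /polar_tangential /dot /frame_normal /=; set p' := derive1 _ _.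
by rewrite -[RHS](mulr_cos2Dsin2 t); ring.
Qed.

Lemma ex_dot_velocity_dir t : dot (ex_curve t) (velocity_dir t) = derive1 ex_support t.
Proof.
rewrite /ex_curve /polar_tangential /dot /velocity_dir /=; set p' := derive1 _ _.
by rewrite -[RHS](mulr_cos2Dsin2 t); ring.
Qed.

Lemma ex_support_function : support_function n (period n) ex_curve ex_support.
Proof.
exists (fun x => x); split => //.
- by split => // theta; rewrite did.
- exact: ex_derive1.
- by move=> theta; rewrite -ex_dot_frame_normal.
Qed.

Lemma ex_radiusE : radius ex_curve (fun x => x) = ex_radius.
Proof.
apply/funext => t; rewrite /radius did mulr1 (tangent_curve_derive1 t ex_tangent_curve).
by rewrite enorm_velocity_dir gtr0_norm// ex_radius_gt0.
Qed.

Let one_gt0 (theta : R) : 0 < derive1 (fun x : R => x) theta. Proof. by rewrite did. Qed.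

Lemma ex_curvature_derivE t : curvature_deriv ex_curve t = - derive1 ex_radius t / ex_radius t ^+ 3.
Proof.
by have := curvature_deriv_f_phi ex_closed ex_regular sid one_gt0 ex_derive1 t; rewrite ex_radiusE.
Qed.

Lemma ex_radiusE' t : derive1 ex_radius t = - (ex_amplitude * n%:R^-1 * sin (t / n%:R)).
Proof.
have h := isdD (isd_cst 1 t) (isdZ ex_amplitude (is_derive_cos_div t)).
by rewrite (derive1_of h); ring.
Qed.

Lemma cos_sin_div_period (s t : R) : cos (s / n%:R) = cos (t / n%:R) -> sin (s / n%:R) = sin (t / n%:R) ->
  exists m : int, s = t + m%:~R * period n.
Proof.
move=> c1 s1; have [m E] := cos_sin_inj c1 s1; exists m.
by rewrite -[LHS](divfK n0) E /period; field.
Qed.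

Lemma ex_det s t : det2 (derive1 ex_curve s) (derive1 ex_curve t) =
  ex_radius s * ex_radius t * sin (t - s).
Proof.
by rewrite !(tangent_curve_derive1 _ ex_tangent_curve) det2Z det2_velocity_dir.
Qed.

Lemma ex_dot s t : dot (derive1 ex_curve s) (derive1 ex_curve t) =
  ex_radius s * ex_radius t * cos (t - s).
Proof.
by rewrite !(tangent_curve_derive1 _ ex_tangent_curve) dotZ dot_velocity_dir2.
Qed.

Lemma ex_parallel s t : det2 (derive1 ex_curve s) (derive1 ex_curve t) = 0 ->
  exists m : int, t = s + m%:~R * pi.
Proof.
rewrite ex_det => h.
have s0 : sin (t - s) = 0.
  by apply: (mulfI (lt0r_neq0 (mulr_gt0 (ex_radius_gt0 s) (ex_radius_gt0 t)))); rewrite h mulr0.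
by have [m E] := sin_eq0_pi s0; exists m; rewrite -E addrC subrK.
Qed.

Lemma frame_normal_addzpi (t : R) (m : int) :
  frame_normal (t + m%:~R * pi) = (-1) ^+ `|m|%N *: frame_normal t.
Proof. by rewrite /frame_normal sin_addzpi cos_addzpi. Qed.

Lemma velocity_dir_addzpi (t : R) (m : int) :
  velocity_dir (t + m%:~R * pi) = (-1) ^+ `|m|%N *: velocity_dir t.
Proof. by rewrite /velocity_dir sin_addzpi cos_addzpi /GRing.scale /= -mulrN. Qed.

Lemma dotZr (u v : R * R) (a : R) : dot u (a *: v) = a * dot u v.
Proof. by have := dotZ 1 a u v; rewrite scale1r mul1r. Qed.

(** Parallel tangents put the angles a multiple of pi apart. An odd multiple would give the positive
    support function opposite values; for an even one, [p] and [p'] agree at both angles and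
    determine cosine and sine of the angle divided by [n]. *)
Lemma ex_crossing s t : ex_curve s = ex_curve t ->
  det2 (derive1 ex_curve s) (derive1 ex_curve t) = 0 ->
  exists m : int, s = t + m%:~R * period n.
Proof.
move=> E /ex_parallel[m tE].
have pE : ex_support t = (-1) ^+ `|m|%N * ex_support s.
  by rewrite -ex_dot_frame_normal -E {1}tE frame_normal_addzpi dotZr ex_dot_frame_normal.
have qE : derive1 ex_support t = (-1) ^+ `|m|%N * derive1 ex_support s.
  by rewrite -ex_dot_velocity_dir -E {1}tE velocity_dir_addzpi dotZr ex_dot_velocity_dir.
move: pE qE; rewrite -signr_odd; case: odd => /=.
  by have := ex_support_gt0 s; have := ex_support_gt0 t; rewrite expr1 mulN1r => h1 h2 h3; lra.
rewrite !mul1r ex_supportE' /ex_support => h1 h2; apply: cos_sin_div_period.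
  by lra.
have h3 : n%:R^-1 * sin (s / n%:R) = n%:R^-1 * sin (t / n%:R) by lra.
by move/mulfI : h3; apply; rewrite invr_eq0.
Qed.

Lemma ex_generic : generic (period n) ex_curve.
Proof.
have P0 : 0 < period n :> R by exact: period_gt0.
have ni := not_inflexion (t := _) ex_curvature_gt0.
split.
- split; first by move=> t /ni.
  by move=> t [h _]; have := ex_curvature_gt0 t; rewrite h ltxx.
- move=> s t nst E d0; apply: nst; apply/(circle_pt_eq _ _ P0); exact: ex_crossing.
- by move=> s t _; left => /ni.
move=> s t [nE d0]; split.
  rewrite ex_dot => dp kE dkE; have [m tE] := ex_parallel d0.
  have rs := ex_radius_gt0 s; have rt := ex_radius_gt0 t.
  (* An odd multiple of pi would make the velocities opposite. *)
  have em : ~~ odd `|m|%N.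
    apply/negP => om; move: dp; have -> : t - s = 0 + m%:~R * pi by rewrite tE; ring.
    have -> : cos (0 + m%:~R * pi) = -1 :> R.
      by have := cos_addzpi (0 : R) m; rewrite cos0 mulr1 -signr_odd om expr1.
    by rewrite mulrN1 oppr_gt0 => h; have := lt_trans (mulr_gt0 rs rt) h; rewrite ltxx.
  have rE : ex_radius s = ex_radius t. by move: kE; rewrite !ex_curvatureE => /invr_inj.
  have r'E : derive1 ex_radius s = derive1 ex_radius t.
    move: dkE; rewrite !ex_curvature_derivE rE => /mulIf => h; apply: oppr_inj; apply: h.
    exact: invr_neq0 (expf_neq0 3 (lt0r_neq0 rt)).
  (* For [n = 1] the radius is constant and carries no information, but every even multiple of pi is
     then a period. *)
  apply: nE; have [n1|n1] := leqP n 1%N.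
    have nE : n = 1%N by lia.
    have [k mE] : exists k : int, m = k * 2.
      by exists (m %/ 2)%Z; apply/esym/divzK; rewrite dvdzE /= dvdn2.
    rewrite tE mE -(ex_curve_period s k); congr (ex_curve (_ + _)).
    by rewrite intrM /period nE; ring.
  have a0 := ex_amplitude_gt0 n1.
  have [k ->] : exists m : int, s = t + m%:~R * period n.
    apply: cos_sin_div_period.
      by apply: (mulfI (lt0r_neq0 a0)); move: rE; rewrite /ex_radius => /addrI.
    move: r'E; rewrite !ex_radiusE' => /oppr_inj/mulfI; apply.
    exact: mulf_neq0 (lt0r_neq0 a0) (invr_neq0 n0).
  by rewrite ex_curve_period.
move=> _ kE; exfalso; move: kE; rewrite curvature_reverse; last by case: ex_tangent_curve.
move=> h; have := ex_curvature_gt0 s; rewrite h oppr_gt0 => h1.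
by have := lt_trans (ex_curvature_gt0 t) h1; rewrite ltxx.
Qed.

Lemma ex_rho_generic (j : nat) t : ~~ odd j -> (0 < j < 2 * n)%N ->
  ex_radius t = ex_radius (t + j%:R * pi) ->
  derive1 ex_radius t <> derive1 ex_radius (t + j%:R * pi).
Proof.
have pP (x : R) : x + period n = x + period n by [].
rewrite -!ex_radiusE => oj hj.
exact: (generic_radius ex_closed ex_regular sid one_gt0 pP ex_derive1 ex_generic oj hj).
Qed.

(** With the midpoint angle [al] and the half gap [be], both divided by [n], the difference of the
    two cosines is [2 * sin be * sin al]. As [t] runs over a period, [al] runs over the interval
    from [be] to [be + 2 pi], the latter excluded; since [0 < be < pi], it meets the multiples of pi
    at [pi] and [2 pi] only. *)
Lemma ex_branch_zero j (t : R) : (1 < n)%N -> (0 < j <= n)%N -> ~~ odd j ->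
  (0 <= t < period n) && (radius_diff ex_radius j t == 0) <->
  t = n%:R * pi - j%:R * pi / 2 \/ t = 2 * n%:R * pi - j%:R * pi / 2.
Proof.
move=> n1 /andP[j0 jn] ej; have p0 := pi_gt0 R.
have a0 := ex_amplitude_gt0 n1; have nn : 0 < n%:R :> R by rewrite ltr0n.
pose al : R := t / n%:R + j%:R * pi / (2 * n%:R); pose be : R := j%:R * pi / (2 * n%:R).
have be0 : 0 < sin be.
  apply: sin_gt0_pi; rewrite /be divr_gt0 ?mulr_gt0 ?ltr0n//= ltr_pdivrMr ?mulr_gt0//.
  by rewrite mulrC ltr_pM2l// -natrM ltr_nat; lia.
have E : radius_diff ex_radius j t = 2 * ex_amplitude * sin be * sin al.
  rewrite radius_diff_even// /ex_radius.
  have -> : t / n%:R = al - be by rewrite /al /be addrK.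
  have -> : (t + j%:R * pi) / n%:R = al + be by rewrite /al /be; field.
  by rewrite cosB cosD; move: (cos al) (cos be) (sin al) (sin be) => a b c d; ring.
have jR : 0 < j%:R * pi :> R by rewrite mulr_gt0// ltr0n.
have jnR : j%:R * pi <= n%:R * pi :> R by rewrite ler_pM2r// ler_nat.
have zero : (radius_diff ex_radius j t == 0) = (sin al == 0).
  have c0 : 2 * ex_amplitude * sin be != 0.
    exact: mulf_neq0 (mulf_neq0 (lt0r_neq0 (ltr0n _ 2)) (lt0r_neq0 a0)) (lt0r_neq0 be0).
  by rewrite E mulf_eq0 (negbTE c0).
rewrite zero; split.
  move=> /andP[/andP[t0 tP] /eqP/sin_eq0_pi[m mE]].
  have tE : t = m%:~R * (n%:R * pi) - j%:R * pi / 2.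
    have -> : t = al * n%:R - j%:R * pi / 2 by rewrite /al; field.
    by rewrite mE; ring.
  have np : 0 < n%:R * pi :> R by rewrite mulr_gt0.
  have m0 : (0 : R) < m%:~R.
    by rewrite ltNge; apply/negP => h; move: t0; rewrite tE => t0; nra.
  have m3 : m%:~R < (3 : R).
    rewrite ltNge; apply/negP => h; move: tP; rewrite tE /period => tP; nra.
  have [m1|m2] : m = 1 \/ m = 2.
    have {}m0 : (0 < m)%R by rewrite -(ltr_int R).
    have {}m3 : (m < 3)%R by rewrite -(ltr_int R).
    by clear -m0 m3; lia.
  - by left; rewrite tE m1 mul1r.
  - by right; rewrite tE m2; ring.
have aux (m : nat) : t = m%:R * n%:R * pi - j%:R * pi / 2 -> sin al = 0.
  move=> tE; have -> : al = m%:R * pi by rewrite /al tE; field.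
  exact: sin_addkpi0.
case=> tE.
  rewrite (aux 1%N) ?eqxx ?andbT; last by rewrite tE mul1r.
  by rewrite tE /period; apply/andP; split; lra.
rewrite (aux 2%N) ?eqxx ?andbT; last by rewrite tE.
by rewrite tE /period; apply/andP; split; lra.
Qed.

Definition ex_cusp_param (i j : nat) : R :=
  (if odd i then 2 else 1) * n%:R * pi - j%:R * pi / 2.

(** The cusps are enumerated in pairs: the half of [i] selects the singular branch and the parity of
    [i] one of its two cusps. *)
Lemma ex_card_cusps : (SC_cusps n ex_curve #= `I_(2 * (n - 1)))%card.
Proof.
have p0 := pi_gt0 R.
pose K i := singular_index n i./2.
pose F i := (K i, ex_cusp_param i (branch_shift n (K i))).
have cE k t : SC_indices n k -> cusps (period n) (SC n ex_curve k) t <->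
    (0 <= t < period n) && (branch_speed n ex_radius k t == 0).
  move=> hk; exact: (cusps_SC hn ex_tangent_curve ex_radius_gt0 ex_rho_generic t hk).
have zE k t : SC_indices n k -> ~~ odd (branch_shift n k) -> (1 < n)%N ->
    cusps (period n) (SC n ex_curve k) t <->
    t = n%:R * pi - (branch_shift n k)%:R * pi / 2 \/
    t = 2 * n%:R * pi - (branch_shift n k)%:R * pi / 2.
  move=> hk ek n1; have hb : (0 < branch_shift n k <= n)%N by exact: branch_shift_bound.
  rewrite cE// -ex_branch_zero//.
  have -> : (branch_speed n ex_radius k t == 0) = (radius_diff ex_radius (branch_shift n k) t == 0).
    by apply/eqP/eqP => /branch_speed_eq0.
  by [].
apply: (@card_nat_image _ _ _ F).
- move=> i j hi hj [/singular_index_inj e]; have ij : i./2 = j./2 by apply: e; lia.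
  rewrite /K ij /ex_cusp_param; have np : 0 < n%:R * pi :> R by rewrite mulr_gt0// ltr0n.
  by case: (boolP (odd i)) => oi; case: (boolP (odd j)) => oj h; [lia|exfalso; lra|exfalso; lra|lia].
- move=> i hi; have n1 : (1 < n)%N by lia.
  have [/= hk ek] : SC_indices n (K i) /\ ~~ odd (branch_shift n (K i)).
    by apply/expected_singularP => //; apply: singular_indexP => //; lia.
  split => //=; apply/zE => //; rewrite /ex_cusp_param; case: odd; [right|left] => //.
  by rewrite mul1r.
move=> [k t] [/= hk hc]; have ek : ~~ odd (branch_shift n k).
  move: hc => /(cE _ _ hk)/andP[_ /eqP h]; apply/negP => ok.
  by have := branch_speed_odd ex_radius_gt0 t ok; rewrite h eqxx.
have [i hi iE] : exists2 i, (i < n - 1)%N & singular_index n i = k.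
  by apply: singular_index_surj => //; apply/expected_singularP.
have n1 : (1 < n)%N by lia.
have [tE|tE] := (zE k t hk ek n1).1 hc.
  exists i.*2; first lia.
  by rewrite /F /K doubleK iE /ex_cusp_param odd_double mul1r tE.
exists i.*2.+1; first lia.
have -> : F i.*2.+1 = (k, ex_cusp_param i.*2.+1 (branch_shift n k)).
  by rewrite /F /K (_ : i.*2.+1./2 = i) ?iE//; lia.
by rewrite /ex_cusp_param /= odd_double /= tE.
Qed.

End Example.

Lemma card_nat_le (T : Type) (A : set T) (m : nat) (F : nat -> T) :
  (forall i j, (i < m)%N -> (j < m)%N -> F i = F j -> i = j) ->
  (forall i, (i < m)%N -> A (F i)) -> (`I_m #<= A)%card.
Proof.
move=> Fi FA; have e : (F @` `I_m #= `I_m)%card.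
  by apply: (@card_nat_image _ _ _ F) => // i hi; exists i.
by rewrite -(card_le_eql e); apply: subset_card_le => _ [i hi <-]; exact: FA.
Qed.

(** Each of the [n - 1] singular branches contributes two chosen cusps, and cusps on different
    branches count separately. *)
Lemma SC_cusps_ge (R : realType) (n : nat) (hn : (0 < n)%N) (gam : R -> R * R) (rho : R -> R) :
  tangent_curve gam rho -> (forall theta, 0 < rho theta) ->
  (forall theta, rho (theta + period n) = rho theta) ->
  (forall (j : nat) theta, ~~ odd j -> (0 < j < 2 * n)%N ->
    rho theta = rho (theta + j%:R * pi) ->
    derive1 rho theta <> derive1 rho (theta + j%:R * pi)) ->
  (`I_(2 * (n - 1)) #<= SC_cusps n gam)%card.
Proof.
move=> tg rho_gt0 rho_period rho_generic.
have two i : exists s : seq R, (i < n - 1)%N ->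
    [/\ uniq s, (1 < size s)%N & forall x, x \in s -> cusps (period n) (SC n gam (singular_index n i)) x].
  have [hi|] := ltnP i (n - 1)%N; last by exists [::].
  have [hk ek] := (expected_singularP hn _).1 (singular_indexP hn hi).
  have [s [us Hs os]] := cusps_seq hn tg rho_gt0 rho_period rho_generic hk.
  have sk := (branch_singularP hn tg rho_gt0 rho_period hk).2 ek.
  exists s => _; split => //.
    exact: (cusps_seq_ge2 hn tg rho_gt0 rho_period rho_generic hk sk Hs os).
  by move=> x /Hs.
have [s Hs] := choice two.
apply: (@card_nat_le _ _ _ (fun i => (singular_index n i./2, nth 0 (s i./2) (odd i)))).
  move=> i j hi hj [/(singular_index_inj hn) e E].
  have ij : i./2 = j./2 by apply: e; lia.
  have [us ss _] : [/\ uniq (s i./2), (1 < size (s i./2))%N &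
      forall x, x \in s i./2 -> cusps (period n) (SC n gam (singular_index n i./2)) x].
    by apply: Hs; lia.
  have lt2 (b : bool) : (b < size (s i./2))%N by apply: leq_ltn_trans ss; case: b.
  move/eqP: E; rewrite -ij nth_uniq// => /eqP E.
  have ob : odd i = odd j by case: (odd i) (odd j) E => -[].
  by rewrite -[i]odd_double_half -[j]odd_double_half ob ij.
move=> i hi; have hi2 : (i./2 < n - 1)%N by lia.
have [_ ss sc] := Hs _ hi2; split => /=.
  by have [] := (expected_singularP hn _).1 (singular_indexP hn hi2).
by apply: sc; apply: mem_nth; apply: leq_ltn_trans ss; case: odd.
Qed.

Theorem theorem4p2 (R : realType) (n : nat) (hn : (0 < n)%N) :
  (forall (T : R) (f : R -> R * R) (p : R -> R),
    n_rosette n T f -> generic T f -> support_function n T f p ->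
    let gamma := polar_tangential p in
    (* (i) *)
    (exists B : nat -> set ((R * R) * (R * R)),
      [/\ set_bij (SC_indices n) (SC_components T f) B,
          (SC_components T f #= `I_(2 * n - 1))%card,
          forall k, (1 <= k <= n)%N ->
            SC n gamma k = (fun theta => gamma theta - gamma (theta + k%:R * pi)) /\
            parameterizes_branch T f (B k) (period n) (SC n gamma k) &
          forall k, (1 <= k <= n - 1)%N ->
            SC n gamma (n + k)%N =
              (fun theta => gamma (theta + k%:R * pi) - gamma theta) /\
            parameterizes_branch T f (B (n + k)%N) (period n)
              (SC n gamma (n + k)%N)]) /\
    (* (ii) *)
    (forall k, (1 <= k <= n - 1)%N ->
      point_reflection \o SC n gamma k = SC n gamma (n + k)%N) /\
    (* (iii) *)
    centrally_symmetric (range (SC n gamma n)) /\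
    (* (iv) *)
    (forall k, SC_indices n k ->
      at_most_cusps (SC n gamma k) /\
      forall nu, unit_normal_field (period n) gamma nu ->
        unit_normal_field (period n) (SC n gamma k) (nu \o SC_fst n k) /\
        field_rotation_number (period n) (nu \o SC_fst n k) n%:Z) /\
    (* (v) *)
    ([set k | SC_indices n k /\ rosette (period n) (SC n gamma k)] =
       expected_rosettes n /\
     (expected_rosettes n #= `I_n)%card) /\
    (* (vi) *)
    ([set k | SC_indices n k /\ singular (SC n gamma k)] =
       expected_singular n /\
     (expected_singular n #= `I_(n - 1))%card /\
     forall k, SC_indices n k -> singular (SC n gamma k) ->
       exists2 m, ~~ odd m &
         (cusps (period n) (SC n gamma k) #= `I_m)%card) /\
    (* (viii) *)
    (forall k, SC_indices n k -> ~ singular (SC n gamma k) ->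
      length (period n) (SC n gamma k) = 2 * length (period n) gamma) /\
    (* (ix) *)
    (forall k, SC_indices n k -> singular (SC n gamma k) ->
      length (period n) (SC n gamma k) <= 2 * length (period n) gamma) /\
    (* (x) *)
    (forall k, (1 <= k < n)%N ->
      signed_area (period n) (SC n gamma k)
        + 4 * signed_area (period n) (wigner gamma k)
        = 4 * signed_area (period n) gamma /\
      signed_area (period n) (SC n gamma (n + k)%N)
        + 4 * signed_area (period n) (wigner gamma k)
        = 4 * signed_area (period n) gamma) /\
    signed_area (period n) (SC n gamma n)
      + 8 * signed_area (n%:R * pi) (wigner gamma n)
      = 4 * signed_area (period n) gamma) /\
  (* (vii) *)
  (exists (T : R) (f : R -> R * R) (p : R -> R),
    [/\ n_rosette n T f, generic T f, support_function n T f p &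
        (SC_cusps n (polar_tangential p) #= `I_(2 * (n - 1)))%card]) /\
  (forall (T : R) (f : R -> R * R) (p : R -> R),
    n_rosette n T f -> generic T f -> support_function n T f p ->
    (`I_(2 * (n - 1)) #<= SC_cusps n (polar_tangential p))%card).
Proof.
split; last split.
- move=> T f p [cf rf _ _] gf [phi [[sphi phi_incr] phi_period f_dir pE]] gamma.
  (* The next facts transfer the hypotheses on [f] to [gamma] and [rho]; after that only (i), which
     speaks of the parallel locus of [f], returns to [f] itself. *)
  pose rho := radius f phi.
  have tg := tangent_curve_gamma cf rf sphi f_dir pE : tangent_curve gamma rho.
  have rho_gt0 := radius_gt0 rf phi_incr : forall theta, 0 < rho theta.
  have gam_period := gamma_period cf sphi phi_period f_dir pE :
    forall theta, gamma (theta + period n) = gamma theta.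
  have rho_period := radius_period cf rf sphi phi_period f_dir pE :
    forall theta, rho (theta + period n) = rho theta.
  have rho_generic (j : nat) (theta : R) : ~~ odd j -> (0 < j < 2 * n)%N ->
      rho theta = rho (theta + j%:R * pi) ->
      derive1 rho theta <> derive1 rho (theta + j%:R * pi).
    exact: (generic_radius cf rf sphi phi_incr phi_period f_dir gf).
  have par := branch_parameterization hn cf sphi phi_incr phi_period f_dir pE.
  have bij := branch_locus_bij hn cf rf sphi phi_incr phi_period f_dir.
  have nsg k (hk : SC_indices n k) := branch_singularP hn tg rho_gt0 rho_period hk.
  split; last split; last split; last split; last split; last split; last split;
    last split; last split.
  + exists (branch_locus n T phi); split => //.
    * apply: card_eq_trans (card_SC_indices hn).
      have [bf bi bs] := bij.
      have <- : branch_locus n T phi @` SC_indices n = SC_components T f.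
        by apply/seteqP; split => // _ [k hk <-]; exact: bf.
      exact: inj_card_eq bi.
    * move=> k /andP[k1 kn]; split; last by apply: par; rewrite /SC_indices /=; lia.
      by apply/funext => t; rewrite /SC /SC_fst /SC_snd kn.
    * move=> k /andP[k1 kn]; split; last by apply: par; rewrite /SC_indices /=; lia.
      by apply/funext => t; rewrite /SC /SC_fst /SC_snd (_ : (n + k <= n)%N = false) ?addKn//; lia.
  + by move=> k hk; exact: SC_reflection.
  + exact: SC_centrally_symmetric gam_period.
  + move=> k hk; split; first by move=> t; exact: (SC_singular_cusp hn tg rho_gt0 rho_generic hk).
    by move=> nu; exact: (unit_normal_field_SC tg rho_gt0 k).
  + split; last exact: card_expected_rosettes.
    have ros k (hk : SC_indices n k) := SC_rosetteP hn tg rho_gt0 gam_period rho_period hk.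
    apply/seteqP; split => k.
      by move=> [hk /(ros k hk) ok]; apply/(expected_rosettesP hn).
    by move=> /(expected_rosettesP hn)[hk ok]; split => //; apply/(ros k hk).
  + split; last split; last first.
    * move=> k hk _; have [s [us Hs os]] := cusps_seq hn tg rho_gt0 rho_period rho_generic hk.
      by exists (size s) => //; exact: card_seq_set.
    * exact: card_expected_singular.
    apply/seteqP; split => k.
      by move=> [hk /(nsg k hk) ok]; apply/(expected_singularP hn).
    by move=> /(expected_singularP hn)[hk ok]; split => //; apply/(nsg k hk).
  + by move=> k; exact: (length_SC_nonsingular hn tg rho_gt0 rho_period).
  + by move=> k _ _; exact: (length_SC_le hn tg rho_gt0 rho_period).
  + by move=> k; exact: (signed_area_SC_wigner hn tg gam_period rho_period).
  + exact: (signed_area_SC_wigner_n hn tg gam_period rho_period).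
- exists (period n), (@ex_curve R n), (@ex_support R n); split.
  + exact: ex_n_rosette.
  + exact: ex_generic.
  + exact: ex_support_function.
  + exact: ex_card_cusps.
- move=> T f p [cf rf _ _] gf [phi [[sphi phi_incr] phi_period f_dir pE]].
  apply: (@SC_cusps_ge R n hn _ (radius f phi)).
  + exact: (tangent_curve_gamma cf rf sphi f_dir pE).
  + exact: (radius_gt0 rf phi_incr).
  + exact: (radius_period cf rf sphi phi_period f_dir pE).
  + by move=> j theta; exact: (generic_radius cf rf sphi phi_incr phi_period f_dir gf).
Qed.
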